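(* Let $m\ge 1$, let $X_1,\dots,X_m,Y$ be Banach spaces, and let $T:X_1\times\cdots\times X_m\to Y$ be $m$-linear, where $Y$ has cotype $q$. Let $r,p\in[1,+\infty)$, assume that $T$ is separately $(r,p)$-summing, and let $t\in[p,+\infty)$. (1) If $\frac 1r+\frac{1}{p^*}-\frac{m}{t^*}>\frac 1q$, then $T$ is multiple $(s,t)$-summing with $$\frac 1s=\frac{m-1}{mq}+\frac 1{mr}+\frac{1}{mp^*}-\frac{1}{t^*}.$$ (2) If $0<\frac 1r+\frac{1}{p^*}-\frac{m}{t^*}\leq \frac 1q$, then $T$ is multiple $(s,t)$-summing with $$\frac1s=\frac1r+\frac 1{p^*}-\frac{m}{t^*}.$$ (3) When $1\le p=t\le 2$ and $q=2$, these values of $s$, namely $\frac 1s=\frac{m-1}{2m}+\frac 1{mr}+\frac{1}{mp^*}-\frac{1}{p^*}$ if $\frac 1r+\frac{1}{p^*}-\frac{m}{p^*}>\frac 12$, and $\frac1s=\frac1r+\frac 1{p^*}-\frac{m}{p^*}$ if $0<\frac 1r+\frac{1}{p^*}-\frac{m}{p^*}\leq \frac 12$, are optimal: for every $m\ge 1$, every $p\in[1,2]$ and every $r\ge p$ with $\frac1r\ge\frac1p-\frac12$ and $\frac1r-\frac{m-1}{p^*}>0$, if $s$ denotes the value given by whichever of these two formulas applies, then for every $s'\in[1,s)$ there exist Banach spaces $X_1,\dots,X_m$, a Banach space $Y$ of cotype $2$, and an $m$-linear map $T:X_1\times\cdots\times X_m\to Y$ which is separately $(r,p)$-summing but not multiple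 $(s',p)$-summing.
   Context: For $p\in[1,+\infty)$, $p^*$ denotes the conjugate exponent, $\frac1p+\frac1{p^*}=1$ (with $\frac1{p^*}=0$ if $p=1$). For a sequence $x=(x_i)_{i\in\mathbb N}$ in a Banach space $X$, $w_p(x)=\sup_{\|x^*\|\le1}\big(\sum_{i}|x^*(x_i)|^p\big)^{1/p}$, the supremum being over $x^*$ in the unit ball of $X^*$. For $r\ge1$ and $\mathbf p=(p_1,\dots,p_m)\in[1,+\infty)^m$, an $m$-linear map $T:X_1\times\cdots\times X_m\to Y$ between Banach spaces is multiple $(r,\mathbf p)$-summing if there is $C>0$ such that for all sequences $x(j)=(x_i(j))_{i\in\mathbb N}\subset X_j$, $1\le j\le m$, $$\Big(\sum_{\mathbf i\in\mathbb N^m}\|T(x_{i_1}(1),\dots,x_{i_m}(m))\|^r\Big)^{1/r}\le C\,w_{p_1}(x(1))\cdots w_{p_m}(x(m)).$$ If all $p_j$ equal the same $p$, one says multiple $(r,p)$-summing. For $m=1$ this is the usual notion of $(r,p)$-summing linear operator. $T$ is separately $(r,p)$-summing if for each $k$, and each choice of fixed vectors in the other coordinates, the induced linear map $X_k\to Y$ is $(r,p)$-summing. Cotype $q$ ($2\le q<\infty$) has its usual meaning in Banach space theory. *)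

(* Defs.v *)
From HB Require Import structures.
From mathcomp Require Import all_boot all_order all_algebra.
From mathcomp Require Import complex.
From mathcomp Require Import all_classical all_reals all_analysis.

Set Implicit Arguments.
Unset Strict Implicit.
Unset Printing Implicit Defensive.

Import Order.TTheory GRing.Theory Num.Theory.
Import numFieldNormedType.Exports.

Local Open Scope classical_set_scope.
Local Open Scope ring_scope.

(* A Banach space is real or complex.  The library's norm on a normed module
   over K takes its values in K itself, so the scalar field comes together with
   the map K -> R used to read these (real, nonnegative) values in R. *)
Variant scalar_field (R : realType) : forall K : numFieldType, (K -> R) -> Prop :=
| real_scalars : @scalar_field R R id
| complex_scalars : @scalar_field R R[i] (@complex.Re R).

(* 1 / p^*, hence 0 when p = 1 *)
Definition inv_conj (R : realType) (p : R) : R :=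
  fine (inve (hoelder_conjugate p%:E)).

Lemma inv_conjE (R : realType) (p : R) : 1 <= p -> inv_conj p = 1 - p^-1.
Proof.
move=> p1; have p0 : p != 0 by rewrite gt_eqF// (lt_le_trans ltr01).
have := @hoelder_conjugate_eq1 R p%:E (ltNyr _) p0.
rewrite /inv_conj inver (negbTE p0).
by case: (inve _) => [c||]//= [<-]; rewrite [_ + c]addrC addrK.
Qed.

Section summing.
Context (R : realType) (K : numFieldType) (re : K -> R).

Definition rnorm (X : normedModType K) (x : X) : R := re `|x|.

(* The closed unit ball of X^*: functionals with sup_(`|x| <= 1) `|phi x| <= 1 *)
Definition dual_ball (X : normedModType K) : set {linear X -> K^o} :=
  [set phi | forall x : X, `|x| <= 1 -> `|phi x| <= 1].

Definition weak_norm (p : R) (X : normedModType K) (x : nat -> X) : \bar R :=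
  ereal_sup [set ((\sum_(i <oo) (rnorm (phi (x i)) `^ p)%:E) `^ p^-1)%E
            | phi in @dual_ball X].

Definition summing (r p : R) (X Y : normedModType K) (u : X -> Y) : Prop :=
  exists2 C : R, 0 < C & forall x : nat -> X,
    ((\sum_(i <oo) (rnorm (u (x i)) `^ r)%:E) `^ r^-1 <= C%:E * weak_norm p x)%E.

Definition multilinear (m : nat) (X : 'I_m -> completeNormedModType K)
    (Y : completeNormedModType K) (T : (forall j, X j) -> Y) : Prop :=
  forall (k : 'I_m) (x : forall j, X j), linear (fun u : X k => T (dfwith x k u)).

Definition multiple_summing (m : nat) (r : R) (p : 'I_m -> R)
    (X : 'I_m -> completeNormedModType K)
    (Y : completeNormedModType K) (T : (forall j, X j) -> Y) : Prop :=
  exists2 C : R, 0 < C & forall x : (forall j, nat -> X j),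
    ((\esum_(i in [set: {ffun 'I_m -> nat}])
        (rnorm (T (fun j => x j (i j))) `^ r)%:E) `^ r^-1
     <= C%:E * \prod_(j < m) weak_norm (p j) (x j))%E.

Definition separately_summing (m : nat) (r p : R)
    (X : 'I_m -> completeNormedModType K)
    (Y : completeNormedModType K) (T : (forall j, X j) -> Y) : Prop :=
  forall (k : 'I_m) (x : forall j, X j),
    summing r p (fun u : X k => T (dfwith x k u)).

Definition cotype (q : R) (Y : normedModType K) : Prop :=
  exists2 C : R, 0 < C & forall (n : nat) (y : 'I_n -> Y),
    (\sum_(i < n) rnorm (y i) `^ q) `^ q^-1
    <= C * Num.sqrt (2 ^- n * \sum_(e : {ffun 'I_n -> bool})
                       rnorm (\sum_(i < n) (-1) ^+ e i *: y i) ^+ 2).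

End summing.

(* Main.v *)
(* Parts (1) and (2).  By the uniform boundedness principle the (r,p)-summing
   constants of the one-variable restrictions of T are uniform over unit balls in
   the other variables.  Multiplying a weakly t-summable sequence by an l_1-sequence
   to the power 1/p - 1/t makes it weakly p-summable, while the power 1/t^* makes
   its signed sums bounded, so averaging over random signs (multilinear cotype q,
   via Kahane's inequality) gives, for the array c_i = |T(x_i)|^q, estimates on all
   its one-dimensional fibers that hold for every choice of such multipliers.  These
   multipliers are removed one variable at a time, by Young's inequality and a
   duality argument, which raises the exponent of the sum over fibers.  When
   1/r + 1/p^* - m/t^* > 1/q this exponent stays below that of the inner sums, and
   Blei's inequality combines the m mixed-norm bounds; otherwise it reaches it, fiber
   sums and total sum coincide, and the rest is removed from the total sum.

   Part (3).  T(x)_i = w_i x_1(i_1) ... x_m(i_m) maps l_u x ... x l_u to l_2(N^m).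
   Freezing all variables but one yields an operator dominated by a diagonal one
   l_u -> l_2, which is (r,p)-summing when its multiplier is in l_r.  In the first
   range 1/u is close to 1/p^* and w_i is a negative power of max_j i_j; in the second
   one u = p^* and w is a negative power supported on the diagonal i_1 = ... = i_m.
   Testing on the unit vectors bounds the admissible exponents. *)

Require Import Defs.
From HB Require Import structures.
From mathcomp Require Import all_boot all_order all_algebra.
From mathcomp Require Import complex.
From mathcomp Require Import all_classical all_reals all_analysis.
From mathcomp Require Import ring lra.

Set Implicit Arguments.
Unset Strict Implicit.
Unset Printing Implicit Defensive.

Import Order.TTheory GRing.Theory Num.Theory.
Import numFieldNormedType.Exports.

Local Open Scope ring_scope.

(** * Real powers and sums *)

(** Multipliers are kept as powers alpha^lam of sub-probability vectors: a product of two such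
    powers is dominated by a single one with the exponents added, so only exponents need
    bookkeeping. The array is divided once by its constant; every bound then reads [<= 1], the
    removal steps lose nothing, and they can be iterated over the m variables. With V = 1/r + 1/p^*,
    the fiber exponent of |T|^q starts at k = 1/(q V) and the multiplier exponent at q/t^*. Removing
    one multiplier subtracts q/t^* from 1/k, which leaves E = q V - m q/t^* in the end. Passing from
    one fiber direction to another requires exponents at most 1, and this is why E = 1 is the
    threshold between the two ranges. All of this happens on finite families, where no question of
    convergence arises.

    For optimality, l_u needs a finite u, so u = p^* is impossible when p = 1. The second range then
    forces r = 2, the boundary at which the two formulas for s agree, and the first construction
    covers this case. *)

Section FiniteSums.
Context {R : realType}.
Implicit Types (a b c r s x : R) (I J : finType).

(** At base 0 the rule survives because r + s = 0 forces r = s = 0, where 0^0 = 1. *)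
Lemma powRD_ge0 a r s : 0 <= r -> 0 <= s -> a `^ (r + s) = a `^ r * a `^ s.
Proof.
move=> r0 s0; have [->|a0] := eqVneq a 0; last by rewrite powRD ?a0 ?implybT.
have [->|rn] := eqVneq r 0; first by rewrite add0r powRr0 mul1r.
by rewrite [0 `^ r]powR0// mul0r powR0// gt_eqF// ltr_pwDl// lt_neqAle eq_sym rn.
Qed.

Lemma powR_le a b r : 0 <= r -> 0 <= a -> a <= b -> a `^ r <= b `^ r.
Proof. by move=> r0 a0 ab; apply: ge0_ler_powR; rewrite ?nnegrE// (le_trans a0). Qed.

Lemma powRK a r : 0 <= a -> r != 0 -> (a `^ r) `^ r^-1 = a.
Proof. by move=> a0 r0; rewrite -powRrM divff// powRr1. Qed.

Lemma powRVK a r : 0 <= a -> r != 0 -> (a `^ r^-1) `^ r = a.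
Proof. by move=> a0 r0; rewrite -powRrM mulVf// powRr1. Qed.

Lemma powRV a r : 0 <= a -> a^-1 `^ r = (a `^ r)^-1.
Proof. by move=> a0; rewrite -powR_inv1// -powRrM mulN1r powRN. Qed.

Lemma powR_le1 a r : 0 <= r -> 0 <= a -> a <= 1 -> a `^ r <= 1.
Proof. by move=> r0 a0 a1; have := powR_le r0 a0 a1; rewrite powR1. Qed.

Lemma powR_leK a b r : 0 < r -> 0 <= a -> 0 <= b -> a `^ r <= b `^ r -> a <= b.
Proof.
move=> r0 a0 b0 /(powR_le (_ : 0 <= r^-1)) h.
have := h _ (powR_ge0 _ _); rewrite !powRK ?gt_eqF//; apply.
by rewrite invr_ge0 ltW.
Qed.

Lemma powR_le_le1 a r s : 0 <= a <= 1 -> 0 <= r -> r <= s -> a `^ s <= a `^ r.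
Proof.
move=> /andP[a0 a1] r0 rs; have <- : r + (s - r) = s by rewrite addrC subrK.
by rewrite powRD_ge0 ?subr_ge0// ler_piMr ?powR_ge0// powR_le1 ?subr_ge0.
Qed.

Lemma powR_young a b x : 0 <= a -> 0 <= b -> 0 <= x <= 1 ->
  a `^ x * b `^ (1 - x) <= x * a + (1 - x) * b.
Proof.
move=> a0 b0 /andP[x0 x1].
have [->|xn0] := eqVneq x 0.
  by rewrite powRr0 subr0 powRr1// !mul1r mul0r add0r.
have [->|xn1] := eqVneq x 1.
  by rewrite powRr1// subrr powRr0 mulr1 mul1r mul0r addr0.
have xp : 0 < x by rewrite lt_neqAle eq_sym xn0.
have yp : 0 < 1 - x by rewrite subr_gt0 lt_neqAle xn1.
have := @conjugate_powR R (a `^ x) (b `^ (1 - x)) x^-1 (1 - x)^-1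
  (powR_ge0 _ _) (powR_ge0 _ _).
rewrite !invr_gt0 !invrK => /(_ xp yp); rewrite addrC subrK => /(_ erefl).
by rewrite !powRK ?gt_eqF// [a * x]mulrC [b * _]mulrC.
Qed.

(** Normalize both sums to 1 and apply the weighted arithmetic-geometric mean termwise. Writing the
    exponents as x and 1 - x keeps the endpoints x = 0 and x = 1 available. *)
Lemma sum_hoelder I (P : pred I) (f g : I -> R) x :
  (forall i, 0 <= f i) -> (forall i, 0 <= g i) -> 0 <= x <= 1 ->
  \sum_(i | P i) f i `^ x * g i `^ (1 - x) <=
  (\sum_(i | P i) f i) `^ x * (\sum_(i | P i) g i) `^ (1 - x).
Proof.
move=> f0 g0 x01; have /andP[x0 x1] := x01.
have [->|xn0] := eqVneq x 0.
  rewrite powRr0 subr0 mul1r powRr1 ?sumr_ge0//.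
  by apply: ler_sum => i _; rewrite powRr0 mul1r powRr1.
have [->|xn1] := eqVneq x 1.
  rewrite subrr powRr0 mulr1 powRr1 ?sumr_ge0//.
  by apply: ler_sum => i _; rewrite powRr0 mulr1 powRr1.
have yn0 : 1 - x != 0 by rewrite subr_eq0 eq_sym.
set F := \sum_(i | P i) f i; set G := \sum_(i | P i) g i.
have F0 : 0 <= F by exact: sumr_ge0.
have G0 : 0 <= G by exact: sumr_ge0.
have [Fz|Fn] := eqVneq F 0.
  rewrite big1 ?mulr_ge0 ?powR_ge0// => i Pi.
  by rewrite (psumr_eq0P _ Fz)// powR0// mul0r.
have [Gz|Gn] := eqVneq G 0.
  rewrite big1 ?mulr_ge0 ?powR_ge0// => i Pi.
  by rewrite (psumr_eq0P _ Gz)// [0 `^ _]powR0// mulr0.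
have Fp : 0 < F by rewrite lt_neqAle eq_sym Fn.
have Gp : 0 < G by rewrite lt_neqAle eq_sym Gn.
rewrite -[leRHS]mulr1 -ler_pdivrMl ?mulr_gt0 ?powR_gt0// mulr_sumr.
rewrite [leRHS](_ : 1 = \sum_(i | P i) (x * (f i / F) + (1 - x) * (g i / G))); last first.
  rewrite big_split/= -!mulr_sumr -!mulr_suml -/F -/G !divff// !mulr1.
  by rewrite addrC subrK.
apply: ler_sum => i _; apply: le_trans (powR_young _ _ x01).
- rewrite !powRM ?invr_ge0// !powRV//.
  by rewrite invfM mulrACA [(F `^ x)^-1 * _]mulrC [(G `^ _)^-1 * _]mulrC.
- by rewrite divr_ge0.
- by rewrite divr_ge0.
Qed.

(** Each term f_i^r is f_i times f_i^(r - 1), which is at most F^(r - 1). *)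
Lemma sum_powR_le I (P : pred I) (f : I -> R) r : 1 <= r ->
  (forall i, 0 <= f i) ->
  \sum_(i | P i) f i `^ r <= (\sum_(i | P i) f i) `^ r.
Proof.
move=> r1 f0; set F := \sum_(i | P i) f i.
have F0 : 0 <= F by exact: sumr_ge0.
rewrite -[F `^ r]mulr_powRB1 ?(lt_le_trans ltr01)// mulr_suml ler_sum// => i Pi.
rewrite -mulr_powRB1 ?(lt_le_trans ltr01)// ler_wpM2l// powR_le ?subr_ge0//.
by rewrite /F (bigD1 i)//= lerDl sumr_ge0.
Qed.

Lemma sum_minkowski I (P : pred I) (f g : I -> R) r : 1 <= r ->
  (forall i, 0 <= f i) -> (forall i, 0 <= g i) ->
  (\sum_(i | P i) (f i + g i) `^ r) `^ r^-1 <=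
  (\sum_(i | P i) f i `^ r) `^ r^-1 + (\sum_(i | P i) g i `^ r) `^ r^-1.
Proof.
move=> r1 f0 g0; have r0 : 0 < r by rewrite (lt_le_trans ltr01).
have rV : 0 <= r^-1 <= 1 by rewrite invr_ge0 ltW//= invf_le1.
set S := \sum_(i | P i) (f i + g i) `^ r.
have S0 : 0 <= S by apply: sumr_ge0 => i _; exact: powR_ge0.
have [Sz|Sn] := eqVneq S 0.
  by rewrite Sz powR0 ?invr_eq0 ?gt_eqF// addr_ge0 ?powR_ge0.
have Sp : 0 < S by rewrite lt_neqAle eq_sym Sn.
(* Hölder against (f + g)^(r - 1), which is the power 1 - 1/r of (f + g)^r; hence the common factor
   S^(1 - 1/r), divided out at the end. *)
have H (h : I -> R) : (forall i, 0 <= h i) ->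
    \sum_(i | P i) h i * (f i + g i) `^ (r - 1) <=
    (\sum_(i | P i) h i `^ r) `^ r^-1 * S `^ (1 - r^-1).
  move=> h0; apply: le_trans (sum_hoelder _ _ _ _) => //; last first.
  - by move=> i; exact: powR_ge0.
  - by move=> i; exact: powR_ge0.
  apply: ler_sum => i _; rewrite powRK ?gt_eqF// -powRrM mulrBr mulr1 divff// gt_eqF//.
have : S <= ((\sum_(i | P i) f i `^ r) `^ r^-1 + (\sum_(i | P i) g i `^ r) `^ r^-1)
    * S `^ (1 - r^-1).
  rewrite mulrDl; apply: le_trans (lerD (H _ f0) (H _ g0)).
  rewrite -big_split/= ler_sum// => i _.
  by rewrite -mulrDl mulr_powRB1// addr_ge0.
rewrite -ler_pdivrMr ?powR_gt0//; apply: le_trans.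
by rewrite ler_pdivlMr ?powR_gt0// -powRD ?Sn ?implybT// addrC subrK powRr1.
Qed.

(** Induction on an enumeration of [J]. It serves to pull averages over signs out of an l_q norm. *)
Lemma sum_minkowski_sum I J (P : pred I) (Q : pred J) (f : I -> J -> R) r : 1 <= r ->
  (forall i j, 0 <= f i j) ->
  (\sum_(i | P i) (\sum_(j | Q j) f i j) `^ r) `^ r^-1 <=
  \sum_(j | Q j) (\sum_(i | P i) f i j `^ r) `^ r^-1.
Proof.
move=> r1 f0; have r0 : 0 < r by rewrite (lt_le_trans ltr01).
elim: (index_enum J) => [|j s IH].
  rewrite [leRHS]big_nil big1 ?powR0 ?invr_eq0 ?gt_eqF// => i _.
  by rewrite big_nil powR0 ?gt_eqF.
have -> : \sum_(i | P i) (\sum_(j <- j :: s | Q j) f i j) `^ r =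
    \sum_(i | P i) ((if Q j then f i j else 0) + \sum_(j <- s | Q j) f i j) `^ r.
  by apply: eq_bigr => i _; rewrite big_cons; case: ifP; rewrite ?add0r.
have f'0 i : 0 <= if Q j then f i j else 0 by case: ifP.
have g0 i : 0 <= \sum_(j <- s | Q j) f i j by exact: sumr_ge0.
apply: le_trans (sum_minkowski P r1 f'0 g0) _.
rewrite big_cons; case: ifP => Qj; first exact: lerD.
rewrite -[leRHS]add0r lerD//.
by rewrite big1 ?powR0 ?invr_eq0 ?gt_eqF// => i _; rewrite powR0 ?gt_eqF.
Qed.

Lemma sum_powR_norm_le I (P : pred I) (f : I -> R) r s : 0 < r -> r <= s ->
  (forall i, 0 <= f i) ->
  (\sum_(i | P i) f i `^ s) `^ s^-1 <= (\sum_(i | P i) f i `^ r) `^ r^-1.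
Proof.
move=> r0 rs f0; have s0 := lt_le_trans r0 rs.
apply: (powR_leK s0); [exact: powR_ge0|exact: powR_ge0|].
rewrite powRVK; last by rewrite gt_eqF.
  rewrite -powRrM [_^-1 * _]mulrC; apply: le_trans (sum_powR_le _ _ _).
  - by apply: ler_sum => i _; rewrite -powRrM mulrCA divff ?mulr1// gt_eqF.
  - by rewrite ler_pdivlMr// mul1r.
  - by move=> i; exact: powR_ge0.
by apply: sumr_ge0 => i _; exact: powR_ge0.
Qed.

End FiniteSums.

(** * Multipliers and mixed norms *)

Section Multipliers.
Context {R : realType}.

(** Mass at most 1, not equal to 1: the zero vector is admissible, also on an empty type, and with
    exponent 0 it is the trivial multiplier because 0^0 = 1. *)
Definition sub_prob (J : finType) (g : J -> R) :=
  (forall j, 0 <= g j) /\ \sum_j g j <= 1.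

(** Converse of Hölder's inequality: the extremal g is w^v / Z with v = 1/(1 - d), and on it the
    tested sum equals Z^(1 - d). *)
Lemma sub_prob_dual (J : finType) (w : J -> R) (d : R) :
  (forall j, 0 <= w j) -> 0 <= d < 1 ->
  (forall g, sub_prob g -> \sum_j g j `^ d * w j <= 1) ->
  \sum_j w j `^ (1 - d)^-1 <= 1.
Proof.
move=> w0 /andP[d0 d1] H; set v := (1 - d)^-1.
have d1' : 0 < 1 - d by rewrite subr_gt0.
have v0 : 0 < v by rewrite invr_gt0.
set Z := \sum_j w j `^ v.
have Z0 : 0 <= Z by apply: sumr_ge0 => j _; exact: powR_ge0.
have [->//|Zn] := eqVneq Z 0.
have Zp : 0 < Z by rewrite lt_neqAle eq_sym Zn.
have := H (fun j => w j `^ v / Z).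
have -> : \sum_j (w j `^ v / Z) `^ d * w j = Z `^ (1 - d).
  transitivity (\sum_j w j `^ v * (Z^-1) `^ d).
    apply: eq_bigr => j _; rewrite powRM ?powR_ge0 ?invr_ge0//.
    rewrite mulrAC -powRrM; congr (_ * _).
    rewrite -[X in _ * X]powRr1// -powRD_ge0 ?mulr_ge0 ?(ltW v0)//.
    by congr (_ `^ _); rewrite /v; field; rewrite gt_eqF.
  rewrite -mulr_suml -/Z powRV// -{1}[Z]powRr1// -powRN -powRD//.
  by rewrite Zn implybT.
move=> H1; have {H1} le1 : Z `^ (1 - d) <= 1.
  apply: H1; split; first by move=> j; rewrite divr_ge0 ?powR_ge0.
  by rewrite -mulr_suml divff.
by apply: (powR_leK d1'); rewrite ?powR1.
Qed.

(** Hölder within each row turns the first hypothesis into a bound that is linear in g^(d k), with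
    coefficients [Dj]; duality then controls the sum of D^(k'/k). The row sums to the power k' are
    interpolated between [Dj] and the column sums [Cj]. *)
Lemma matrix_step (I J : finType) (b : I -> J -> R) (k k' : R) :
  (forall i j, 0 <= b i j) -> 0 < k -> k <= k' -> k' <= 1 ->
  (forall g, sub_prob g ->
    \sum_i (\sum_j g j `^ (k^-1 - k'^-1) * b i j) `^ k <= 1) ->
  \sum_j (\sum_i b i j) `^ k' <= 1 ->
  \sum_i (\sum_j b i j) `^ k' <= 1.
Proof.
move=> b0 k0 kk' k'1 H1 H2; have k'0 := lt_le_trans k0 kk'.
have kn : k != 0 by rewrite gt_eqF.
have k'n : k' != 0 by rewrite gt_eqF.
set d := k^-1 - k'^-1 in H1.
have d0 : 0 <= d by rewrite subr_ge0 lef_pV2.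
have dk : d * k = 1 - k / k' by rewrite mulrBl mulVf// mulrC.
(* For k = 1 also k' = 1 and d = 0: the first hypothesis at g = 0 is the claim, as 0^0 = 1.
   Afterwards one may divide by 1 - k. *)
have [k1|k1] := eqVneq k 1.
  have k'E : k' = 1 by apply/eqP; rewrite eq_le k'1 -k1 kk'.
  have d00 : d = 0 by rewrite /d k'E k1 subrr.
  have := H1 (fun=> 0) _; rewrite d00 k'E k1.
  under eq_bigr do under eq_bigr do rewrite powRr0 mul1r.
  by apply; split=> //; rewrite big1.
have {k1} k1 : 0 < 1 - k by rewrite subr_gt0 lt_neqAle k1 (le_trans kk').
pose Ri i := \sum_j b i j; pose Cj j := \sum_i b i j.
pose Dj j := \sum_i b i j * Ri i `^ (k - 1).
have R0 i : 0 <= Ri i by exact: sumr_ge0.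
have C0 j : 0 <= Cj j by exact: sumr_ge0.
have D0 j : 0 <= Dj j by apply: sumr_ge0 => i _; rewrite mulr_ge0 ?powR_ge0.
have HD : \sum_j Dj j `^ (k' / k) <= 1.
  have -> : k' / k = (1 - d * k)^-1 by rewrite dk opprB addrC subrK invf_div.
  apply: sub_prob_dual => //.
    by rewrite mulr_ge0 ?(ltW k0)//= dk gtrBl divr_gt0.
  move=> g g1; apply: le_trans (H1 _ g1).
  under eq_bigr do rewrite mulr_sumr.
  rewrite exchange_big/= ler_sum// => i _.
  under eq_bigr do rewrite mulrA.
  rewrite -mulr_suml.
  have jensen : \sum_j g j `^ (d * k) * b i j <=
      (\sum_j g j `^ d * b i j) `^ k * Ri i `^ (1 - k).
    have k01 : 0 <= k <= 1 by rewrite (ltW k0)//= (le_trans kk').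
    have gb0 j : 0 <= g j `^ d * b i j by rewrite mulr_ge0 ?powR_ge0.
    apply: le_trans (sum_hoelder _ gb0 (b0 i) k01).
    apply: ler_sum => j _; rewrite powRM ?powR_ge0// -powRrM -mulrA.
    by rewrite -powRD_ge0 ?(ltW k0) ?(ltW k1)// addrC subrK powRr1.
  apply: le_trans (ler_wpM2r (powR_ge0 _ _) jensen) _.
  rewrite -mulrA ler_piMr ?powR_ge0//.
  have [->|Rn] := eqVneq (Ri i) 0; first by rewrite powR0 ?mul0r// gt_eqF.
  by rewrite -powRD ?Rn ?implybT// addrA subrK subrr powRr0.
(* This x gives b R^(k' - 1) = (b R^(k - 1))^x b^(1 - x). Hölder in i produces D^x C^(1 - x), and y
   = x k / k' fits Hölder in j, since 1 - y = (1 - x) / k'. *)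
pose x := (1 - k') / (1 - k).
have kn1 : 1 - k != 0 by rewrite gt_eqF.
have kn1' : k - 1 != 0 by rewrite -opprB oppr_eq0.
have x0 : 0 <= x by rewrite divr_ge0 ?subr_ge0// (le_trans kk').
have x1 : x <= 1 by rewrite ler_pdivrMr// mul1r lerD2l lerN2.
have x01 : 0 <= x <= 1 by rewrite x0.
pose y := x * k / k'.
have y01 : 0 <= y <= 1.
  apply/andP; split.
    by rewrite divr_ge0 ?(ltW k'0)// mulr_ge0 ?(ltW k0).
  by rewrite ler_pdivrMr// mul1r; apply: le_trans kk'; rewrite ler_piMl// (ltW k0).
have yE : 1 - y = (1 - x) / k'.
  by rewrite /y /x; field; rewrite ?k'n ?kn1 ?kn1'.
have -> : \sum_i (\sum_j b i j) `^ k' =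
    \sum_j \sum_i (b i j * Ri i `^ (k - 1)) `^ x * b i j `^ (1 - x).
  rewrite exchange_big/=; apply: eq_bigr => i _.
  rewrite -(mulr_powRB1 (R0 i) k'0) {1}/Ri mulr_suml; apply: eq_bigr => j _.
  rewrite powRM ?powR_ge0// -powRrM mulrAC.
  rewrite -powRD_ge0 ?subr_ge0// [x + _]addrC subrK powRr1//.
  by congr (_ * _ `^ _); rewrite /x; field; rewrite ?kn1 ?kn1'.
have H i j : 0 <= b i j * Ri i `^ (k - 1) by rewrite mulr_ge0 ?powR_ge0.
apply: (@le_trans _ _ (\sum_j Dj j `^ x * Cj j `^ (1 - x))).
  apply: ler_sum => j _.
  exact: (sum_hoelder xpredT (fun i => H i j) (fun i => b0 i j) x01).
have -> : \sum_j Dj j `^ x * Cj j `^ (1 - x) =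
    \sum_j (Dj j `^ (k' / k)) `^ y * (Cj j `^ k') `^ (1 - y).
  have e1 : k' / k * y = x by rewrite /y; field; rewrite kn k'n.
  have e2 : k' * (1 - y) = 1 - x by rewrite yE mulrC divfK.
  by apply: eq_bigr => j _; rewrite -!powRrM e1 e2.
apply: le_trans (sum_hoelder _ _ _ y01) _; [by move=> j; exact: powR_ge0..|].
have /andP[y0 y1] := y01.
apply: mulr_ile1; rewrite ?powR_ge0// powR_le1 ?subr_ge0//.
- by apply: sumr_ge0 => j _; exact: powR_ge0.
- by apply: sumr_ge0 => j _; exact: powR_ge0.
Qed.

End Multipliers.

(** * Removing multipliers from multi-indexed arrays *)

Section MultiIndex.
Context {R : realType} (m : nat) (A : finType) (c : {ffun 'I_m -> A} -> R).
Hypothesis c0 : forall i, 0 <= c i.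
Implicit Types (lam : 'I_m -> R) (alpha : 'I_m -> A -> R) (k s : R).

Definition weight lam alpha (i : {ffun 'I_m -> A}) : R :=
  \prod_j alpha j (i j) `^ lam j.

(** All directions l are bounded together, because removing the multiplier of one variable in
    another direction uses the bound in that variable's own direction. The exponents depend on the
    variable since the multipliers disappear one at a time. *)
Definition fiber_bound lam k := forall (l : 'I_m) alpha,
  (forall j, sub_prob (alpha j)) ->
  \sum_a (\sum_(i : {ffun 'I_m -> A} | i l == a) weight lam alpha i * c i) `^ k <= 1.

Definition total_bound lam s := forall alpha, (forall j, sub_prob (alpha j)) ->
  \sum_i (weight lam alpha i * c i) `^ s <= 1.

Lemma weight_ge0 lam alpha i : 0 <= weight lam alpha i.
Proof. by apply: prodr_ge0 => j _; exact: powR_ge0. Qed.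

Lemma sub_prob_conv (g h : A -> R) x : 0 <= x <= 1 -> sub_prob g -> sub_prob h ->
  sub_prob (fun a => x * g a + (1 - x) * h a).
Proof.
move=> /andP[x0 x1] [g0 g1] [h0 h1]; split=> [a|].
  by rewrite addr_ge0// mulr_ge0// subr_ge0.
rewrite big_split/= -!mulr_sumr -[leRHS](subrK x 1) addrC lerD//.
  by rewrite ler_piMr// subr_ge0.
by rewrite ler_piMr.
Qed.

(* Splitting off a factor [g `^ d] of one multiplier amounts to replacing that
   multiplier by a convex combination, by Young's inequality. *)
Lemma weight_split lam lam' (l : 'I_m) d alpha g :
  (forall j, j != l -> lam' j = lam j) -> lam l = lam' l + d ->
  0 <= lam' l -> 0 <= d -> (forall j, sub_prob (alpha j)) -> sub_prob g ->
  exists alpha', (forall j, sub_prob (alpha' j)) /\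
    forall i : {ffun 'I_m -> A}, g (i l) `^ d * weight lam' alpha i <= weight lam alpha' i.
Proof.
move=> lamE laml lam'0 d0 Ha Hg.
have [lam0|lam0] := eqVneq (lam l) 0.
  have d00 : d = 0 by apply/eqP; rewrite eq_le d0 andbT -lam0 laml lerDr.
  have lam'00 : lam' l = lam l by rewrite laml d00 addr0.
  exists alpha; split=> // i; rewrite d00 powRr0 mul1r /weight.
  rewrite [leRHS](eq_bigr (fun j => alpha j (i j) `^ lam' j))// => j _.
  by have [->|/lamE->] := eqVneq j l; rewrite ?lam'00.
have lamp : 0 < lam l by rewrite lt_neqAle eq_sym lam0 laml addr_ge0.
pose x := lam' l / lam l.
have x01 : 0 <= x <= 1.
  by rewrite divr_ge0 ?(ltW lamp)//= ler_pdivrMr// mul1r laml lerDl.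
have dE : d = (1 - x) * lam l by rewrite mulrBl divfK// mul1r laml addrC addKr.
have lam'E : lam' l = x * lam l by rewrite divfK.
exists (fun j => if j == l then fun a => x * alpha j a + (1 - x) * g a
  else alpha j); split=> [j|i].
  by case: eqP => // _; exact: sub_prob_conv.
rewrite /weight (bigD1 l)//= [leRHS](bigD1 l)//= eqxx mulrA.
rewrite [X in _ <= _ * X](eq_bigr (fun j => alpha j (i j) `^ lam' j)); last first.
  by move=> j jl; rewrite (negbTE jl) lamE.
rewrite ler_wpM2r ?prodr_ge0// => [j _|]; first exact: powR_ge0.
have a0 := (Ha l).1 (i l); have g0 := Hg.1 (i l).
rewrite mulrC {1}lam'E {1}dE (powRrM _ x) (powRrM _ (1 - x)) -powRM ?powR_ge0//.
apply: powR_le; rewrite ?(ltW lamp)// ?mulr_ge0 ?powR_ge0//.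
exact: powR_young.
Qed.

(** In the direction l the removed factor is constant on each fiber, so it leaves the inner sum and
    duality suffices. For l' <> l the array, summed over the remaining indices, becomes a matrix
    indexed by i l' and i l, and [matrix_step] applies, its second hypothesis being the direction l
    just treated. *)
Lemma fiber_step lam lam' (l : 'I_m) k k' :
  (forall j, j != l -> lam' j = lam j) ->
  lam l = lam' l + (k^-1 - k'^-1) -> 0 <= lam' l ->
  0 < k -> k <= k' -> k' <= 1 ->
  fiber_bound lam k -> fiber_bound lam' k'.
Proof.
move=> lamE laml lam'0 k0 kk' k'1 H.
have k'0 := lt_le_trans k0 kk'.
set d := k^-1 - k'^-1 in laml.
have d0 : 0 <= d by rewrite subr_ge0 lef_pV2.
have {}H l' alpha g : (forall j, sub_prob (alpha j)) -> sub_prob g ->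
    \sum_a (\sum_(i : {ffun 'I_m -> A} | i l' == a) g (i l) `^ d * (weight lam' alpha i * c i)) `^ k <= 1.
  move=> Ha Hg; have [alpha' [Ha' le_w]] := weight_split lamE laml lam'0 d0 Ha Hg.
  apply: le_trans (H l' _ Ha'); apply: ler_sum => a _; apply: powR_le.
  - exact: ltW.
  - by apply: sumr_ge0 => i _; rewrite !mulr_ge0 ?powR_ge0 ?weight_ge0.
  - by apply: ler_sum => i _; rewrite mulrA ler_wpM2r.
move=> l' alpha Ha; set c' := fun i => weight lam' alpha i * c i.
have c'0 i : 0 <= c' i by rewrite mulr_ge0 ?weight_ge0.
have Hl : \sum_a (\sum_(i : {ffun 'I_m -> A} | i l == a) c' i) `^ k' <= 1.
  have dk : d * k = 1 - k / k' by rewrite mulrBl mulVf ?gt_eqF// mulrC.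
  have := @sub_prob_dual R A (fun a => (\sum_(i : {ffun 'I_m -> A} | i l == a) c' i) `^ k) (d * k).
  rewrite [X in (1 - X)]dk opprB addrC subrK invf_div.
  under eq_bigr do rewrite -powRrM mulrC divfK ?gt_eqF//.
  apply=> [a||g Hg]; first exact: powR_ge0.
  - by rewrite mulr_ge0 ?(ltW k0)//= dk gtrBl divr_gt0.
  - apply: le_trans (H l alpha g Ha Hg); apply: ler_sum => a _.
    rewrite powRrM -powRM ?powR_ge0 ?sumr_ge0// mulr_sumr.
    rewrite le_eqVlt; apply/orP; left; apply/eqP; congr (_ `^ _).
    by apply: eq_bigr => i /eqP <-.
have [->//|ll'] := eqVneq l' l.
have := @matrix_step R A A (fun a a' => \sum_(i : {ffun 'I_m -> A} | (i l' == a) && (i l == a')) c' i)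
  k k' _ k0 kk' k'1.
have E1 a : \sum_a' \sum_(i : {ffun 'I_m -> A} | (i l' == a) && (i l == a')) c' i =
    \sum_(i : {ffun 'I_m -> A} | i l' == a) c' i.
  by rewrite (partition_big (fun i : {ffun 'I_m -> A} => i l) xpredT).
have E2 a' : \sum_a \sum_(i : {ffun 'I_m -> A} | (i l' == a) && (i l == a')) c' i =
    \sum_(i : {ffun 'I_m -> A} | i l == a') c' i.
  rewrite [RHS](partition_big (fun i : {ffun 'I_m -> A} => i l') xpredT)//.
  by apply: eq_bigr => a _; apply: eq_bigl => i; rewrite andbC.
under [X in _ -> _ -> X <= 1 -> _]eq_bigr => a' _ do rewrite E2.
under [X in _ -> _ -> _ -> X <= 1]eq_bigr => a _ do rewrite E1.
apply=> // [a a'|g Hg]; first exact: sumr_ge0.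
apply: le_trans (H l' alpha g Ha Hg).
rewrite le_eqVlt; apply/orP; left; apply/eqP; apply: eq_bigr => a _.
congr (_ `^ _); rewrite [RHS](partition_big (fun i : {ffun 'I_m -> A} => i l) xpredT)//.
apply: eq_bigr => a' _; rewrite mulr_sumr.
by apply: eq_bigr => i /andP[_ /eqP ->].
Qed.

(** Duality over the slices i l = a bounds the sum of the (s'/s)-th powers of the slice sums of
    c'^s; as s'/s >= 1, this dominates the sum of c'^s'. Unlike for fibers, s' may exceed 1. *)
Lemma total_step lam lam' (l : 'I_m) s s' :
  (forall j, j != l -> lam' j = lam j) ->
  lam l = lam' l + (s^-1 - s'^-1) -> 0 <= lam' l ->
  0 < s -> s <= s' -> total_bound lam s -> total_bound lam' s'.
Proof.
move=> lamE laml lam'0 s0 ss' H alpha Ha.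
have s'0 := lt_le_trans s0 ss'.
set d := s^-1 - s'^-1 in laml.
have d0 : 0 <= d by rewrite subr_ge0 lef_pV2.
have ds : d * s = 1 - s / s' by rewrite mulrBl mulVf ?gt_eqF// mulrC.
set c' := fun i => weight lam' alpha i * c i.
have c'0 i : 0 <= c' i by rewrite mulr_ge0 ?weight_ge0.
rewrite (partition_big (fun i : {ffun 'I_m -> A} => i l) xpredT)//=.
have := @sub_prob_dual R A (fun a => \sum_(i : {ffun 'I_m -> A} | i l == a) c' i `^ s) (d * s).
rewrite [X in (1 - X)]ds opprB addrC subrK invf_div => D.
apply: le_trans (D _ _ _) => [|a||g Hg]; last 3 first.
- by apply: sumr_ge0 => i _; exact: powR_ge0.
- by rewrite mulr_ge0 ?(ltW s0)//= ds gtrBl divr_gt0.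
- have [alpha' [Ha' le_w]] := weight_split lamE laml lam'0 d0 Ha Hg.
  apply: le_trans (H _ Ha').
  rewrite [leRHS](partition_big (fun i : {ffun 'I_m -> A} => i l) xpredT)//=.
  apply: ler_sum => a _; rewrite mulr_sumr; apply: ler_sum => i /eqP <-.
  rewrite powRrM -powRM ?powR_ge0//; apply: powR_le; first exact: ltW.
  - by rewrite mulr_ge0 ?powR_ge0.
  - by rewrite /c' mulrA ler_wpM2r.
apply: ler_sum => a _.
apply: le_trans (sum_powR_le _ _ _) => [||i]; last exact: powR_ge0.
- by apply: ler_sum => i _; rewrite -powRrM [s * _]mulrC divfK// gt_eqF.
- by rewrite ler_pdivlMr// mul1r.
Qed.

End MultiIndex.

Section MultiIndexSums.
Context {R : realType} (m : nat) (A : finType) (c : {ffun 'I_m -> A} -> R).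
Hypothesis c0 : forall i, 0 <= c i.
Implicit Types (k s lam : R).

Let lam_ (lam0 lam1 : R) d (j : 'I_m) := if (j < d)%N then lam1 else lam0.

Let lam_m lam0 lam1 : lam_ lam0 lam1 m = fun=> lam1.
Proof. by apply/funext => j; rewrite /lam_ ltn_ord. Qed.

(** Each variable costs lam0 - lam1 in 1/k. The intermediate values [e d] stay at least 1/k' >= 1,
    so every exponent remains at most 1, as [fiber_step] demands. *)
Lemma fiber_bound_lower lam0 lam1 k k' : 0 <= lam1 -> lam1 <= lam0 ->
  0 < k -> 0 < k' -> k'^-1 = k^-1 - m%:R * (lam0 - lam1) -> k' <= 1 ->
  fiber_bound c (fun=> lam0) k -> fiber_bound c (fun=> lam1) k'.
Proof.
move=> l10 l01 k0 k'0 k'E k'1 H.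
have D0 : 0 <= lam0 - lam1 by rewrite subr_ge0.
pose e d := k^-1 - d%:R * (lam0 - lam1).
have eS d : e d = e d.+1 + (lam0 - lam1) by rewrite /e -natr1 mulrDl mul1r; ring.
have e1 d : (d <= m)%N -> 1 <= e d.
  move=> dm; have : k'^-1 <= e d by rewrite k'E lerD2l lerN2 ler_wpM2r// ler_nat.
  by apply: le_trans; rewrite invf_ge1.
suff : forall d, (d <= m)%N -> fiber_bound c (lam_ lam0 lam1 d) (e d)^-1.
  by move=> /(_ m (leqnn m)); rewrite lam_m /e -k'E invrK.
elim=> [_|d IH dm]; first by rewrite /e mul0r subr0 invrK.
have ed := e1 _ (ltnW dm); have ed1 := e1 _ dm.
have ep := lt_le_trans ltr01 ed; have ep1 := lt_le_trans ltr01 ed1.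
apply: (fiber_step (l := Ordinal dm) c0 _ _ _ _ _ _ (IH (ltnW dm))) => /=.
- move=> j jd; rewrite /lam_ ltnS leq_eqVlt.
  by rewrite -[(_ == _)%N]/(j == Ordinal dm) (negbTE jd).
- by rewrite /lam_ /= ltnn ltnSn !invrK (eS d) addrAC subrr add0r addrC subrK.
- by rewrite /lam_ /= ltnSn.
- by rewrite invr_gt0.
- by rewrite lef_pV2 ?posrE// (eS d) lerDl.
- by rewrite invf_le1.
Qed.

Lemma total_bound_lower lam s s' : 0 <= lam -> 0 < s -> 0 < s' ->
  s'^-1 = s^-1 - m%:R * lam ->
  total_bound c (fun=> lam) s -> \sum_i c i `^ s' <= 1.
Proof.
move=> l0 s0 s'0 s'E H.
pose e d := s^-1 - d%:R * lam.
have eS d : e d = e d.+1 + lam by rewrite /e -natr1 mulrDl mul1r; ring.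
have ep d : (d <= m)%N -> 0 < e d.
  move=> dm; have : s'^-1 <= e d by rewrite s'E lerD2l lerN2 ler_wpM2r// ler_nat.
  by apply: lt_le_trans; rewrite invr_gt0.
suff : forall d, (d <= m)%N -> total_bound c (lam_ lam 0 d) (e d)^-1.
  (* Zero multipliers with exponent 0 have weight 1. *)
  move=> /(_ m (leqnn m) (fun _ _ => 0)); rewrite lam_m /e -s'E invrK => H1.
  under eq_bigr => i _ do rewrite -[c i]mul1r.
  have w1 i : weight (fun=> 0) (fun (_ : 'I_m) (_ : A) => 0) i = 1 :> R.
    by rewrite /weight big1// => j _; rewrite powRr0.
  under eq_bigr => i _ do rewrite -[X in X * _](w1 i).
  by apply: H1 => j; split=> //; rewrite big1.
elim=> [_|d IH dm]; first by rewrite /e mul0r subr0 invrK.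
have ed := ep _ (ltnW dm); have ed1 := ep _ dm.
apply: (total_step (l := Ordinal dm) c0 _ _ _ _ _ (IH (ltnW dm))) => /=.
- move=> j jd; rewrite /lam_ ltnS leq_eqVlt.
  by rewrite -[(_ == _)%N]/(j == Ordinal dm) (negbTE jd).
- by rewrite /lam_ /= ltnn ltnSn !invrK (eS d) addrAC subrr add0r add0r.
- by rewrite /lam_ /= ltnSn.
- by rewrite invr_gt0.
- by rewrite lef_pV2 ?posrE// (eS d) lerDl.
Qed.

(** For k >= 1 the k-th power is superadditive, so the fibers in a single direction already control
    the total sum. *)
Lemma fiber_total lam k : (0 < m)%N -> 1 <= k ->
  fiber_bound c (fun=> lam) k -> total_bound c (fun=> lam) k.
Proof.
move=> m0 k1 H alpha Ha; apply: le_trans (H (Ordinal m0) alpha Ha).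
rewrite (partition_big (fun i : {ffun 'I_m -> A} => i (Ordinal m0)) xpredT)//=.
apply: ler_sum => a _; apply: sum_powR_le => // i.
by rewrite mulr_ge0// weight_ge0.
Qed.

(* Blei's inequality: with [r l a] the sum of the fiber [i l = a], write
   [c i `^ s] as [(c i * \prod_l r l (i l) `^ ((k - 1) / m)) `^ s] times
   [(\prod_l r l (i l) `^ k) `^ (1 - s)]. *)
Lemma blei k s : (0 < m)%N -> 0 < k -> k <= 1 -> 0 < s ->
  s^-1 = 1 + (k^-1 - 1) / m%:R ->
  (forall l, \sum_a (\sum_(i : {ffun 'I_m -> A} | i l == a) c i) `^ k <= 1) ->
  \sum_i c i `^ s <= 1.
Proof.
move=> m0 k0 k1 s0 sE H.
have mR : 0 < m%:R :> R by rewrite ltr0n.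
have s1 : s <= 1.
  rewrite -invf_ge1// sE lerDl divr_ge0// ?subr_ge0 ?invf_ge1//.
have s01 : 0 <= s <= 1 by rewrite ltW.
pose r l a := \sum_(i : {ffun 'I_m -> A} | i l == a) c i.
have r0 l a : 0 <= r l a by exact: sumr_ge0.
have cr i l : c i <= r l (i l).
  by rewrite /r (bigD1 i)//= lerDl sumr_ge0.
pose f i := c i * \prod_l r l (i l) `^ ((k - 1) / m%:R).
pose g (i : {ffun 'I_m -> A}) := \prod_l r l (i l) `^ k.
have f0 i : 0 <= f i by rewrite mulr_ge0// prodr_ge0// => l _; exact: powR_ge0.
have g0 i : 0 <= g i by rewrite prodr_ge0// => l _; exact: powR_ge0.
have prod_powR (h : 'I_m -> R) x : (forall l, 0 <= h l) ->
    (\prod_l h l) `^ x = \prod_l h l `^ x.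
  move=> h0; suff [] : 0 <= \prod_l h l /\ (\prod_l h l) `^ x = \prod_l h l `^ x by [].
  elim/big_rec2: _ => [|l y z _ [z0 E]]; first by rewrite powR1.
  by rewrite mulr_ge0// powRM// E.
have -> : \sum_i c i `^ s = \sum_i f i `^ s * g i `^ (1 - s).
  apply: eq_bigr => i _.
  have [ci0|cin] := eqVneq (c i) 0.
    by rewrite /f ci0 mul0r powR0 ?gt_eqF// mul0r.
  have cp : 0 < c i by rewrite lt_neqAle eq_sym cin c0.
  have rn l : r l (i l) != 0 by rewrite gt_eqF// (lt_le_trans cp).
  rewrite /f powRM ?prodr_ge0// => [|l _]; last exact: powR_ge0.
  rewrite /g !prod_powR => [|l|l]; [|exact: powR_ge0..].
  rewrite -mulrA -big_split/= big1 ?mulr1// => l _.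
  rewrite -!powRrM -powRD ?rn ?implybT//.
  rewrite [X in _ `^ X](_ : _ = 0) ?powRr0//.
  have -> : k * (1 - s) = s * (k * (s^-1 - 1)).
    by field; rewrite gt_eqF.
  by rewrite sE; field; rewrite !gt_eqF.
apply: le_trans (sum_hoelder _ f0 g0 s01) _.
have le1 (u : R) x : 0 <= u -> u <= 1 -> 0 <= x -> 0 <= u `^ x <= 1.
  by move=> *; rewrite powR_ge0 powR_le1.
have hg : \sum_i g i <= 1.
  rewrite /g -(bigA_distr_bigA (fun l a => r l a `^ k)).
  by apply: Num.Theory.prodr_ile1 => l _; rewrite H sumr_ge0// => a _; exact: powR_ge0.
have hf : \sum_i f i <= 1.
  (* The geometric mean over the directions is at most the arithmetic one, and for a single l the
     sum over i of c i times r l (i l)^(k - 1) collapses to the sum of r l a^k. *)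
  have fle i : f i <= m%:R^-1 * \sum_l c i * r l (i l) `^ (k - 1).
    have [ci0|cin] := eqVneq (c i) 0.
      rewrite /f ci0 mul0r mulr_ge0 ?invr_ge0 ?(ltW mR)// sumr_ge0//.
    pose h l := c i * r l (i l) `^ (k - 1).
    have h0 l : 0 <= h l by rewrite mulr_ge0 ?powR_ge0.
    have -> : f i = (\prod_l h l) `^ m%:R^-1.
      rewrite prod_powR// /h.
      under [RHS]eq_bigr => l _ do rewrite powRM ?powR_ge0// -powRrM.
      rewrite big_split/= prodr_const card_ord -powR_mulrn ?powR_ge0//.
      by rewrite -powRrM mulVf ?gt_eqF// powRr1.
    have := @leif_AGM R 'I_m predT h (fun l _ => h0 l).
    rewrite card_ord => -[/(powR_le (_ : 0 <= m%:R^-1)) + _].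
    rewrite invr_ge0 ler0n => /(_ isT); rewrite prodr_ge0// => /(_ isT).
    move/le_trans; apply; rewrite -powR_mulrn ?divr_ge0 ?sumr_ge0//.
    by rewrite powRK ?gt_eqF ?divr_ge0 ?sumr_ge0// mulrC.
  apply: (@le_trans _ _ (m%:R^-1 * \sum_(l < m) 1)); last first.
    by rewrite big_const_ord iter_addr_0 mulVf ?gt_eqF.
  apply: le_trans (ler_sum _ (fun i _ => fle i)) _.
  rewrite -mulr_sumr ler_wpM2l ?invr_ge0// exchange_big/= ler_sum// => l _.
  apply: le_trans (H l).
  rewrite (partition_big (fun i : {ffun 'I_m -> A} => i l) xpredT)//=.
  apply: ler_sum => a _; rewrite -(mulr_powRB1 (r0 l a) k0) mulr_suml.
  by apply: ler_sum => i /eqP ->.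
have s1' : 0 <= 1 - s by rewrite subr_ge0.
have /andP[? ?] := le1 _ _ (sumr_ge0 _ (fun i _ => f0 i)) hf (ltW s0).
have /andP[? ?] := le1 _ _ (sumr_ge0 _ (fun i _ => g0 i)) hg s1'.
exact: mulr_ile1.
Qed.

Lemma fiber_bound_sum_lt lam k E s : (0 < m)%N -> 0 <= lam -> 0 < k ->
  fiber_bound c (fun=> lam) k -> E = k^-1 - m%:R * lam -> 1 <= E ->
  0 < s -> s^-1 = 1 + (E - 1) / m%:R -> \sum_i c i `^ s <= 1.
Proof.
move=> m0 l0 k0 H EE E1 s0 sE; have E0 := lt_le_trans ltr01 E1.
have H1 : fiber_bound c (fun=> 0) E^-1.
  by apply: (fiber_bound_lower (lam0 := lam) (k := k)) => //;
    rewrite ?invr_gt0 ?invrK ?subr0 ?invf_le1.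
apply: (blei (k := E^-1)) => //; rewrite ?invr_gt0 ?invf_le1 ?invrK// => l.
have := H1 l (fun _ _ => 0) _.
have w1 i : weight (fun=> 0) (fun (_ : 'I_m) (_ : A) => 0) i = 1 :> R.
  by rewrite /weight big1// => j _; rewrite powRr0.
under eq_bigr => a _ do under eq_bigr => i _ do rewrite w1 mul1r.
by apply=> j; split=> //; rewrite big1.
Qed.

Lemma fiber_bound_sum_ge lam k E : (0 < m)%N -> 0 <= lam -> 0 < k ->
  fiber_bound c (fun=> lam) k -> E = k^-1 - m%:R * lam -> 0 < E -> E <= 1 ->
  \sum_i c i `^ E^-1 <= 1.
Proof.
move=> m0 l0 k0 H EE E0 E1; have mR : 0 < m%:R :> R by rewrite ltr0n.
have [k1|k1] := leP 1 k.
  apply: (total_bound_lower l0 k0); rewrite ?invr_gt0 ?invrK//.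
  exact: fiber_total.
(* The multiplier exponent still present when the fiber exponent reaches 1, that is 1/k - m (lam -
   lam1) = 1. From there on the total sum takes over. *)
pose lam1 := (1 - E) / m%:R.
have l10 : 0 <= lam1 by rewrite divr_ge0 ?subr_ge0// ltW.
have l1l : lam1 <= lam.
  rewrite ler_pdivrMr// EE lerBlDr addrC [lam * _]mulrC subrK.
  by rewrite invf_ge1// ltW.
have H1 : total_bound c (fun=> lam1) 1.
  apply: (fiber_total m0 (lexx 1)); apply: (fiber_bound_lower l10 l1l k0 ltr01 _ _ H) => //.
  rewrite invr1 mulrBr /lam1 [m%:R * (_ / _)]mulrC divfK ?gt_eqF// EE.
  by ring.
apply: (total_bound_lower l10 ltr01) => //; first by rewrite invr_gt0.
rewrite invr1 invrK /lam1 [m%:R * (_ / _)]mulrC divfK ?gt_eqF//.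
by ring.
Qed.

End MultiIndexSums.

(** * Real and complex scalars, Hahn-Banach *)

(** Common interface of the two scalar fields: through [e] every K-valued norm is the image of the
    R-valued [rnorm]. Later the two cases are distinguished only for Hahn-Banach, completeness of
    the scalars and orthogonality of signs. *)
Record scalar_embedding (R : realType) (K : numFieldType) (re : K -> R) :=
  ScalarEmbedding {
    emb :> {rmorphism R -> K};
    emb_le : {mono emb : x y / x <= y};
    embK : cancel emb re;
    reK : forall z, 0 <= z -> emb (re z) = z }.

Lemma scalar_field_embedding (R : realType) (K : numFieldType) (re : K -> R) :
  scalar_field re -> inhabited (scalar_embedding re).
Proof.
case.
  exists; exact: (@ScalarEmbedding R R id idfun (fun _ _ => erefl) (fun _ => erefl)
    (fun _ _ => erefl)).
exists; apply: (@ScalarEmbedding R R[i] (@complex.Re R) (real_complex R)) => //.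
  by move=> x y; rewrite lecR.
by move=> z z0; exact: (RRe_real (ger0_real z0)).
Qed.

Section ScalarNorms.
Context {R : realType} {K : numFieldType} {re : K -> R} (e : scalar_embedding re).
Local Notation rnorm := (rnorm re).

Lemma normE_rnorm (X : normedModType K) (x : X) : `|x| = e (rnorm x).
Proof. by rewrite reK. Qed.

Lemma rnorm_ge0 (X : normedModType K) (x : X) : 0 <= rnorm x.
Proof. by rewrite -(emb_le e) rmorph0 -normE_rnorm. Qed.

Lemma rnorm_le1 (X : normedModType K) (x : X) : (`|x| <= 1) = (rnorm x <= 1).
Proof. by rewrite normE_rnorm -(rmorph1 e) emb_le. Qed.

Lemma emb_lt : {mono e : x y / x < y}.
Proof. by move=> x y; rewrite !lt_leAnge !emb_le. Qed.

Lemma emb_norm a : `|e a| = e `|a|.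
Proof.
have [a0|a0] := leP 0 a; first by rewrite !ger0_norm// -(rmorph0 e) emb_le.
by rewrite !ltr0_norm ?rmorphN// -(rmorph0 e) emb_lt.
Qed.

Lemma rnorm0 (X : normedModType K) : rnorm (0 : X) = 0.
Proof. by rewrite /Defs.rnorm normr0 -(rmorph0 e) embK. Qed.

Lemma rnorm_eq0 (X : normedModType K) (x : X) : (rnorm x == 0) = (x == 0).
Proof.
apply/eqP/eqP => [h|->]; last exact: rnorm0.
by apply/eqP; rewrite -normr_eq0 normE_rnorm h rmorph0.
Qed.

Lemma rnormD (X : normedModType K) (x y : X) : rnorm (x + y) <= rnorm x + rnorm y.
Proof. by rewrite -(emb_le e) rmorphD -!normE_rnorm ler_normD. Qed.

Lemma rnormN (X : normedModType K) (x : X) : rnorm (- x) = rnorm x.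
Proof. by rewrite /Defs.rnorm normrN. Qed.

Lemma rnormZ (X : normedModType K) (k : K) (x : X) :
  rnorm (k *: x) = rnorm (k : K^o) * rnorm x.
Proof.
apply: (can_inj (embK e)); rewrite -normE_rnorm rmorphM -!normE_rnorm.
exact: normrZ.
Qed.

Lemma rnorm_emb a : rnorm (e a : K^o) = `|a|.
Proof.
by apply: (can_inj (embK e)); rewrite -normE_rnorm [LHS]emb_norm.
Qed.

Lemma rnormZr (X : normedModType K) a (x : X) :
  rnorm (e a *: x) = `|a| * rnorm x.
Proof. by rewrite rnormZ rnorm_emb. Qed.

Lemma rnormM (k l : K) : rnorm (k * l : K^o) = rnorm (k : K^o) * rnorm (l : K^o).
Proof. exact: (@rnormZ K^o). Qed.

Lemma rnorm_sign (X : normedModType K) (b : bool) (x : X) :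
  rnorm ((-1) ^+ b *: x) = rnorm x.
Proof. by case: b; rewrite ?expr0 ?expr1 ?scale1r// scaleN1r rnormN. Qed.

Lemma rnorm_sum (X : normedModType K) (I : Type) (s : seq I) (P : pred I) (f : I -> X) :
  rnorm (\sum_(i <- s | P i) f i) <= \sum_(i <- s | P i) rnorm (f i).
Proof.
elim/big_rec2 : _ => [|i y z Pi h]; first by rewrite rnorm0.
by apply: le_trans (rnormD _ _) _; rewrite lerD2l.
Qed.

Lemma dual_ball_le (X : normedModType K) (phi : {linear X -> K^o}) (x : X) :
  dual_ball phi -> rnorm (phi x) <= rnorm x.
Proof.
move=> hphi; have [->|x0] := eqVneq x 0; first by rewrite linear0 !rnorm0.
have nx : 0 < rnorm x by rewrite lt_neqAle eq_sym rnorm_eq0 x0 rnorm_ge0.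
have := hphi (e (rnorm x)^-1 *: x).
rewrite !rnorm_le1 linearZ !rnormZr ger0_norm ?invr_ge0 ?rnorm_ge0//.
by rewrite mulVf ?gt_eqF// ler_pdivrMl// mulr1; exact.
Qed.

End ScalarNorms.

(** * The Hahn-Banach theorem through minimal sublinear functionals *)

Section HahnBanach.
Context {R : realType} {K : numFieldType} (e : {rmorphism R -> K}) (V : lmodType K).

Definition sublinear (q : V -> R) :=
  (forall x y, q (x + y) <= q x + q y) /\
  (forall a x, 0 <= a -> q (e a *: x) = a * q x).

Lemma sublinear_opp q x : sublinear q -> - q (- x) <= q x.
Proof.
move=> [qD qZ]; have q0 : q 0 = 0 by rewrite -(scale0r 0) -(rmorph0 e) qZ// mul0r.
by rewrite lerNl -subr_ge0 opprK addrC -q0 -(subrr x) qD.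
Qed.

(* Forces the value at [- y] down to [- q y], so a minimal [q] is odd. *)
Definition sub_along (q : V -> R) (y x : V) : R :=
  inf [set q (x + e t *: y) - t * q y | t in [set t : R | 0 <= t]]%classic.

Section along.
Variables (q : V -> R) (y : V).
Hypothesis qs : sublinear q.

Let S x := [set q (x + e t *: y) - t * q y | t in [set t : R | 0 <= t]]%classic.

Let lbS x t : 0 <= t -> - q (- x) <= q (x + e t *: y) - t * q y.
Proof.
move=> t0; rewrite lerBrDl lerBlDr -qs.2//.
by apply: le_trans (qs.1 _ _); rewrite addrAC subrr add0r.
Qed.

Let S_inf x : has_inf (S x).
Proof.
split; first by exists (q (x + e 0 *: y) - 0 * q y); exists 0 => /=.
by exists (- q (- x)) => _ [t /= t0 <-]; exact: lbS.
Qed.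

Lemma sub_along_le x t : 0 <= t -> sub_along q y x <= q (x + e t *: y) - t * q y.
Proof. by move=> t0; apply: ge_inf; [exact: (S_inf x).2|exists t]. Qed.

Lemma sub_along_ge x z : (forall t, 0 <= t -> z <= q (x + e t *: y) - t * q y) ->
  z <= sub_along q y x.
Proof. by move=> h; apply: lb_le_inf; [exact: (S_inf x).1|move=> _ [t /= t0 <-]; exact: h]. Qed.

Lemma sublinear_along : sublinear (sub_along q y).
Proof.
have [qD qZ] := qs; split=> [x x'|a x].
  rewrite -lerBlDr; apply: sub_along_ge => t t0.
  rewrite lerBlDr [leRHS]addrC -lerBlDr; apply: sub_along_ge => t' t'0.
  rewrite lerBlDr; apply: le_trans (@sub_along_le _ (t + t') _) _; rewrite ?addr_ge0//.
  rewrite rmorphD scalerDl addrACA mulrDl opprD.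
  by rewrite [leRHS]addrC [leRHS]addrACA lerD2r qD.
rewrite le_eqVlt => /orP[/eqP<-|a0].
  rewrite rmorph0 scale0r mul0r; apply/eqP; rewrite eq_le; apply/andP; split.
    apply: le_trans (sub_along_le _ (lexx 0)) _.
    by rewrite rmorph0 scale0r addr0 mul0r subr0 -(scale0r 0) -(rmorph0 e) qZ// mul0r.
  by apply: sub_along_ge => t t0; rewrite add0r qZ// subrr.
have aN := gt_eqF a0.
apply/eqP; rewrite eq_le; apply/andP; split.
  rewrite -ler_pdivrMl//; apply: sub_along_ge => t t0; rewrite ler_pdivrMl//.
  apply: le_trans (@sub_along_le _ (a * t) _) _; first by rewrite mulr_ge0// ltW.
  by rewrite rmorphM -scalerA -scalerDr qZ ?(ltW a0)// mulrBr mulrA.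
apply: sub_along_ge => t t0; rewrite -ler_pdivlMl//.
apply: le_trans (@sub_along_le _ (a^-1 * t) _) _; first by rewrite mulr_ge0// invr_ge0 ltW.
rewrite mulrBr mulrA lerD2r -qZ ?invr_ge0 ?(ltW a0)//.
by rewrite scalerDr scalerA -rmorphM mulVf ?aN// rmorph1 scale1r scalerA -rmorphM.
Qed.

Lemma along_le x : sub_along q y x <= q x.
Proof.
apply: le_trans (sub_along_le _ (lexx 0)) _.
by rewrite rmorph0 scale0r addr0 mul0r subr0.
Qed.

Lemma along_opp : sub_along q y (- y) <= - q y.
Proof.
apply: le_trans (sub_along_le _ ler01) _.
have [_ qZ] := qs; have q0 : q 0 = 0 by rewrite -(scale0r 0) -(rmorph0 e) qZ// mul0r.
by rewrite rmorph1 scale1r addNr q0 mul1r sub0r.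
Qed.

End along.

Lemma sublinear_chain_inf (p : V -> R) (C : set (V -> R)) : sublinear p ->
  (forall q, C q -> sublinear q /\ forall x, q x <= p x) ->
  total_on C (fun q q' => forall x, q' x <= q x) -> (exists q, C q) ->
  exists2 q, sublinear q & forall q', C q' -> forall x, q x <= q' x.
Proof.
move=> ps Cp Ctot [q0 Cq0].
pose S x := [set q x | q in C]%classic.
have S_inf x : has_inf (S x).
  split; first by exists (q0 x); exists q0.
  exists (- p (- x)) => _ [q Cq <-]; have [qs qp] := Cp _ Cq.
  by apply: le_trans (sublinear_opp _ qs); rewrite lerN2 qp.
pose q x := inf (S x).
have q_le q' x : C q' -> q x <= q' x.
  by move=> Cq'; apply: ge_inf; [exact: (S_inf x).2|exists q'].
have q_ge x z : (forall q', C q' -> z <= q' x) -> z <= q x.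
  by move=> h; apply: lb_le_inf; [exact: (S_inf x).1|move=> _ [q' Cq' <-]; exact: h].
exists q; last by move=> q' Cq' x; exact: q_le.
split=> [x y|a x].
  rewrite -lerBlDr; apply: (q_ge _ _) => q1 Cq1.
  rewrite lerBlDr [leRHS]addrC -lerBlDr; apply: (q_ge _ _) => q2 Cq2; rewrite lerBlDr [leRHS]addrC.
  have [h|h] := Ctot _ _ Cq1 Cq2.
    apply: le_trans (q_le _ _ Cq2) _; apply: le_trans ((Cp _ Cq2).1.1 _ _) _.
    by rewrite lerD2r.
  apply: le_trans (q_le _ _ Cq1) _; apply: le_trans ((Cp _ Cq1).1.1 _ _) _.
  by rewrite lerD2l.
rewrite le_eqVlt => /orP[/eqP<-|a0].
  rewrite mul0r; apply/eqP; rewrite eq_le; apply/andP; split.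
    by apply: le_trans (q_le _ _ Cq0) _; rewrite (Cp _ Cq0).1.2// mul0r.
  by apply: (q_ge _ _) => q' Cq'; rewrite (Cp _ Cq').1.2// mul0r.
apply/eqP; rewrite eq_le; apply/andP; split.
  rewrite -ler_pdivrMl//; apply: (q_ge _ _) => q' Cq'; rewrite ler_pdivrMl//.
  by rewrite -(Cp _ Cq').1.2 ?(ltW a0)//; exact: q_le.
apply: (q_ge _ _) => q' Cq'; rewrite (Cp _ Cq').1.2 ?(ltW a0)// ler_pM2l//.
exact: q_le.
Qed.

(** Zorn's lemma gives a minimal sublinear functional, and a minimal one is odd, hence linear; no
    extension from subspaces occurs. Starting below [sub_along p x0], whose value at - x0 is at most
    - p x0, forces the value p x0 at x0. *)
Theorem sublinear_dominates (p : V -> R) (x0 : V) : sublinear p ->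
  exists f : V -> R, [/\ (forall x y, f (x + y) = f x + f y),
    (forall a x, f (e a *: x) = a * f x), (forall x, f x <= p x) & f x0 = p x0].
Proof.
move=> ps; pose p0 := sub_along p x0.
have p0s : sublinear p0 := sublinear_along x0 ps.
pose T := {q : V -> R | sublinear q /\ forall x, q x <= p0 x}.
pose rel (s t : T) := `[< forall x, sval t x <= sval s x >].
have [|||C Ctot|[q [qs qp]] qmax] := @Zorn T rel.
- by move=> t; apply/asboolP.
- by move=> a b c /asboolP ab /asboolP bc; apply/asboolP => x; exact: le_trans (ab x).
- move=> [a ha] [b hb] /asboolP /= ab /asboolP /= ba; apply: eq_exist.
  by apply/funext => x; apply: le_anti; rewrite ab ba.
- have [C0|C0] := pselect (exists c, C c); last first.
    by exists (exist _ p0 (conj p0s (fun=> lexx _))) => s Cs; case: C0; exists s.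
  pose C' := [set sval c | c in C]%classic.
  have [||||q qs qC] := @sublinear_chain_inf p0 C' => //.
  + by move=> _ [[q hq] _ <-].
  + move=> _ _ [a Ca <-] [b Cb <-].
    by have [/asboolP|/asboolP] := Ctot _ _ Ca Cb; [left|right].
  + by have [c Cc] := C0; exists (sval c); exists c.
  have qp : forall x, q x <= p0 x.
    have [c Cc] := C0; move=> x; apply: le_trans ((svalP c).2 x).
    by apply: qC; exists c.
  exists (exist _ q (conj qs qp)) => s Cs; apply/asboolP => x /=.
  by apply: qC; exists s.
have [qD qZ] := qs.
(* [sub_along q y] lies below q, so it equals q by minimality, while its value at - y is at most - q
   y. *)
have odd y : q (- y) = - q y.
  have h1 : - q y <= q (- y) by have := sublinear_opp (- y) qs; rewrite opprK.
  have h x : sub_along q y x <= p0 x by apply: le_trans (qp x); exact: along_le.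
  pose s : T := exist _ (sub_along q y) (conj (sublinear_along y qs) h).
  have /(congr1 sval)/= E : s = exist _ q (conj qs qp).
    by apply: qmax; apply/asboolP => x /=; exact: along_le.
  have h2 : q (- y) <= - q y by rewrite -{1}E; exact: along_opp.
  by apply/eqP; rewrite eq_le h2.
exists q; split.
- move=> x y; apply: le_anti; rewrite qD/=.
  have := qD (x + y) (- y); rewrite addrK odd lerBrDr.
  exact.
- move=> a x; have [a0|a0] := leP 0 a; first exact: qZ.
  have := qZ (- a) x; rewrite oppr_ge0 (ltW a0) rmorphN scaleNr odd => /(_ isT).
  by rewrite mulNr => /oppr_inj.
- by move=> x; apply: le_trans (qp x) _; exact: along_le.
- apply: le_anti; rewrite (le_trans (qp x0) (along_le x0 ps x0))/=.
  rewrite -lerN2 -odd; apply: le_trans (qp _) _; exact: along_opp.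
Qed.

End HahnBanach.

Lemma hahn_banach_real (R : realType) (X : normedModType R) (x0 : X) :
  exists2 phi : {linear X -> R^o}, dual_ball phi & `|phi x0| = `|x0|.
Proof.
have ps : sublinear (idfun : {rmorphism R -> R}) (fun x : X => `|x|).
  by split=> [x y|a x a0]; rewrite ?ler_normD// normrZ ger0_norm.
have [f [fD fZ fle fx0]] := sublinear_dominates x0 ps.
have lf : linear (f : X -> R^o) by move=> a u v; rewrite fD [f (a *: u)]fZ.
pose phi : {linear X -> R^o} := HB.pack f (GRing.isLinear.Build _ _ _ _ _ lf).
have phile x : `|phi x| <= `|x|.
  rewrite ler_norml fle andbT lerNl; have := fle (- x).
  by rewrite normrN -[- x]scaleN1r fZ mulN1r.
exists phi => [x|]; first exact: le_trans.
by apply: le_anti; rewrite phile/= -fx0 ler_norm.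
Qed.

Lemma hahn_banach_complex (R : realType) (X : normedModType R[i]) (x0 : X) :
  exists2 phi : {linear X -> R[i]^o}, dual_ball phi & `|phi x0| = `|x0|.
Proof.
have [e] := scalar_field_embedding (complex_scalars R).
pose n (x : X) := rnorm (@complex.Re R) x.
have ps : sublinear e n.
  split=> [x y|a x a0]; first exact: (rnormD e).
  by rewrite /n (rnormZr e) ger0_norm.
have [f [fD fZ fle fx0]] := sublinear_dominates x0 ps.
(* [e] comes from an existence statement; it is the canonical embedding, since embedded reals are
   real and [complex.Re] inverts [e]. *)
have eE a : e a = a%:C%C.
  have [b|b] := leP 0 a.
    have /complex_realP[k kE] : e a \is Num.real by rewrite ger0_real// -(rmorph0 e) emb_le.
    by rewrite kE -[in RHS](embK e a) kE.
  have /complex_realP[k kE] : e a \is Num.real.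
    by rewrite ltr0_real// -(rmorph0 e) emb_lt.
  by rewrite kE -[in RHS](embK e a) kE.
(* The complex linear functional with real part f is f(x) - i f(i x). *)
pose g x : R[i] := (f x +i* (- f ('i%C *: x)))%C.
have {}fZ a x : f (a%:C%C *: x) = a * f x by rewrite -eE fZ.
have fC a b x : f ((a +i* b)%C *: x) = a * f x + b * f ('i%C *: x).
  have -> : (a +i* b)%C = a%:C%C + b%:C%C * 'i%C :> R[i].
    by rewrite [LHS]complexE/= [X in _ + X]mulrC.
  by rewrite scalerDl -scalerA fD !fZ.
have lg : linear (g : X -> R[i]^o).
  move=> [b c] u v; rewrite /g scalerDr !fD !scalerA (fC b c).
  have -> : 'i%C * (b +i* c)%C = ((- c) +i* b)%C :> R[i].
    by apply/eqP; rewrite eq_complex/=; apply/andP; split; apply/eqP; rewrite ?(mul0r, mul1r, sub0r, add0r).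
  rewrite (fC (- c) b); apply/eqP; rewrite eq_complex/=; apply/andP; split; apply/eqP; ring.
pose phi : {linear X -> R[i]^o} := HB.pack g (GRing.isLinear.Build _ _ _ _ _ lg).
have phile x : `|phi x| <= `|x|.
  have [->|z0] := eqVneq (phi x) 0; first by rewrite normr0.
  (* A rotation of x by a scalar of modulus 1 makes the value of phi real and nonnegative, so the
     bound on the real part f bounds the modulus. *)
  pose k : R[i] := `|phi x| / phi x.
  have k1 : `|k| = 1 by rewrite normf_div normr_id divff// normr_eq0.
  have kz : k * phi x = `|phi x| by rewrite divfK.
  have := fle (k *: x); rewrite /n /rnorm normrZ k1 mul1r.
  have -> : f (k *: x) = complex.Re (phi (k *: x)) by [].
  have -> : phi (k *: x) = `|phi x| by rewrite linearZ; exact: kz.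
  move=> h.
  by rewrite (normE_rnorm e (phi x)) (normE_rnorm e x) emb_le.
exists phi => [x|]; first exact: le_trans.
apply: le_anti; rewrite phile/= (normE_rnorm e x0) -/(n x0) -fx0 eE.
apply: le_trans (normc_ge_Re (phi x0)); rewrite lecR; exact: ler_norm.
Qed.

Lemma hahn_banach (R : realType) (K : numFieldType) (re : K -> R)
    (hK : scalar_field re) (X : normedModType K) (x0 : X) :
  exists2 phi : {linear X -> K^o}, dual_ball phi & rnorm re (phi x0) = rnorm re x0.
Proof.
case: hK X x0 => X x0.
  by have [phi h E] := hahn_banach_real x0; exists phi => //; rewrite /rnorm E.
by have [phi h E] := hahn_banach_complex x0; exists phi => //; rewrite /rnorm E.
Qed.

Section Banach.
Context {R : realType} {K : numFieldType} {re : K -> R} (e : scalar_embedding re).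
Context {X : completeNormedModType K}.
Local Notation rnorm := (rnorm re).

Lemma cauchy_rnorm_cvg (u : nat -> X) :
  (forall eps : R, 0 < eps -> exists N, forall i, (N <= i)%N ->
    rnorm (u N - u i) <= eps) ->
  exists x, forall eps : R, 0 < eps -> exists N, forall i, (N <= i)%N ->
    rnorm (x - u i) <= eps.
Proof.
move=> H; have rep (eps : K) : 0 < eps -> 0 < re eps.
  by move=> eps0; rewrite -(emb_lt e) (reK e) ?(ltW eps0)// rmorph0.
have : cvg (u @ \oo)%classic.
  apply: cauchy_cvg; apply: cauchy_exP => eps eps0.
  have [N HN] := H (re eps / 2) (divr_gt0 (rep _ eps0) (ltr0n _ 2)).
  exists (u N), N => // i /= /HN h; rewrite -ball_normE /= (normE_rnorm e).
  rewrite -(reK e (ltW eps0)) emb_lt; apply: le_lt_trans h _.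
  by rewrite ltr_pdivrMr// ltr_pMr ?ltr1n// rep.
rewrite cvg_ex => -[x /cvgrPdist_le /= Hx]; exists x => eps eps0.
have e0 : 0 < e eps by rewrite -(rmorph0 e) emb_lt.
have [N _ HN] := Hx _ e0; exists N => i /HN /=.
by rewrite (normE_rnorm e) emb_le.
Qed.

End Banach.

(** * Random signs and cotype *)

Section Walsh.
Context {R : realType} {n : nat}.
Local Notation cube := {ffun 'I_n -> bool}.
Implicit Types (f g : cube -> R) (A : {set 'I_n}) (w : cube).

Definition walsh A w : R := \prod_(i in A) (-1) ^+ w i.

Definition flip (i : 'I_n) w : cube := [ffun j => w j (+) (j == i)].

Definition flip_all w : cube := [ffun j => ~~ w j].

Definition fourier f A : R := \sum_w f w * walsh A w.

Lemma flipK i : involutive (flip i).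
Proof. by move=> w; apply/ffunP => j; rewrite !ffunE -addbA addbb addbF. Qed.

Lemma flip_allK : involutive flip_all.
Proof. by move=> w; apply/ffunP => j; rewrite !ffunE negbK. Qed.

Lemma walsh_flip A i w : walsh A (flip i w) = (-1) ^+ (i \in A) * walsh A w.
Proof.
rewrite /walsh; under eq_bigr => j _ do rewrite ffunE signr_addb.
rewrite big_split/= mulrC; congr (_ * _).
have [iA|iA] := boolP (i \in A).
  rewrite (bigD1 i)//= eqxx big1 ?mulr1// => j /andP[_ /negbTE->].
  by rewrite expr0.
rewrite big1// => j jA; have [ji|_] := eqVneq j i; last by rewrite expr0.
by rewrite ji (negbTE iA) in jA.
Qed.

Lemma walsh_flip_all A w : walsh A (flip_all w) = (-1) ^+ #|A| * walsh A w.
Proof.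
rewrite /walsh -prodr_const -big_split/=; apply: eq_bigr => j _.
by rewrite ffunE signrN mulN1r.
Qed.

(** The sum over A is the expansion of a product of factors 1 + (sign of w_i)(sign of w'_i); a
    coordinate where w and w' disagree gives a zero factor. *)
Lemma sum_walsh w w' : \sum_A walsh A w * walsh A w' = 2 ^+ n * (w == w')%:R.
Proof.
transitivity (\prod_i (1 + (-1) ^+ (w i (+) w' i)) : R).
  rewrite bigA_distr/= [LHS](reindex_inj (@finset.setC_inj _))/=.
  apply: eq_bigr => A _; rewrite /walsh -big_split/= [LHS]big_mkcond/=.
  apply: eq_bigr => i _; rewrite inE; case: (i \in A) => //=.
  by rewrite signr_addb.
have [->|ww'] := eqVneq w w'.
  by rewrite (eq_bigr (fun=> 2)) ?prodr_const ?card_ord ?mulr1// => i _; rewrite addbb.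
have /existsP[i wi] : [exists i, w i != w' i].
  rewrite -negb_forall; apply: contra ww' => /forallP h.
  by apply/eqP/ffunP => i; apply/eqP.
rewrite (bigD1 i)//= mulr0; move: wi; case: (w i); case: (w' i) => //= _;
  by rewrite expr1 subrr mul0r.
Qed.

Lemma parseval f g : \sum_A fourier f A * fourier g A = 2 ^+ n * \sum_w f w * g w.
Proof.
rewrite /fourier.
transitivity (\sum_w \sum_w' f w * g w' * \sum_A walsh A w * walsh A w').
  under eq_bigr => A _ do rewrite big_distrlr/=.
  rewrite exchange_big/=; apply: eq_bigr => w _.
  rewrite exchange_big/=; apply: eq_bigr => w' _.
  by rewrite mulr_sumr; apply: eq_bigr => A _; rewrite mulrACA.
rewrite mulr_sumr; apply: eq_bigr => w _.
under eq_bigr => w' _ do rewrite sum_walsh.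
rewrite (bigD1 w)//= eqxx big1 ?addr0 => [|w' /negbTE]; first by rewrite mulr1 mulrC.
by rewrite eq_sym => ->; rewrite !mulr0.
Qed.

Lemma fourier0 f : fourier f finset.set0 = \sum_w f w.
Proof. by apply: eq_bigr => w _; rewrite /walsh finset.big_set0 mulr1. Qed.

Lemma fourier_flip f i A :
  fourier (fun w => f (flip i w)) A = (-1) ^+ (i \in A) * fourier f A.
Proof.
rewrite /fourier [LHS](reindex_inj (inv_inj (flipK i)))/= mulr_sumr.
by apply: eq_bigr => w _; rewrite flipK walsh_flip mulrCA.
Qed.

Lemma fourier_laplacian f A :
  fourier (fun w => \sum_i (f w - f (flip i w))) A = 2 * #|A|%:R * fourier f A.
Proof.
transitivity (\sum_i (fourier f A - fourier (fun w => f (flip i w)) A)).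
  rewrite /fourier; under eq_bigr => w _ do rewrite mulr_suml.
  rewrite exchange_big/=; apply: eq_bigr => i _.
  by rewrite -sumrB; apply: eq_bigr => w _; rewrite mulrBl.
rewrite (eq_bigr (fun i => if i \in A then 2 * fourier f A else 0)).
  by rewrite -big_mkcond/= sumr_const -[LHS]mulr_natr mulrAC.
move=> i _; rewrite fourier_flip; case: (i \in A).
  by rewrite expr1 mulN1r opprK mulr_natl mulr2n.
by rewrite expr0 mul1r subrr.
Qed.

Lemma fourier_even f A : (forall w, f (flip_all w) = f w) -> odd #|A| ->
  fourier f A = 0.
Proof.
move=> fE oA; have : fourier f A = - fourier f A.
  rewrite {1}/fourier (reindex_inj (inv_inj flip_allK))/= -sumrN.
  by apply: eq_bigr => w _; rewrite fE walsh_flip_all -signr_odd oA expr1 mulN1r mulrN.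
by move/eqP; rewrite -addr_eq0 -mulr2n mulrn_eq0 => /eqP.
Qed.

(* The Poincare inequality gains a factor 2 on even functions, whose Walsh
   expansion has no term of degree 1. *)
Lemma poincare_even f : (forall w, f (flip_all w) = f w) ->
  2 ^+ n * (\sum_w f w ^+ 2) - (\sum_w f w) ^+ 2 <=
  4^-1 * (2 ^+ n * \sum_w f w * \sum_i (f w - f (flip i w))).
Proof.
move=> fE; rewrite -parseval -fourier0.
have -> : \sum_w f w ^+ 2 = \sum_w f w * f w by apply: eq_bigr => w _; rewrite expr2.
rewrite -parseval (bigD1 finset.set0)//= expr2 addrAC subrr add0r.
rewrite mulr_sumr [leRHS](bigD1 finset.set0)//= fourier_laplacian finset.cards0 mulr0 mul0r !mulr0 add0r.
apply: ler_sum => A A0; rewrite fourier_laplacian.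
have [oA|eA] := boolP (odd #|A|); first by rewrite (fourier_even fE oA) !mul0r mulr0.
have A2 : (2 <= #|A|)%N.
  by move: A0 eA; rewrite -finset.card_gt0; case: #|A| => [|[|]].
have A2' : (2 : R) <= #|A|%:R by rewrite ler_nat.
have -> : 4^-1 * (fourier f A * (2 * #|A|%:R * fourier f A)) =
  (#|A|%:R / 2) * (fourier f A * fourier f A) :> R by field.
by rewrite ler_peMl -?expr2 ?sqr_ge0// ler_pdivlMr// mul1r.
Qed.

End Walsh.

(** * Comparison of the first two moments of signed sums *)

Section Kahane.
Context {R : realType} {K : numFieldType} {re : K -> R} (e : scalar_embedding re).
Context {Y : normedModType K}.
Local Notation rnorm := (rnorm re).

Definition rademacher n (y : 'I_n -> Y) (w : {ffun 'I_n -> bool}) : Y :=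
  \sum_(i < n) (-1) ^+ w i *: y i.

(** The norm f of the signed sum S is even, and its Laplacian is at most 2 f: the n sums with one
    flipped sign add up to n S - 2 S, so the triangle inequality bounds n f by 2 f plus the sum of
    their norms. The Poincare inequality for even functions then bounds the variance of f by half of
    its second moment. *)
Lemma kahane n (y : 'I_n -> Y) :
  2 ^+ n * \sum_w rnorm (rademacher y w) ^+ 2 <=
  2 * (\sum_w rnorm (rademacher y w)) ^+ 2.
Proof.
set f := fun w => rnorm (rademacher y w).
have f0 w : 0 <= f w := rnorm_ge0 e _.
have fE w : f (flip_all w) = f w.
  rewrite /f -[LHS]rnormN; congr (Defs.rnorm _ _); rewrite /rademacher -sumrN.
  by apply: eq_bigr => i _; rewrite ffunE signrN scaleNr opprK.
have flipE w i : rademacher y (flip i w) =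
    rademacher y w - 2 *: ((-1) ^+ w i *: y i).
  rewrite /rademacher (bigD1 i)//= [in RHS](bigD1 i)//= ffunE eqxx addbT signrN.
  rewrite (eq_bigr (fun j => (-1) ^+ w j *: y j)) => [|j /negbTE ji]; last first.
    by rewrite ffunE ji addbF.
  set S := \sum_(j | _) _.
  by rewrite scaleNr scaler_nat mulr2n opprD addrA [_ *: _ + S]addrC addrK addrC.
have lap w : \sum_i (f w - f (flip i w)) <= 2 * f w.
  have : f w *+ n <= 2 * f w + \sum_i f (flip i w).
    have -> : f w *+ n = rnorm (rademacher y w *+ n).
      by rewrite -[in RHS]scaler_nat -(rmorph_nat e) (rnormZr e) ger0_norm// mulr_natl.
    have -> : rademacher y w *+ n = 2 *: rademacher y w + \sum_i rademacher y (flip i w).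
      under [X in _ + X]eq_bigr => i _ do rewrite flipE.
      by rewrite sumrB sumr_const card_ord -scaler_sumr addrCA subrr addr0.
    apply: le_trans (rnormD e _ _) _; apply: lerD; last exact: (rnorm_sum e).
    by rewrite -(rmorph_nat e) (rnormZr e) ger0_norm.
  by rewrite sumrB sumr_const card_ord lerBlDr.
have := poincare_even fE.
have : \sum_w f w * \sum_i (f w - f (flip i w)) <= 2 * \sum_w f w ^+ 2.
  rewrite mulr_sumr ler_sum// => w _.
  by rewrite expr2 mulrCA ler_wpM2l.
have n2 : 0 <= (2 : R) ^+ n by rewrite exprn_ge0.
move=> /(ler_wpM2l n2) h1 h2.
have -> : \sum_w rnorm (rademacher y w) ^+ 2 = \sum_w f w ^+ 2 by [].
have -> : \sum_w rnorm (rademacher y w) = \sum_w f w by [].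
move: h1 h2; rewrite mulrCA; set S := 2 ^+ n * \sum_w f w ^+ 2.
set B := (\sum_w f w) ^+ 2; set L := 2 ^+ n * _ => h1 h2.
lra.
Qed.

(** The first moment, unlike the quadratic one, can be pulled out of an l_q norm by Minkowski's
    inequality when cotype is applied in one variable after another. *)
Lemma cotype_average q : 0 < q -> cotype re q Y -> exists2 C : R, 0 < C &
  forall n (y : 'I_n -> Y), (\sum_i rnorm (y i) `^ q) `^ q^-1 <=
    C * (2 ^- n * \sum_w rnorm (rademacher y w)).
Proof.
move=> q0 [C C0 H]; exists (C * Num.sqrt 2); first by rewrite mulr_gt0// sqrtr_gt0.
move=> n y; apply: le_trans (H n y) _; rewrite -mulrA ler_wpM2l ?(ltW C0)//.
set M := 2 ^- n * \sum_w rnorm (rademacher y w).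
have n2 : 0 < (2 : R) ^+ n by rewrite exprn_gt0.
have M0 : 0 <= M.
  rewrite mulr_ge0 ?invr_ge0 ?(ltW n2)// sumr_ge0// => w _; exact: (rnorm_ge0 e).
have -> : M = Num.sqrt (M ^+ 2) by rewrite sqrtr_sqr ger0_norm.
rewrite -sqrtrM// ler_wsqrtr// /M exprMn mulrCA expr2 -mulrA.
rewrite ler_wpM2l ?invr_ge0 ?(ltW n2)//.
rewrite -(ler_pM2l n2) [leRHS]mulrA mulfV ?gt_eqF// mul1r.
exact: kahane.
Qed.

End Kahane.

Definition ffun_upd (I T : finType) (i : {ffun I -> T}) (l : I) (a : T) : {ffun I -> T} :=
  [ffun j => if j == l then a else i j].

(** Lets one coordinate be summed separately while all functions keep the full domain; the redundant
    coordinate is counted by #|T|. The bijection behind it exchanges a with the old value i l. *)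
Lemma sum_ffun_upd (R : nmodType) (I T : finType) (l : I) (F : {ffun I -> T} -> R) :
  \sum_i \sum_a F (ffun_upd i l a) = (\sum_i F i) *+ #|T|.
Proof.
rewrite pair_big/= -sumrMnl.
transitivity (\sum_(p : {ffun I -> T} * T) F p.1); last first.
  rewrite -(pair_big xpredT xpredT (fun i (_ : T) => F i))/=.
  by apply: eq_bigr => i _; rewrite sumr_const.
pose h (p : {ffun I -> T} * T) := (ffun_upd p.1 l p.2, p.1 l).
have hK : involutive h.
  move=> [i a]; rewrite /h /=; congr (_, _); last by rewrite ffunE eqxx.
  by apply/ffunP => j; rewrite !ffunE; have [->|] := eqVneq j l.
by rewrite [RHS](reindex_inj (inv_inj hK)).
Qed.

(** * Cotype applied in every variable *)

Section MultilinearCotype.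
Context {R : realType} {K : numFieldType} {re : K -> R} (e : scalar_embedding re).
Context {m : nat} {X : 'I_m -> completeNormedModType K} {Y : completeNormedModType K}.
Context {T : (forall j, X j) -> Y} (hT : multilinear T).
Local Notation rnorm := (rnorm re).

Definition partial_map (k : 'I_m) (x : forall j, X j) : {linear X k -> Y} :=
  HB.pack (fun u : X k => T (dfwith x k u)) (GRing.isLinear.Build _ _ _ _ _ (@hT k x)).

Lemma partial_mapE k x u : partial_map k x u = T (dfwith x k u).
Proof. by []. Qed.

Lemma multilinear_eq0 k (x : forall j, X j) : x k = 0 -> T x = 0.
Proof.
move=> xk; have -> : x = dfwith x k 0.
  by apply: functional_extensionality_dep => j; case: dfwithP.
by rewrite -partial_mapE linear0.
Qed.

Lemma multilinear_scale (c : 'I_m -> K) (x : forall j, X j) :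
  T (fun j => c j *: x j) = (\prod_j c j) *: T x.
Proof.
pose v d (j : 'I_m) := if (j < d)%N then c j *: x j else x j.
suff H d : (d <= m)%N -> T (v d) = (\prod_(j < m | (j < d)%N) c j) *: T x.
  have -> : \prod_j c j = \prod_(j < m | (j < m)%N) c j.
    by apply: eq_bigl => j; rewrite ltn_ord.
  by rewrite -H//; congr T; apply: functional_extensionality_dep => j; rewrite /v ltn_ord.
elim: d => [_|d IH dm].
  by rewrite big_pred0_eq scale1r; congr T; apply: functional_extensionality_dep.
set l := Ordinal dm.
have -> : v d.+1 = dfwith (v d) l (c l *: x l).
  apply: functional_extensionality_dep => j; rewrite /v.
  case: dfwithP => [|j' lj']; first by rewrite /= ltnSn.
  by rewrite ltnS leq_eqVlt (_ : (j' == d :> nat) = false)//; apply/negbTE; rewrite eq_sym.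
have vE : v d = dfwith (v d) l (x l).
  apply: functional_extensionality_dep => j; rewrite /v.
  by case: dfwithP => //=; rewrite ltnn.
have -> : T (dfwith (v d) l (c l *: x l)) = c l *: T (dfwith (v d) l (x l)).
  by rewrite -!partial_mapE linearZ.
rewrite -vE (IH (ltnW dm)) scalerA.
rewrite [in RHS](bigD1 l)//=; congr (_ * _ *: _); apply: eq_bigl => j.
by rewrite ltnS [LHS]ltn_neqAle andbC.
Qed.

Lemma multilinear_rademacher n (y : forall j, 'I_n -> X j) x l w :
  rademacher (fun a => T (dfwith x l (y l a))) w =
  T (dfwith x l (rademacher (y l) w)).
Proof.
rewrite -partial_mapE /rademacher linear_sum; apply: eq_bigr => a _.
by rewrite linearZ.
Qed.

Lemma cotype_multilinear q : 1 <= q -> cotype re q Y -> exists2 C : R, 0 < C &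
  forall n (y : forall j, 'I_n -> X j), (0 < n)%N ->
  (\sum_(i : {ffun 'I_m -> 'I_n}) rnorm (T (fun j => y j (i j))) `^ q) `^ q^-1 <=
  C * (((2 ^+ n) ^+ m)^-1 * \sum_(w : {ffun 'I_m -> {ffun 'I_n -> bool}})
         rnorm (T (fun j => rademacher (y j) (w j)))).
Proof.
move=> q1 ct; have q0 := lt_le_trans ltr01 q1.
have qn0 : q != 0 by rewrite gt_eqF.
have qV : 0 <= q^-1 by rewrite invr_ge0 ltW.
have [C C0 HC] := cotype_average e q0 ct; exists (C ^+ m); first exact: exprn_gt0.
move=> n y n0.
(* In the first d variables the vectors are replaced by their signed sums. *)
pose v d (w : {ffun 'I_m -> {ffun 'I_n -> bool}}) (i : {ffun 'I_m -> 'I_n}) j : X j :=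
  if (j < d)%N then rademacher (y j) (w j) else y j (i j).
pose F d w i := rnorm (T (v d w i)) `^ q.
have F0 d w i : 0 <= F d w i by exact: powR_ge0.
have N0 : 0 < n%:R :> R by rewrite ltr0n.
have p2 k : 0 < (2 : R) ^+ k by exact: exprn_gt0.
have p22 k l : 0 < ((2 : R) ^+ k) ^+ l by rewrite !exprn_gt0.
have vS d (dm : (d < m)%N) w w' i :
    v d.+1 (ffun_upd w (Ordinal dm) w') i =
    dfwith (v d w i) (Ordinal dm) (rademacher (y (Ordinal dm)) w').
  apply: functional_extensionality_dep => j; rewrite /v.
  case: dfwithP => [|j' j'd]; first by rewrite /= ltnSn ffunE eqxx.
  rewrite ltnS leq_eqVlt ffunE.
  have /negbTE-> : j' != Ordinal dm by rewrite eq_sym.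
  by have /negbTE-> : j' != d :> nat by rewrite eq_sym; exact: j'd.
have vU d (dm : (d < m)%N) w i a :
    v d w (ffun_upd i (Ordinal dm) a) =
    dfwith (v d w i) (Ordinal dm) (y (Ordinal dm) a).
  apply: functional_extensionality_dep => j; rewrite /v.
  case: dfwithP => [|j' j'd]; first by rewrite /= ltnn ffunE eqxx.
  by rewrite ffunE eq_sym (negbTE j'd).
have step d (dm : (d < m)%N) w :
    2 ^+ n * (n%:R * \sum_i F d w i) `^ q^-1 <=
    C * \sum_w' (\sum_i F d.+1 (ffun_upd w (Ordinal dm) w') i) `^ q^-1.
  set l := Ordinal dm.
  have -> : n%:R * \sum_i F d w i =
      \sum_i \sum_a rnorm (T (dfwith (v d w i) l (y l a))) `^ q.
    rewrite mulr_natl -[n in _ *+ n]card_ord -(sum_ffun_upd l).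
    by apply: eq_bigr => i _; apply: eq_bigr => a _; rewrite /F vU.
  pose G i w' := rnorm (T (dfwith (v d w i) l (rademacher (y l) w'))).
  have G0 i w' : 0 <= G i w' by exact: (rnorm_ge0 e).
  have GE i w' : G i w' `^ q = F d.+1 (ffun_upd w l w') i by rewrite /F vS.
  have h i : \sum_a rnorm (T (dfwith (v d w i) l (y l a))) `^ q <=
      (C * 2 ^- n * \sum_w' G i w') `^ q.
    have := HC n (fun a => T (dfwith (v d w i) l (y l a))).
    under [X in _ <= _ * (_ * X) -> _]eq_bigr => w' _ do rewrite multilinear_rademacher.
    move=> /(powR_le (ltW q0) (powR_ge0 _ _)).
    rewrite powRVK ?gt_eqF// ?mulrA// sumr_ge0// => a _; exact: powR_ge0.
  have CN : 0 <= C * 2 ^- n by rewrite mulr_ge0 ?invr_ge0 ?(ltW C0) ?(ltW (p2 n)).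
  rewrite -ler_pdivlMl//.
  apply: (@le_trans _ _ (C * 2 ^- n * (\sum_i (\sum_w' G i w') `^ q) `^ q^-1)).
    rewrite -[X in X * _](powRK CN qn0) -powRM ?powR_ge0 ?sumr_ge0//; last first.
      by move=> i _; exact: powR_ge0.
    apply: powR_le => //.
      by apply: sumr_ge0 => i _; apply: sumr_ge0 => a _; exact: powR_ge0.
    rewrite mulr_sumr ler_sum// => i _; rewrite -powRM ?sumr_ge0//.
  rewrite mulrA [2 ^- n * C]mulrC ler_wpM2l//.
  apply: le_trans (sum_minkowski_sum _ _ q1 G0) _.
  rewrite le_eqVlt; apply/orP; left; apply/eqP; apply: eq_bigr => w' _.
  by congr (_ `^ _); apply: eq_bigr => i _; exact: GE.
have alg (a c Z B C' B' : R) : 0 <= c -> 0 <= Z -> a * B <= C' * B' ->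
    a * (c * (Z * B)) <= C' * c * (Z * B').
  move=> c0 Z0 h; have -> : a * (c * (Z * B)) = (c * Z) * (a * B) by ring.
  have -> : C' * c * (Z * B') = (c * Z) * (C' * B') by ring.
  by apply: ler_wpM2l h; rewrite mulr_ge0.
(* [F d w i] no longer depends on the first d coordinates of i, so summing over all i repeats each
   value n^d times; the factor n^d on the left compensates. *)
have claim d : (d <= m)%N ->
    (n%:R ^+ d * \sum_(i : {ffun 'I_m -> 'I_n}) rnorm (T (fun j => y j (i j))) `^ q) `^ q^-1 <=
    C ^+ d * (((2 ^+ n) ^+ m)^-1 * \sum_w (\sum_i F d w i) `^ q^-1).
  elim: d => [_|d IH dm].
    rewrite !mul1r; set S := (_ `^ q^-1).
    have -> : \sum_w (\sum_i F 0 w i) `^ q^-1 = \sum_(w : {ffun 'I_m -> {ffun 'I_n -> bool}}) S.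
      by [].
    rewrite sumr_const !card_ffun card_bool !card_ord -[S *+ _]mulr_natl mulrA.
    by rewrite !natrX mulVf ?mul1r// gt_eqF.
  rewrite exprS -mulrA powRM ?ler0n//; last first.
    by rewrite mulr_ge0 ?exprn_ge0 ?ler0n// sumr_ge0// => i _; exact: powR_ge0.
  apply: le_trans (ler_wpM2l (powR_ge0 _ _) (IH (ltnW dm))) _.
  rewrite exprS; apply: alg; [by rewrite exprn_ge0 ?(ltW C0)|by rewrite invr_ge0 (ltW (p22 _ _))|].
  have EB : 2 ^+ n * (\sum_w (\sum_i F d.+1 w i) `^ q^-1) =
      \sum_w \sum_w' (\sum_i F d.+1 (ffun_upd w (Ordinal dm) w') i) `^ q^-1.
    rewrite (sum_ffun_upd _ (fun w => (\sum_i F d.+1 w i) `^ q^-1)).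
    by rewrite card_ffun card_bool card_ord -[RHS]mulr_natl natrX.
  rewrite -(ler_pM2l (p2 n)) [leRHS]mulrCA EB !mulr_sumr.
  apply: ler_sum => w _; apply: le_trans (step d dm w).
  by rewrite powRM ?(ltW N0) ?sumr_ge0.
have := claim m (leqnn m).
have S0 : 0 <= \sum_(i : {ffun 'I_m -> 'I_n}) rnorm (T (fun j => y j (i j))) `^ q.
  by apply: sumr_ge0 => i _; exact: powR_ge0.
have nm : 0 < (n%:R : R) ^+ m by exact: exprn_gt0.
rewrite (powRM _ (ltW nm) S0).
have -> : \sum_w (\sum_i F m w i) `^ q^-1 =
    (n%:R ^+ m) `^ q^-1 * \sum_(w : {ffun 'I_m -> {ffun 'I_n -> bool}})
      rnorm (T (fun j => rademacher (y j) (w j))).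
  rewrite mulr_sumr; apply: eq_bigr => w _.
  have E i : v m w i = fun j => rademacher (y j) (w j).
    by apply: functional_extensionality_dep => j; rewrite /v ltn_ord.
  rewrite (eq_bigr (fun=> rnorm (T (fun j => rademacher (y j) (w j))) `^ q)) => [|i _];
    last by rewrite /F E.
  rewrite sumr_const card_ffun !card_ord -[LHS]/((_ *+ _) `^ _) -[X in X `^ _]mulr_natl natrX.
  by rewrite powRM ?powR_ge0 ?(ltW nm)// powRK ?(rnorm_ge0 e)// gt_eqF.
have alg' (c Z N U S' : R) : 0 < N -> N * S' <= c * (Z * (N * U)) -> S' <= c * (Z * U).
  move=> Np; have -> : c * (Z * (N * U)) = N * (c * (Z * U)) by ring.
  by rewrite ler_pM2l.
by apply: alg'; exact: powR_gt0.
Qed.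

End MultilinearCotype.

(** * Uniform boundedness and weak norms *)

Section UniformBoundedness.
Context {R : realType} {K : numFieldType} {re : K -> R} (e : scalar_embedding re).
Local Notation rnorm := (rnorm re).

Definition bounded_seminorm (X : normedModType K) (N : X -> R) :=
  [/\ forall x y, N (x + y) <= N x + N y,
      forall a x, N (e a *: x) = `|a| * N x &
      exists B, forall x, N x <= B * rnorm x].

Context {X : completeNormedModType K}.

(** Nested balls in place of Baire's theorem: if the claim fails, every ball contains a smaller one
    on which some N in [F] exceeds n, and the common point contradicts pointwise boundedness.
    Seminorms replace operators because the application is to l_r norms of finite families of
    operators. *)
Theorem seminorm_uniform_bounded (F : set (X -> R)) :
  (forall N, F N -> bounded_seminorm N) ->
  (forall x, exists M, forall N, F N -> N x <= M) ->
  exists M, forall N, F N -> forall x, rnorm x <= 1 -> N x <= M.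
Proof.
move=> semi ptw; apply: contrapT => /forallNP H.
have big (M : R) : exists N x, [/\ F N, rnorm x <= 1 & M < N x].
  have /existsNP[N /not_implyP[FN /existsNP[x /not_implyP[x1 h]]]] := H M.
  by exists N, x; split=> //; rewrite ltNge; apply/negP.
have step (n : nat) (p : X * R) : exists p' : X * R, 0 < p.2 ->
    [/\ 0 < p'.2, p'.2 <= p.2 / 2, rnorm (p'.1 - p.1) <= p.2 / 2 &
     exists2 N, F N & forall y, rnorm (y - p'.1) <= p'.2 -> n%:R < N y].
  have [d0|d0] := ltP 0 p.2; last by exists p; rewrite ltNge d0.
  have d2 : 0 < p.2 / 2 by rewrite divr_gt0.
  have [N [x [FN x1 Nx]]] := big (n%:R / (p.2 / 2)).
  have [ND NZ [B NB]] := semi N FN.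
  pose xi := e (p.2 / 2) *: x.
  have Nxi : n%:R < N xi by rewrite NZ gtr0_norm// mulrC -ltr_pdivrMr.
  have xid : rnorm xi <= p.2 / 2.
    by rewrite (rnormZr e) gtr0_norm// ler_piMr// ltW.
  have Nopp y : N (- y) = N y.
    by have := NZ (-1) y; rewrite rmorphN rmorph1 scaleN1r normrN1 mul1r.
  (* Since 2 xi = (p.1 + xi) - (p.1 - xi) and N xi > n, the seminorm exceeds n at one of these two
     points. *)
  have [x' x'd Nx'] : exists2 x', rnorm (x' - p.1) <= p.2 / 2 & n%:R < N x'.
    have [h|h] := ltP n%:R (N (p.1 + xi)).
      by exists (p.1 + xi) => //; rewrite addrAC subrr add0r.
    exists (p.1 - xi); first by rewrite addrAC subrr add0r rnormN.
    rewrite ltNge; apply/negP => h'.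
    have : N (xi + xi) <= n%:R + n%:R.
      have -> : xi + xi = (p.1 + xi) - (p.1 - xi).
        by rewrite opprB [p.1 + xi]addrC addrACA subrr addr0.
      by apply: le_trans (ND _ _) _; rewrite Nopp lerD.
    have -> : xi + xi = e 2 *: xi by rewrite rmorph_nat scaler_nat mulr2n.
    by rewrite NZ ger0_norm//; lra.
  have eta0 : 0 < N x' - n%:R by rewrite subr_gt0.
  pose B' := `|B| + 1; have B'0 : 0 < B' by rewrite ltr_wpDl.
  (* Within this radius N changes by at most half of its excess over n. *)
  pose d' := Num.min (p.2 / 2) ((N x' - n%:R) / (2 * B')).
  have B20 : 0 < 2 * B' by rewrite mulr_gt0.
  exists (x', d') => _; split=> //=.
  - by rewrite lt_min d2 divr_gt0.
  - by rewrite ge_min lexx.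
  exists N => // y yx'.
  have h1 : N x' <= N y + N (y - x').
    rewrite -Nopp -[X in X <= _]Nopp opprK -[in leLHS](subrK y x') addrC.
    by apply: le_trans (ND _ _) _; rewrite lerD2l -[leRHS]Nopp opprB.
  have h2 : N (y - x') <= (N x' - n%:R) / 2.
    apply: le_trans (NB _) _; apply: (@le_trans _ _ (B' * rnorm (y - x'))).
      by rewrite ler_wpM2r ?(rnorm_ge0 e)// (le_trans (ler_norm B))// lerDl.
    have : rnorm (y - x') <= (N x' - n%:R) / (2 * B').
      by apply: le_trans yx' _; rewrite ge_min lexx orbT.
    rewrite ler_pdivlMr// => h; rewrite ler_pdivlMr//; apply: le_trans h.
    by rewrite le_eqVlt; apply/orP; left; apply/eqP; ring.
  lra.
have [G HG] : {G : nat -> X * R -> X * R | forall n p, 0 < p.2 ->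
    [/\ 0 < (G n p).2, (G n p).2 <= p.2 / 2, rnorm ((G n p).1 - p.1) <= p.2 / 2 &
     exists2 N, F N & forall y, rnorm (y - (G n p).1) <= (G n p).2 -> n%:R < N y]}.
  exists (fun n p => sval (cid (step n p))) => n p; exact: (svalP (cid (step n p))).
pose s := fix s n := if n is n'.+1 then G n' (s n') else (0 : X, 1 : R).
have s0 n : 0 < (s n).2.
  by elim: n => [|n IH] /=; [exact: ltr01|have [] := HG n _ IH].
have sS n : [/\ (s n.+1).2 <= (s n).2 / 2, rnorm ((s n.+1).1 - (s n).1) <= (s n).2 / 2 &
     exists2 N, F N & forall y, rnorm (y - (s n.+1).1) <= (s n.+1).2 -> n%:R < N y].
  by have [] := HG n _ (s0 n).
have s2 n : (s n).2 <= 2 ^- n.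
  elim: n => [|n IH]; first by rewrite expr0 invr1.
  have [h _ _] := sS n; apply: le_trans h _.
  by rewrite exprSr invfM ler_wpM2r.
have nest n j : rnorm ((s (n + j)%N).1 - (s n).1) <= (s n).2 - (s (n + j)%N).2.
  elim: j => [|j IH]; first by rewrite addn0 !subrr (rnorm0 e).
  have [h1 h2 _] := sS (n + j)%N; rewrite addnS.
  rewrite -(subrKA (s (n + j)%N).1).
  by apply: le_trans (rnormD e _ _) _; lra.
have [|x Hx] := cauchy_rnorm_cvg e (u := fun n => (s n).1).
  move=> eps eps0; have [N HN] : exists N : nat, 2 ^- N <= eps.
    exists (Num.truncn eps^-1).+1; rewrite invf_ple ?posrE ?exprn_gt0//.
    apply: le_trans (ltW (truncnS_gt _)) _.
    by rewrite -natrX ler_nat ltnW// ltn_expl.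
  exists N => i /subnKC <-.
  rewrite -rnormN opprB; apply: le_trans (nest _ _) _.
  by have := s2 N; have := s0 (N + (i - N))%N; lra.
have xs n : rnorm (x - (s n).1) <= (s n).2.
  apply/ler_addgt0Pr => eps eps0; have [N HN] := Hx _ eps0.
  have h1 := HN (n + N)%N (leq_addl _ _).
  rewrite -(subrKA (s (n + N)%N).1).
  apply: le_trans (rnormD e _ _) _; have := nest n N.
  by have := s0 (n + N)%N; lra.
have [M HM] := ptw x.
have [_ _ [N FN HN]] := sS (Num.truncn M).+1.
have := HN x (xs _); have := HM N FN.
have : M < (Num.truncn M).+1%:R by exact: truncnS_gt.
lra.
Qed.

End UniformBoundedness.

Section ExtendedSums.
Local Open Scope classical_set_scope.
Context {R : realType}.

Lemma nneseries_leP (f : nat -> R) (M : R) : (forall i, 0 <= f i) ->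
  (\sum_(i <oo) (f i)%:E <= M%:E)%E <-> forall n, \sum_(i < n) f i <= M.
Proof.
move=> f0; have f0' i : (0 <= (f i)%:E)%E by rewrite lee_fin.
split=> [h n|h].
  rewrite -lee_fin; apply: le_trans h; rewrite -sumEFin.
  rewrite -(big_mkord xpredT (fun i => (f i)%:E)).
  exact: nneseries_lim_ge.
apply: lime_le; first exact: is_cvg_nneseries.
by apply: nearW => n; rewrite big_mkord sumEFin lee_fin.
Qed.

Lemma poweR_le_fin (x : \bar R) (M r : R) : (0 <= x)%E -> 0 <= M -> 0 < r ->
  (x `^ r^-1 <= M%:E)%E = (x <= (M `^ r)%:E)%E.
Proof.
move=> x0 M0 r0; have rV : 0 < r^-1 by rewrite invr_gt0.
case: x x0 => [x||] // x0.
  rewrite poweR_EFin !lee_fin; rewrite lee_fin in x0; apply/idP/idP => h.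
    by have := powR_le (ltW r0) (powR_ge0 _ _) h; rewrite powRVK ?gt_eqF.
  by have := powR_le (ltW rV) x0 h; rewrite powRK ?gt_eqF.
by rewrite poweRyr ?gt_eqF// !leye_eq.
Qed.

Lemma esum_box_le (m : nat) (f : {ffun 'I_m -> nat} -> R) (M : R) :
  (forall i, 0 <= f i) ->
  (\esum_(i in [set: {ffun 'I_m -> nat}]) (f i)%:E <= M%:E)%E <->
  forall n, \sum_(i : {ffun 'I_m -> 'I_n}) f [ffun j => val (i j)] <= M.
Proof.
move=> f0; split=> [h n|h].
  pose g (i : {ffun 'I_m -> 'I_n}) : {ffun 'I_m -> nat} := [ffun j => val (i j)].
  have gI : injective g.
    by move=> a b /ffunP ab; apply/ffunP => j; apply: val_inj; have := ab j; rewrite !ffunE.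
  rewrite -lee_fin; apply: le_trans h; apply: esum_ge.
  exists [set` [seq g i | i <- enum {: {ffun 'I_m -> 'I_n}}]].
    by split=> //; exact: finite_seq.
  rewrite -fsbig_seq; last by rewrite map_inj_uniq ?enum_uniq.
  rewrite big_map -sumEFin.
  by rewrite big_enum.
apply: ge_ereal_sup => _ [A [Afin _] <-].
rewrite fsbig_finite//= sumEFin lee_fin.
set s := finmap.enum_fset _.
have su : uniq s by exact: finmap.fset_uniq.
pose n := (\max_(i <- s) \max_j i j)%N.
have sn i : i \in s -> forall j, (i j < n.+1)%N.
  move=> si j; rewrite ltnS /n (big_rem i)//= leq_max; apply/orP; left.
  exact: (leq_bigmax j).
pose g (i : {ffun 'I_m -> nat}) : {ffun 'I_m -> 'I_n.+1} := [ffun j => inord (i j)].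
have gK i : i \in s -> [ffun j => val (g i j)] = i.
  by move=> si; apply/ffunP => j; rewrite !ffunE /= inordK// sn.
apply: le_trans (h n.+1).
rewrite big_seq (eq_bigr (fun i => f [ffun j => val (g i j)])) => [|i si]; last first.
  by rewrite gK.
rewrite -big_seq.
rewrite -(big_map g xpredT (fun i' : {ffun 'I_m -> 'I_n.+1} => f [ffun j => val (i' j)])).
rewrite big_uniq ?map_inj_in_uniq//; last first.
  by move=> a b sa sb ab; rewrite -(gK a)// -(gK b)// ab.
by rewrite [leRHS](bigID (mem (map g s)))/= lerDl sumr_ge0.
Qed.

Lemma prode_pinfty (I : finType) (f : I -> \bar R) (i : I) :
  (forall j, 0 < f j)%E -> f i = +oo%E -> (\prod_j f j = +oo)%E.
Proof.
move=> f0 fi; rewrite (bigD1 i)//= fi gt0_mulye//.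
by elim/big_ind : _ => // x y; exact: mule_gt0.
Qed.

End ExtendedSums.

(** * Reduction of summability to finite normalized families *)

Section WeakNorm.
Local Open Scope classical_set_scope.
Context {R : realType} {K : numFieldType} {re : K -> R} (hK : scalar_field re)
  (e : scalar_embedding re).
Local Notation rnorm := (rnorm re).

Definition weak_bounded (X : normedModType K) (p : R) n (z : 'I_n -> X) :=
  forall phi : {linear X -> K^o}, dual_ball phi ->
    \sum_a rnorm (phi (z a)) `^ p <= 1.

Lemma weak_norm_ge0 (X : normedModType K) p (x : nat -> X) : (0 <= weak_norm re p x)%E.
Proof.
have [phi hphi _] := hahn_banach hK (x 0%N).
apply: le_ereal_sup_tmp.
exists ((\sum_(i <oo) (rnorm (phi (x i)) `^ p)%:E) `^ p^-1)%E; first by exists phi.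
exact: poweR_ge0.
Qed.

Lemma weak_norm_le (X : normedModType K) p (x : nat -> X) (M : R) : 0 < p -> 0 <= M ->
  (weak_norm re p x <= M%:E)%E <->
  forall phi : {linear X -> K^o}, dual_ball phi ->
    forall n, \sum_(i < n) rnorm (phi (x i)) `^ p <= M `^ p.
Proof.
move=> p0 M0; have S0 (phi : {linear X -> K^o}) :
    (0 <= \sum_(i <oo) (rnorm (phi (x i)) `^ p)%:E)%E.
  by apply: nneseries_ge0 => i _ _; rewrite lee_fin powR_ge0.
split=> [h phi hphi|h].
  apply: (nneseries_leP (M `^ p) (fun i => powR_ge0 (rnorm (phi (x i))) p)).1.
  rewrite -poweR_le_fin//; apply: le_trans h.
  by apply: ereal_sup_ubound; exists phi.
apply: ge_ereal_sup => _ [phi hphi <-]; rewrite poweR_le_fin//.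
apply: (nneseries_leP (M `^ p) (fun i => powR_ge0 (rnorm (phi (x i))) p)).2.
exact: h.
Qed.

Lemma sum_extend0 (n N : nat) (f : 'I_n -> R) : (forall a, 0 <= f a) ->
  \sum_(i < N) oapp f 0 (insub (val i)) <= \sum_a f a.
Proof.
move=> f0; have E : \sum_(i < n) oapp f 0 (insub (val i)) = \sum_a f a.
  by apply: eq_bigr => a _; rewrite valK.
have g0 i : 0 <= oapp f 0 (insub i : option 'I_n) by case: insubP => //= a _ _; exact: f0.
rewrite -E -!(big_mkord xpredT (fun i => oapp f 0 (insub i : option 'I_n))).
have [Nn|nN] := leqP N n.
  by rewrite [leRHS](big_cat_nat (n := N))//= lerDl sumr_ge0.
rewrite [leLHS](big_cat_nat (n := n)) ?(ltnW nN)//= gerDl.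
rewrite big_nat big1// => i /andP[ni _]; rewrite insubF//.
by rewrite ltnNge ni.
Qed.

Lemma summing_finite (X Y : normedModType K) r p (u : X -> Y) :
  0 < r -> 0 < p -> u 0 = 0 -> summing re r p u ->
  exists2 C : R, 0 < C & forall n (z : 'I_n -> X), weak_bounded p z ->
    \sum_a rnorm (u (z a)) `^ r <= C.
Proof.
move=> r0 p0 u0 [C C0 H]; exists (C `^ r); first exact: powR_gt0.
move=> n z hz; pose x i : X := oapp z 0 (insub i).
have hx : (weak_norm re p x <= 1%:E)%E.
  apply: (weak_norm_le x p0 ler01).2 => phi hphi N; rewrite powR1.
  apply: le_trans (hz phi hphi).
  rewrite (eq_bigr (fun i : 'I_N => oapp (fun a => rnorm (phi (z a)) `^ p) 0 (insub (val i)))).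
    by apply: sum_extend0 => a; exact: powR_ge0.
  move=> i _; rewrite /x; case: insubP => //= _.
  by rewrite linear0 (rnorm0 e) powR0 ?gt_eqF.
have : ((\sum_(i <oo) (rnorm (u (x i)) `^ r)%:E) `^ r^-1 <= C%:E)%E.
  apply: le_trans (H x) _; rewrite -[leRHS]mule1.
  by apply: lee_pmul; rewrite ?lee_fin ?(ltW C0)// weak_norm_ge0.
rewrite poweR_le_fin ?(ltW C0)//; last first.
  by apply: nneseries_ge0 => i _ _; rewrite lee_fin powR_ge0.
move=> /(nneseries_leP (C `^ r) (fun i => powR_ge0 (rnorm (u (x i))) r)).1/(_ n).
apply: le_trans.
rewrite le_eqVlt; apply/orP; left; apply/eqP.
by apply: eq_bigr => a _; rewrite /x valK.
Qed.

Lemma weak_norm_eq0 (X : normedModType K) p (x : nat -> X) : 0 < p ->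
  weak_norm re p x = 0%E -> forall i, x i = 0.
Proof.
move=> p0 h i; have [phi hphi E] := hahn_banach hK (x i).
have /(weak_norm_le _ p0 (lexx 0))/(_ phi hphi i.+1) : (weak_norm re p x <= 0%:E)%E.
  by rewrite h.
rewrite (powR0 (lt0r_neq0 p0)) big_ord_recr/= => h1.
have S0 : 0 <= \sum_(j < i) rnorm (phi (x j)) `^ p.
  by apply: sumr_ge0 => j _; exact: powR_ge0.
have : rnorm (phi (x i)) `^ p <= 0 by apply: le_trans h1; rewrite lerDr.
rewrite E => h2; have : rnorm (x i) `^ p = 0 by apply: le_anti; rewrite h2 powR_ge0.
by move/powR_eq0_eq0/eqP; rewrite (rnorm_eq0 e) => /eqP.
Qed.

Lemma weak_bounded_scale (X : normedModType K) p (x : nat -> X) (w : R) n : 0 < p -> 0 < w ->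
  (weak_norm re p x <= w%:E)%E ->
  weak_bounded p (fun a : 'I_n => e w^-1 *: x a).
Proof.
move=> p0 w0 /(weak_norm_le _ p0 (ltW w0)) h phi hphi.
have wV : 0 <= w^-1 by rewrite invr_ge0 ltW.
under eq_bigr => a _ do rewrite linearZ (rnormZr e) (ger0_norm wV) powRM ?(rnorm_ge0 e)//.
rewrite -mulr_sumr powRV ?(ltW w0)// ler_pdivrMl ?powR_gt0// mulr1.
exact: h.
Qed.

Lemma finite_summing (X Y : normedModType K) r p (u : {linear X -> Y}) (C : R) :
  0 < r -> 0 < p -> (forall n (z : 'I_n -> X), weak_bounded p z ->
    \sum_a rnorm (u (z a)) `^ r <= C) -> summing re r p u.
Proof.
move=> r0 p0 H.
have C0 : 0 <= C.
  by apply: le_trans (H 0%N (fun=> 0) _); rewrite ?big_ord0// => phi _; rewrite big_ord0.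
(* Adding 1 only secures D > 0. *)
pose D := C `^ r^-1 + 1; have D0 : 0 < D by rewrite ltr_wpDl ?powR_ge0.
exists D => // x; have [w0|w0] := eqVneq (weak_norm re p x) 0%E.
  rewrite w0 mule0 eseries0 => [|i _ _]; first by rewrite poweR0r ?invr_eq0 ?gt_eqF.
  by rewrite (weak_norm_eq0 p0 w0) linear0 (rnorm0 e) powR0 ?gt_eqF.
have := weak_norm_ge0 p x; case E : (weak_norm re p x) w0 => [w||]// w0 wge.
  have wp : 0 < w by move: w0 wge; rewrite eqe lee_fin lt0r => -> ->.
  rewrite -EFinM poweR_le_fin ?mulr_ge0 ?(ltW D0) ?(ltW wp)//; last first.
    by apply: nneseries_ge0 => i _ _; rewrite lee_fin powR_ge0.
  apply: (nneseries_leP _ (fun i => powR_ge0 (rnorm (u (x i))) r)).2 => n.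
  have := H n _ (weak_bounded_scale n p0 wp (_ : (weak_norm re p x <= w%:E)%E)).
  rewrite E => /(_ (lexx _)).
  have wV : 0 <= w^-1 by rewrite invr_ge0 ltW.
  under eq_bigr => a _ do rewrite linearZ (rnormZr e) (ger0_norm wV) powRM ?(rnorm_ge0 e)//.
  rewrite -mulr_sumr powRV ?(ltW wp)// ler_pdivrMl ?powR_gt0// => /le_trans; apply.
  rewrite powRM ?(ltW D0) ?(ltW wp)// mulrC ler_wpM2r ?powR_ge0//.
  rewrite -[X in X <= _](powRVK C0 (lt0r_neq0 r0)).
  by apply: powR_le; rewrite ?powR_ge0 ?(ltW r0)// lerDl.
by rewrite gt0_muley ?lte_fin// leey.
Qed.

Lemma finite_multiple_summing m (X : 'I_m -> completeNormedModType K)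
    (Y : completeNormedModType K) (T : (forall j, X j) -> Y) s (t : 'I_m -> R) (C : R) :
  multilinear T -> 0 < s -> (forall j, 0 < t j) ->
  (forall n (z : forall j, 'I_n -> X j), (forall j, weak_bounded (t j) (z j)) ->
    \sum_(i : {ffun 'I_m -> 'I_n}) rnorm (T (fun j => z j (i j))) `^ s <= C) ->
  multiple_summing re s t T.
Proof.
move=> hT s0 t0 H.
have C0 : 0 <= C.
  apply: le_trans (H 0%N (fun j _ => 0) _).
    by apply: sumr_ge0 => i _; exact: powR_ge0.
  by move=> j phi _; rewrite big_ord0 ler01.
pose D := C `^ s^-1 + 1; have D0 : 0 < D by rewrite ltr_wpDl ?powR_ge0.
exists D => // x.
have S0 : (0 <= \esum_(i in [set: {ffun 'I_m -> nat}])
    (rnorm (T (fun j => x j (i j))) `^ s)%:E)%E.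
  by apply: esum_ge0 => i _; rewrite lee_fin powR_ge0.
have W0 j := weak_norm_ge0 (t j) (x j).
(* A zero weak norm is treated before an infinite one, because 0 times +oo is 0: the right side then
   vanishes, and so must [T], which Hahn-Banach ensures by making the whole k-th sequence zero. *)
have [/existsP[k /eqP Wk]|/existsPn Wn0] :=
    boolP [exists k, weak_norm re (t k) (x k) == 0%E].
  rewrite esum1 => [|i _]; last first.
    by rewrite (multilinear_eq0 hT (k := k)) ?(rnorm0 e) ?powR0 ?gt_eqF//; exact: weak_norm_eq0 Wk _.
  by rewrite poweR0r ?invr_eq0 ?gt_eqF// mule_ge0 ?lee_fin ?(ltW D0)// prode_ge0.
have Wp j : (0 < weak_norm re (t j) (x j))%E by rewrite lt0e Wn0 W0.
have [/existsP[k /eqP Wk]|/existsPn Wny] :=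
    boolP [exists k, weak_norm re (t k) (x k) == +oo%E].
  by rewrite (prode_pinfty Wp Wk) gt0_muley ?lte_fin// leey.
pose w j := fine (weak_norm re (t j) (x j)).
have wE j : weak_norm re (t j) (x j) = (w j)%:E.
  by rewrite fineK// ge0_fin_numE// ltey.
have wp j : 0 < w j by rewrite -lte_fin -wE.
under eq_bigr => j _ do rewrite wE.
have Pw : 0 < \prod_j w j by apply: prodr_gt0.
rewrite prodEFin -EFinM poweR_le_fin// ?mulr_ge0 ?(ltW D0) ?(ltW Pw)//.
apply: (esum_box_le _ (fun i => powR_ge0 (rnorm (T (fun j => x j (i j)))) s)).2 => n.
have h : \sum_(i : {ffun 'I_m -> 'I_n})
    rnorm (T (fun j => e (w j)^-1 *: x j (i j))) `^ s <= C.
  apply: (H n (fun j a => e (w j)^-1 *: x j a)) => j.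
  by apply: weak_bounded_scale => //; rewrite wE.
have wV : 0 <= (\prod_j w j)^-1 by rewrite invr_ge0 ltW.
have hs (i : {ffun 'I_m -> 'I_n}) : rnorm (T (fun j => e (w j)^-1 *: x j (i j))) `^ s =
    ((\prod_j w j) `^ s)^-1 * rnorm (T (fun j => x j (i j))) `^ s.
  rewrite (multilinear_scale hT (fun j => e (w j)^-1)) -rmorph_prod prodfV (rnormZr e).
  by rewrite (ger0_norm wV) powRM ?(rnorm_ge0 e)// powRV ?(ltW Pw).
move: h; rewrite (eq_bigr _ (fun i _ => hs i)).
rewrite -mulr_sumr ler_pdivrMl ?powR_gt0// => h.
apply: (@le_trans _ _ ((\prod_j w j) `^ s * C)); last first.
  rewrite powRM ?(ltW D0) ?(ltW Pw)// mulrC ler_wpM2r ?powR_ge0//.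
  rewrite -[X in X <= _](powRVK C0 (lt0r_neq0 s0)).
  by apply: powR_le; rewrite ?powR_ge0 ?(ltW s0)// lerDl.
apply: le_trans h; rewrite le_eqVlt; apply/orP; left; apply/eqP.
apply: eq_bigr => i _; congr (rnorm (T _) `^ s).
by apply: functional_extensionality_dep => j; rewrite ffunE.
Qed.

End WeakNorm.

Arguments weak_bounded {R K} re {X} p {n} z.

Section FamilySeminorm.
Context {R : realType} {K : numFieldType} {re : K -> R} (e : scalar_embedding re).
Local Notation rnorm := (rnorm re).

Lemma family_bounded_seminorm (X Y : normedModType K) n (L : 'I_n -> {linear X -> Y})
    (r : R) : 1 <= r ->
  (forall a, exists B, forall u, rnorm (L a u) <= B * rnorm u) ->
  bounded_seminorm e (fun u => (\sum_a rnorm (L a u) `^ r) `^ r^-1).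
Proof.
move=> r1 bd; have r0 := lt_le_trans ltr01 r1.
have rV : 0 <= r^-1 by rewrite invr_ge0 ltW.
have S0 u : 0 <= \sum_a rnorm (L a u) `^ r.
  by apply: sumr_ge0 => a _; exact: powR_ge0.
split=> [x y|b x|].
- apply: le_trans (sum_minkowski xpredT r1 (fun a => rnorm_ge0 e (L a x))
    (fun a => rnorm_ge0 e (L a y))).
  apply: powR_le => //; apply: ler_sum => a _.
  apply: powR_le; rewrite ?(ltW r0) ?(rnorm_ge0 e)// linearD.
  exact: (rnormD e).
- have E a : rnorm (L a (e b *: x)) `^ r = `|b| `^ r * rnorm (L a x) `^ r.
    by rewrite linearZ (rnormZr e) powRM ?(rnorm_ge0 e).
  rewrite (eq_bigr _ (fun a _ => E a)) -mulr_sumr powRM ?powR_ge0//.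
  by rewrite powRK ?gt_eqF.
have [B HB] := choice bd; exists (\sum_a B a) => u.
apply: le_trans (sum_powR_norm_le xpredT ltr01 r1 (fun a => rnorm_ge0 e (L a u))) _.
rewrite invr1 powRr1 ?sumr_ge0// => [|a _]; last exact: powR_ge0.
rewrite mulr_suml ler_sum// => a _.
by rewrite powRr1 ?(rnorm_ge0 e).
Qed.

End FamilySeminorm.

(** * Uniform summing constants of the one-variable restrictions *)

Section SeparatelySumming.
Context {R : realType} {K : numFieldType} {re : K -> R} (hK : scalar_field re)
  (e : scalar_embedding re).
Context {m : nat} {X : 'I_m -> completeNormedModType K} {Y : completeNormedModType K}.
Context {T : (forall j, X j) -> Y} (hT : multilinear T).
Context {r p : R} (r1 : 1 <= r) (p0 : 0 < p) (sep : separately_summing re r p T).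
Local Notation rnorm := (rnorm re).

Let r0 : 0 < r := lt_le_trans ltr01 r1.

Lemma partial_map_finite (k : 'I_m) (x : forall j, X j) :
  exists2 C : R, 0 < C & forall n (z : 'I_n -> X k), weak_bounded re p z ->
    \sum_a rnorm (T (dfwith x k (z a))) `^ r <= C.
Proof.
apply: (summing_finite hK e (u := fun u => T (dfwith x k u)) r0 p0); last exact: sep.
exact: (linear0 (partial_map hT k x)).
Qed.

(** Continuity in each variable comes from summability: a single normalized vector is a weakly
    bounded family. *)
Lemma partial_map_bounded (k : 'I_m) (x : forall j, X j) :
  exists B, forall u, rnorm (partial_map hT k x u) <= B * rnorm u.
Proof.
have [C C0 H] := partial_map_finite k x.
exists (C `^ r^-1) => u; have [->|u0] := eqVneq u 0.
  by rewrite linear0 !(rnorm0 e) mulr0.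
have nu : 0 < rnorm u by rewrite lt0r (rnorm_eq0 e) u0 (rnorm_ge0 e).
have nV : 0 <= (rnorm u)^-1 by rewrite invr_ge0 ltW.
have := H 1%N (fun=> e (rnorm u)^-1 *: u) _.
rewrite big_ord1 -(partial_mapE hT) linearZ (rnormZr e) (ger0_norm nV) => h.
rewrite -ler_pdivrMr// mulrC; apply: (powR_leK r0).
- by rewrite mulr_ge0 ?(rnorm_ge0 e).
- exact: powR_ge0.
rewrite powRVK ?gt_eqF ?(ltW C0)//; apply: h => phi hphi.
rewrite big_ord1 linearZ (rnormZr e) (ger0_norm nV) powR_le1 ?(ltW p0)//.
  by rewrite mulr_ge0 ?(rnorm_ge0 e).
by rewrite ler_pdivrMl// mulr1; exact: (dual_ball_le e).
Qed.

Lemma dfwithC (k l : 'I_m) (x : forall j, X j) u v : k != l ->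
  dfwith (dfwith x k u) l v = dfwith (dfwith x l v) k u.
Proof.
move=> kl; apply: functional_extensionality_dep => j.
have [->|jk] := eqVneq j k; first by rewrite dfwithin dfwithout ?dfwithin// eq_sym.
rewrite [RHS]dfwithout 1?eq_sym//.
have [->|jl] := eqVneq j l; first by rewrite !dfwithin.
by rewrite !dfwithout// eq_sym.
Qed.

(** Induction over the variables: the bound is uniform over the unit balls of those before d, the
    others being fixed at x. To pass to the next variable l, uniform boundedness on X l is applied
    to the seminorms [N x' n z], whose pointwise boundedness is the induction hypothesis. *)
Theorem separately_summing_uniform (k : 'I_m) :
  exists M, forall x : forall j, X j, (forall j, j != k -> rnorm (x j) <= 1) ->
  forall n (z : 'I_n -> X k), weak_bounded re p z ->
    \sum_a rnorm (T (dfwith x k (z a))) `^ r <= M.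
Proof.
suff H d : (d <= m)%N -> forall x : forall j, X j, exists M, forall x' : forall j, X j,
    (forall j, j != k -> (j < d)%N -> rnorm (x' j) <= 1) ->
    (forall j, j != k -> (d <= j)%N -> x' j = x j) ->
    forall n (z : 'I_n -> X k), weak_bounded re p z ->
    \sum_a rnorm (T (dfwith x' k (z a))) `^ r <= M.
  have [M HM] := H m (leqnn m) (fun=> 0); exists M => x x1.
  apply: HM => [j jk _|j _]; first exact: x1.
  by rewrite leqNgt ltn_ord.
elim: d => [_ x|d IH dm x].
  have [C C0 HC] := partial_map_finite k x; exists C => x' _ xx' n z hz.
  have E u : dfwith x' k u = dfwith x k u.
    apply: functional_extensionality_dep => j.
    by case: dfwithP => [|j' kj']; rewrite ?dfwithin// dfwithout// xx'// eq_sym.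
  by rewrite (eq_bigr _ (fun a _ => congr1 (fun y => rnorm (T y) `^ r) (E (z a)))) HC.
(* For l = k nothing has to be gained, as that coordinate is overwritten by z. *)
pose l := Ordinal dm; have [lk|lk] := eqVneq l k.
  have [M HM] := IH (ltnW dm) x; exists M => x' h1 h2 n z hz.
  have nl j : j != k -> (j != d :> nat) by rewrite -lk.
  apply: HM => // j jk jd; first by apply: h1 => //; exact: ltnW.
  by apply: h2 => //; rewrite ltn_neqAle jd andbT eq_sym nl.
pose N x' n (z : 'I_n -> X k) (u : X l) :=
  (\sum_a rnorm (partial_map hT l (dfwith x' k (z a)) u) `^ r) `^ r^-1.
have NE x' n (z : 'I_n -> X k) (u : X l) : N x' n z u `^ r =
    \sum_a rnorm (T (dfwith (dfwith x' l u) k (z a))) `^ r.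
  rewrite /N powRVK ?gt_eqF//; last by apply: sumr_ge0 => a _; exact: powR_ge0.
  by apply: eq_bigr => a _; rewrite partial_mapE dfwithC// eq_sym.
pose F (f : X l -> R) := exists x' n z, [/\ forall j, j != k -> (j < d)%N -> rnorm (x' j) <= 1,
  forall j, j != k -> j != l -> (d <= j)%N -> x' j = x j, weak_bounded re p z & f = N x' n z].
have [|u|M HM] := @seminorm_uniform_bounded _ _ _ e (X l) F.
- move=> _ [x' [n [z [_ _ _ ->]]]]; apply: (family_bounded_seminorm e r1) => a.
  exact: partial_map_bounded.
- have [M HM] := IH (ltnW dm) (dfwith x l u); exists (M `^ r^-1).
  move=> _ [x' [n [z [h1 h2 hz ->]]]].
  have N0 : 0 <= N x' n z u by exact: powR_ge0.
  rewrite -[X in X <= _](powRK N0 (lt0r_neq0 r0)).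
  apply: powR_le; rewrite ?invr_ge0 ?(ltW r0) ?powR_ge0// NE.
  apply: HM => // j jk jd.
    rewrite dfwithout; first exact: h1.
    by apply: contraTneq jd => <-; rewrite ltnn.
  have [->|jl] := eqVneq j l; first by rewrite !dfwithin.
  by rewrite !dfwithout 1?eq_sym//; exact: h2.
exists (M `^ r) => x' h1 h2 n z hz.
have -> : x' = dfwith x' l (x' l).
  by apply: functional_extensionality_dep => j; case: dfwithP.
rewrite -NE; apply: powR_le; [exact: ltW|exact: powR_ge0|].
apply: HM; last by apply: h1.
exists x', n, z; split=> // j jk; first by move=> jd; apply: h1 => //; exact: ltnW.
move=> jl dj; apply: h2 => //; rewrite ltn_neqAle dj andbT.
by apply: contra jl => /eqP dj'; apply/eqP/val_inj.
Qed.

End SeparatelySumming.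

(** * Inclusion theorems *)

Lemma average_powR_le (R : realType) (I : finType) (f : I -> R) r : 1 <= r ->
  (0 < #|I|)%N -> (forall i, 0 <= f i) ->
  (#|I|%:R^-1 * \sum_i f i) `^ r <= #|I|%:R^-1 * \sum_i f i `^ r.
Proof.
move=> r1 I0 f0; have r0 := lt_le_trans ltr01 r1.
set N := #|I|%:R; have N0 : 0 < N :> R by rewrite ltr0n.
have rV : 0 <= r^-1 <= 1 by rewrite invr_ge0 ltW//= invf_le1.
have S0 : 0 <= \sum_i f i by apply: sumr_ge0.
have Sr0 : 0 <= \sum_i f i `^ r by apply: sumr_ge0 => i _; exact: powR_ge0.
have h : \sum_i f i <= (\sum_i f i `^ r) `^ r^-1 * N `^ (1 - r^-1).
  have -> : N = \sum_(i : I) 1 by rewrite sumr_const.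
  apply: le_trans (sum_hoelder xpredT (fun i => powR_ge0 (f i) r) (fun=> ler01) rV).
  by apply: ler_sum => i _; rewrite powRK ?gt_eqF// powR1 mulr1.
have := powR_le (ltW r0) S0 h; rewrite powRM ?powR_ge0// powRVK ?gt_eqF//.
rewrite -powRrM mulrBl mul1r mulVf ?gt_eqF// => h'.
rewrite powRM ?invr_ge0 ?(ltW N0)// powRV ?(ltW N0)// ler_pdivrMl ?powR_gt0//.
have -> : N `^ r = N `^ (r - 1) * N.
  by rewrite -[X in _ * X](powRr1 (ltW N0)) -powRD ?subrK// (gt_eqF N0) implybT.
by apply: le_trans h' _; rewrite -mulrA mulVKf ?gt_eqF// mulrC.
Qed.

Section FiberBound.
Context {R : realType} {K : numFieldType} {re : K -> R} (hK : scalar_field re)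
  (e : scalar_embedding re).
Local Notation rnorm := (rnorm re).

Lemma rademacher_bound (X : normedModType K) n (z : 'I_n -> X) (t : R) alpha w :
  1 <= t -> weak_bounded re t z -> sub_prob alpha ->
  rnorm (rademacher (fun a => e (alpha a `^ (1 - t^-1)) *: z a) w) <= 1.
Proof.
move=> t1 hz [a0 a1]; have t0 := lt_le_trans ltr01 t1.
have [phi hphi <-] := hahn_banach hK (rademacher (fun a => e (alpha a `^ (1 - t^-1)) *: z a) w).
have tV : 0 <= t^-1 by rewrite invr_ge0 ltW.
have x01 : 0 <= 1 - t^-1 <= 1 by rewrite subr_ge0 invf_le1// t1 gerBl.
rewrite /rademacher linear_sum; apply: le_trans (rnorm_sum e _ _ _) _.
have E a : rnorm (phi ((-1) ^+ w a *: (e (alpha a `^ (1 - t^-1)) *: z a))) =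
    alpha a `^ (1 - t^-1) * (rnorm (phi (z a)) `^ t) `^ (1 - (1 - t^-1)).
  rewrite linearZ [LHS]rnorm_sign linearZ (rnormZr e) ger0_norm ?powR_ge0//.
  by rewrite subKr powRK ?(rnorm_ge0 e)// gt_eqF.
rewrite (eq_bigr _ (fun a _ => E a)).
apply: le_trans (sum_hoelder xpredT a0 (fun a => powR_ge0 _ t) x01) _.
have S0 : 0 <= \sum_a alpha a by exact: sumr_ge0.
have S1 : 0 <= \sum_a rnorm (phi (z a)) `^ t by apply: sumr_ge0 => a _; exact: powR_ge0.
apply: mulr_ile1; rewrite ?powR_ge0// powR_le1//.
- by case/andP: x01.
- by rewrite subr_ge0; case/andP: x01.
- exact: hz.
Qed.

Lemma weak_bounded_multiplier (X : normedModType K) n (z : 'I_n -> X) (p t : R) alpha :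
  1 <= p -> p <= t -> weak_bounded re t z -> sub_prob alpha ->
  weak_bounded re p (fun a => e (alpha a `^ (p^-1 - t^-1)) *: z a).
Proof.
move=> p1 pt hz [a0 a1] phi hphi.
have p0 := lt_le_trans ltr01 p1; have t0 := lt_le_trans p0 pt.
have x01 : 0 <= 1 - p / t <= 1.
  by rewrite subr_ge0 ler_pdivrMr// mul1r pt gerBl divr_ge0 ?(ltW p0) ?(ltW t0).
have E a : rnorm (phi (e (alpha a `^ (p^-1 - t^-1)) *: z a)) `^ p =
    alpha a `^ (1 - p / t) * (rnorm (phi (z a)) `^ t) `^ (1 - (1 - p / t)).
  rewrite linearZ (rnormZr e) ger0_norm ?powR_ge0// powRM ?powR_ge0 ?(rnorm_ge0 e)//.
  rewrite -!powRrM mulrBl mulVf ?gt_eqF// [t^-1 * p]mulrC subKr.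
  by rewrite [t * _]mulrC divfK// gt_eqF.
rewrite (eq_bigr _ (fun a _ => E a)).
apply: le_trans (sum_hoelder xpredT a0 (fun a => powR_ge0 _ t) x01) _.
have S0 : 0 <= \sum_a alpha a by exact: sumr_ge0.
have S1 : 0 <= \sum_a rnorm (phi (z a)) `^ t by apply: sumr_ge0 => a _; exact: powR_ge0.
apply: mulr_ile1; rewrite ?powR_ge0// powR_le1//.
- by case/andP: x01.
- by rewrite subr_ge0; case/andP: x01.
- exact: hz.
Qed.

Context {m : nat} {X : 'I_m -> completeNormedModType K} {Y : completeNormedModType K}.
Context {T : (forall j, X j) -> Y} (hT : multilinear T).

(** The exponent 1/t^* splits as (1/p - 1/t) + 1/p^*. In the direction k the first part makes z k
    weakly p-summable, and the second, kept outside, lowers the exponent from r to r2 by Hölder. In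
    the other directions all of 1/t^* is spent on bounding the signed sums. *)
Lemma fiber_estimate (q r p t r2 : R) : 1 <= q -> cotype re q Y ->
  1 <= r -> 1 <= p -> p <= t -> separately_summing re r p T ->
  0 < r2 -> r2^-1 = r^-1 + (1 - p^-1) ->
  exists2 G : R, 0 < G & forall n (z : forall j, 'I_n -> X j),
    (forall j, weak_bounded re t (z j)) ->
    fiber_bound (fun i : {ffun 'I_m -> 'I_n} => rnorm (T (fun j => z j (i j))) `^ q / G)
      (fun=> q * (1 - t^-1)) (r2 / q).
Proof.
move=> q1 ct r1 p1 pt sep r20 r2E.
have q0 := lt_le_trans ltr01 q1; have r0 := lt_le_trans ltr01 r1.
have p0 := lt_le_trans ltr01 p1; have t0 := lt_le_trans p0 pt.
have t1 := le_trans p1 pt.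
have [C1 C10 HC1] := cotype_multilinear e hT q1 ct.
have [M HM] := choice (separately_summing_uniform hK e hT r1 p0 sep).
(* Summing over k gives one constant for all directions. *)
pose B := C1 `^ r * \sum_k `|M k|.
have B0 : 0 <= B by rewrite mulr_ge0 ?powR_ge0 ?sumr_ge0.
pose D := B `^ (r2 / r) + 1.
have D0 : 0 < D by rewrite ltr_wpDl ?powR_ge0.
have k0 : 0 < r2 / q by rewrite divr_gt0.
pose G := D `^ (r2 / q)^-1; have G0 : 0 < G by exact: powR_gt0.
exists G => // n z hz k alpha Ha.
suff key : \sum_a (\sum_(i : {ffun 'I_m -> 'I_n} | i k == a)
    weight (fun=> q * (1 - t^-1)) alpha i * rnorm (T (fun j => z j (i j))) `^ q) `^ (r2 / q)
    <= B `^ (r2 / r).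
  have E a : (\sum_(i : {ffun 'I_m -> 'I_n} | i k == a) weight (fun=> q * (1 - t^-1)) alpha i *
      (rnorm (T (fun j => z j (i j))) `^ q / G)) `^ (r2 / q) =
      D^-1 * (\sum_(i : {ffun 'I_m -> 'I_n} | i k == a) weight (fun=> q * (1 - t^-1)) alpha i *
      rnorm (T (fun j => z j (i j))) `^ q) `^ (r2 / q).
    rewrite -[in RHS](powRVK (ltW D0) (lt0r_neq0 k0)) -/G -powRV ?(ltW G0)// -powRM ?invr_ge0 ?(ltW G0)//.
      by rewrite mulr_sumr; congr (_ `^ _); apply: eq_bigr => i _; rewrite mulrA mulrC.
    by apply: sumr_ge0 => i _; rewrite mulr_ge0 ?powR_ge0 ?weight_ge0.
  rewrite (eq_bigr _ (fun a _ => E a)) -mulr_sumr ler_pdivrMl// mulr1.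
  by apply: le_trans key _; rewrite lerDl.
pose dl := p^-1 - t^-1; pose mu := 1 - t^-1; pose pp := 1 - p^-1.
have dl0 : 0 <= dl by rewrite subr_ge0 lef_pV2.
have pp0 : 0 <= pp by rewrite subr_ge0 invf_le1.
have muE : mu = dl + pp by rewrite /mu /dl /pp; ring.
have mu0 : 0 <= mu by rewrite muE addr_ge0.
have a0 j b : 0 <= alpha j b := (Ha j).1 b.
(* To isolate the fiber i k = a, the k-th family is concentrated at the index a; its signed sum is
   then plus or minus the single vector [zk a]. *)
pose cf a j b := if j == k then if b == a then alpha k b `^ dl else 0 else alpha j b `^ mu.
have cf0 a j b : 0 <= cf a j b by rewrite /cf; do 2?case: ifP => // _; exact: powR_ge0.
pose zk a := e (alpha k a `^ dl) *: z k a.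
pose u (w : {ffun 'I_m -> {ffun 'I_n -> bool}}) j :=
  rademacher (fun b => e (alpha j b `^ mu) *: z j b) (w j).
pose g w a := rnorm (T (dfwith (u w) k (zk a))).
have g0 w a : 0 <= g w a by exact: rnorm_ge0.
pose N : R := #|{: {ffun 'I_m -> {ffun 'I_n -> bool}}}|%:R.
have cardN : #|{: {ffun 'I_m -> {ffun 'I_n -> bool}}}| = ((2 ^ n) ^ m)%N.
  by rewrite !card_ffun card_bool !card_ord.
have N0 : 0 < N by rewrite /N cardN ltr0n !expn_gt0.
have NE : N = (2 ^+ n) ^+ m by rewrite /N cardN !natrX.
pose A a := C1 * (N^-1 * \sum_w g w a).
have A0 a : 0 <= A a.
  by rewrite mulr_ge0 ?(ltW C10)// mulr_ge0 ?invr_ge0 ?(ltW N0)// sumr_ge0.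
have TY a (i : {ffun 'I_m -> 'I_n}) :
    rnorm (T (fun j => e (cf a j (i j)) *: z j (i j))) =
    (\prod_j cf a j (i j)) * rnorm (T (fun j => z j (i j))).
  rewrite (multilinear_scale hT (fun j => e (cf a j (i j)))) -rmorph_prod (rnormZr e).
  by rewrite ger0_norm// prodr_ge0.
have Tw a (w : {ffun 'I_m -> {ffun 'I_n -> bool}}) : rnorm (T (fun j => rademacher (fun b => e (cf a j b) *: z j b) (w j))) = g w a.
  have -> : (fun j => rademacher (fun b => e (cf a j b) *: z j b) (w j)) =
      dfwith (u w) k ((-1) ^+ w k a *: zk a).
    apply: functional_extensionality_dep => j; case: dfwithP => [|j' kj'].
      rewrite /rademacher (bigD1 a)//= /cf !eqxx big1 ?addr0// => b /negbTE ->.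
      by rewrite rmorph0 scale0r scaler0.
    apply: eq_bigr => b _; rewrite /cf eq_sym (negbTE kj') //.
  rewrite -(partial_mapE hT) linearZ [LHS]rnorm_sign.
  by rewrite partial_mapE.
have fib a : \sum_(i : {ffun 'I_m -> 'I_n} | i k == a)
    weight (fun=> q * mu) alpha i * rnorm (T (fun j => z j (i j))) `^ q <=
    alpha k a `^ (pp * q) * A a `^ q.
  have n0 : (0 < n)%N by apply: leq_ltn_trans (ltn_ord a).
  have h := HC1 n (fun j b => e (cf a j b) *: z j b) n0.
  rewrite (eq_bigr _ (fun w _ => Tw a w)) -NE -/(A a) in h.
  have {}h := powR_le (ltW q0) (powR_ge0 _ _) h.
  rewrite powRVK ?gt_eqF// in h; last by apply: sumr_ge0 => i _; exact: powR_ge0.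
  apply: le_trans (ler_wpM2l (powR_ge0 _ _) h).
  rewrite mulr_sumr [leRHS](bigID (fun i : {ffun 'I_m -> 'I_n} => i k == a))/=.
  apply: ler_wpDr; first by apply: sumr_ge0 => i _; rewrite mulr_ge0 ?powR_ge0.
  apply: ler_sum => i /eqP ika; rewrite TY powRM ?prodr_ge0 ?(rnorm_ge0 e)// mulrA.
  rewrite ler_wpM2r ?powR_ge0// /weight (bigD1 k)//= (bigD1 k (P := xpredT))//=.
  have -> : cf a k (i k) = alpha k a `^ dl by rewrite ika /cf !eqxx.
  rewrite ika powRM ?powR_ge0 ?prodr_ge0//.
  rewrite mulrA -powRrM -powRD_ge0 ?mulr_ge0 ?(ltW q0)// -mulrDl [pp + dl]addrC -muE.
  rewrite [mu * q]mulrC ler_wpM2l ?powR_ge0//.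
  have prodP (I : finType) (P : pred I) (f : I -> R) : (forall i, 0 <= f i) ->
      (\prod_(i | P i) f i) `^ q = \prod_(i | P i) f i `^ q.
    move=> f0; suff [] : 0 <= \prod_(i | P i) f i /\
      (\prod_(i | P i) f i) `^ q = \prod_(i | P i) f i `^ q by [].
    elim/big_rec2: _ => [|l b c _ [b0 E]]; first by rewrite powR1.
    by rewrite mulr_ge0// powRM// E.
  rewrite prodP// le_eqVlt; apply/orP; left; apply/eqP; apply: eq_bigr => j /negbTE jk.
  by rewrite /cf jk -powRrM mulrC.
(* Jensen moves the power r inside the average over signs; for fixed signs the sum over a is bounded
   by the uniform summing constant. *)
have sumA : \sum_a A a `^ r <= B.
  apply: (@le_trans _ _ (C1 `^ r * (N^-1 * \sum_w \sum_a g w a `^ r))).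
    have -> : C1 `^ r * (N^-1 * \sum_w \sum_a g w a `^ r) =
        \sum_a C1 `^ r * (N^-1 * \sum_w g w a `^ r).
      by rewrite exchange_big/= -mulr_sumr -mulr_sumr.
    apply: ler_sum => a _.
    rewrite /A powRM ?(ltW C10)//; last first.
      by rewrite mulr_ge0 ?invr_ge0 ?(ltW N0)// sumr_ge0.
    rewrite ler_wpM2l ?powR_ge0//.
    by apply: average_powR_le => //; rewrite cardN !expn_gt0.
  rewrite ler_wpM2l ?powR_ge0// ler_pdivrMl//.
  apply: (@le_trans _ _ (\sum_(w : {ffun 'I_m -> {ffun 'I_n -> bool}}) `|M k|)).
    apply: ler_sum => w _; apply: le_trans (ler_norm _); apply: HM.
      by move=> j _; exact: rademacher_bound.
    exact: weak_bounded_multiplier.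
  rewrite sumr_const -[leLHS]mulr_natl ler_wpM2l ?(ltW N0)//.
  by rewrite (bigD1 k)//= lerDl sumr_ge0.
(* x is r2 divided by p^*, and 1 - x = r2 / r by the relation defining r2. *)
pose x := pp * r2.
have xE : 1 - x = r2 / r.
  have ppE : pp = r2^-1 - r^-1 by rewrite r2E /pp; ring.
  by rewrite /x ppE; field; rewrite !gt_eqF.
have x01 : 0 <= x <= 1.
  rewrite mulr_ge0 ?(ltW r20)//= -subr_ge0 xE divr_ge0 ?(ltW r20) ?(ltW r0)//.
apply: (@le_trans _ _ (\sum_a alpha k a `^ x * (A a `^ r) `^ (1 - x))).
  apply: ler_sum => a _; have := powR_le (ltW k0) _ (fib a).
  have -> : (alpha k a `^ (pp * q) * A a `^ q) `^ (r2 / q) =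
      alpha k a `^ x * (A a `^ r) `^ (1 - x).
    rewrite powRM ?powR_ge0// -!powRrM xE; congr (_ `^ _ * _ `^ _).
      by rewrite /x; field; rewrite gt_eqF.
    by field; rewrite !gt_eqF.
  by apply; apply: sumr_ge0 => i _; rewrite mulr_ge0 ?powR_ge0 ?weight_ge0.
apply: le_trans (sum_hoelder xpredT (a0 k) (fun a => powR_ge0 (A a) r) x01) _.
have x0 : 0 <= x by case/andP: x01.
have SA0 : 0 <= \sum_a A a `^ r by apply: sumr_ge0 => a _; exact: powR_ge0.
rewrite -[leRHS]mul1r; apply: ler_pM; rewrite ?powR_ge0//.
  by apply: powR_le1 => //; [exact: sumr_ge0|exact: (Ha k).2].
rewrite xE; apply: powR_le => //.
by rewrite divr_ge0 ?(ltW r20) ?(ltW r0).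
Qed.

End FiberBound.

Section Inclusion.
Context {R : realType} {K : numFieldType} {re : K -> R} (hK : scalar_field re).
Context {m : nat} {X : 'I_m -> completeNormedModType K} {Y : completeNormedModType K}.
Context {T : (forall j, X j) -> Y} (hT : multilinear T).
Context {q r p t : R} (m0 : (0 < m)%N) (q2 : 2 <= q) (ct : cotype re q Y).
Context (r1 : 1 <= r) (p1 : 1 <= p) (sep : separately_summing re r p T) (pt : p <= t).
Local Notation rnorm := (rnorm re).

Let q0 : 0 < q. Proof. by apply: lt_le_trans q2. Qed.
Let t1 : 1 <= t. Proof. exact: le_trans pt. Qed.
Let V : R := r^-1 + inv_conj p.

Let V0 : 0 < V.
Proof.
rewrite /V inv_conjE// ltr_wpDr ?invr_gt0 ?(lt_le_trans ltr01)//.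
by rewrite subr_ge0 invf_le1// (lt_le_trans ltr01).
Qed.

Let mR : 0 < m%:R :> R. Proof. by rewrite ltr0n. Qed.

(** [c] stands for |T|^q divided by a constant, so the sum of c^(s/q) is that of |T|^s up to a
    factor. The exponents in [fiber_bound] are those that [fiber_estimate] supplies for r2 = 1/V. *)
Let summing_of_fibers (s : R) : 0 < s ->
  (forall (n : nat) (c : {ffun 'I_m -> 'I_n} -> R), (forall i, 0 <= c i) ->
    fiber_bound c (fun=> q * inv_conj t) (V^-1 / q) ->
    \sum_i c i `^ (s / q) <= 1) ->
  multiple_summing re s (fun=> t) T.
Proof.
move=> s0 H; have [e] := scalar_field_embedding hK.
have q1 : 1 <= q by apply: le_trans q2; rewrite ler1n.
have r20 : 0 < V^-1 by rewrite invr_gt0.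
have r2E : (V^-1)^-1 = r^-1 + (1 - p^-1) by rewrite invrK /V inv_conjE.
have [G G0 HG] := fiber_estimate hK e hT q1 ct r1 p1 pt sep r20 r2E.
apply: (finite_multiple_summing hK e (C := G `^ (s / q)) hT s0).
  by move=> _; rewrite (lt_le_trans ltr01).
move=> n z hz; have := HG n z hz; rewrite -(inv_conjE t1) => /(H n).
have c0 i : 0 <= rnorm (T (fun j => z j (i j))) `^ q / G.
  by rewrite divr_ge0 ?powR_ge0 ?(ltW G0).
move=> /(_ (fun i : {ffun 'I_m -> 'I_n} => c0 i)).
have E (i : {ffun 'I_m -> 'I_n}) :
    (rnorm (T (fun j => z j (i j))) `^ q / G) `^ (s / q) =
    (G `^ (s / q))^-1 * rnorm (T (fun j => z j (i j))) `^ s.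
  rewrite powRM ?powR_ge0 ?invr_ge0 ?(ltW G0)// -powRrM powRV ?(ltW G0)// mulrC.
  by rewrite [q * _]mulrC divfK// gt_eqF.
by rewrite (eq_bigr _ (fun i _ => E i)) -mulr_sumr ler_pdivrMl ?powR_gt0// mulr1.
Qed.

Lemma inclusion_above s : q^-1 < V - m%:R * inv_conj t ->
  s^-1 = (m%:R - 1) / (m%:R * q) + (m%:R * r)^-1 + inv_conj p / m%:R - inv_conj t ->
  multiple_summing re s (fun=> t) T.
Proof.
move=> h sE; have qn : q != 0 by rewrite gt_eqF.
have rn : r != 0 by rewrite gt_eqF// (lt_le_trans ltr01).
have mn : m%:R != 0 :> R by rewrite gt_eqF.
have tc : 0 <= inv_conj t by rewrite inv_conjE// subr_ge0 invf_le1// (lt_le_trans ltr01).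
(* The inverse fiber exponent left once all multipliers are removed. The prescribed s satisfies q/s
   = 1 + (E - 1)/m, which is the exponent of Blei's inequality. *)
pose E := q * (V - m%:R * inv_conj t).
have E1 : 1 < E by rewrite /E -ltr_pdivrMl// mulr1.
have sE' : q * s^-1 = 1 + (E - 1) / m%:R.
  by rewrite sE /E /V; field; rewrite ?qn ?rn ?mn.
have s0 : 0 < s.
  rewrite -invr_gt0 -(pmulr_rgt0 _ q0) sE'.
  by rewrite ltr_wpDr// divr_ge0 ?(ltW mR)// subr_ge0 ltW.
apply: (summing_of_fibers s0) => n c c0 hc.
apply: (fiber_bound_sum_lt c0 (E := E) m0 _ _ hc).
- by rewrite mulr_ge0 ?(ltW q0).
- by rewrite divr_gt0 ?invr_gt0.
- by rewrite invf_div invrK /E; ring.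
- exact: ltW.
- by rewrite divr_gt0.
- by rewrite invf_div sE'.
Qed.

Lemma inclusion_below s : 0 < V - m%:R * inv_conj t <= q^-1 ->
  s^-1 = V - m%:R * inv_conj t -> multiple_summing re s (fun=> t) T.
Proof.
move=> /andP[h0 h1] sE; have qn : q != 0 by rewrite gt_eqF.
have tc : 0 <= inv_conj t by rewrite inv_conjE// subr_ge0 invf_le1// (lt_le_trans ltr01).
have s0 : 0 < s by rewrite -invr_gt0 sE.
apply: (summing_of_fibers s0) => n c c0 hc.
have -> : s / q = (q * s^-1)^-1 by rewrite invfM invrK mulrC.
apply: (fiber_bound_sum_ge c0 m0 _ _ hc).
- by rewrite mulr_ge0 ?(ltW q0).
- by rewrite divr_gt0 ?invr_gt0.
- by rewrite invf_div invrK sE; ring.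
- by rewrite mulr_gt0// invr_gt0.
- by rewrite -ler_pdivlMl// mulr1 sE.
Qed.

End Inclusion.

(** * Spaces of p-summable families *)

Lemma sum_minkowski_seq (R : realType) (I : Type) (s : seq I) (f g : I -> R) r :
  1 <= r -> (forall i, 0 <= f i) -> (forall i, 0 <= g i) ->
  (\sum_(i <- s) (f i + g i) `^ r) `^ r^-1 <=
  (\sum_(i <- s) f i `^ r) `^ r^-1 + (\sum_(i <- s) g i `^ r) `^ r^-1.
Proof.
have E (h : I -> R) : \sum_(i <- s) h i = \sum_(j < size s) h (tnth (in_tuple s) j).
  exact: big_tnth.
move=> r1 f0 g0; rewrite !E.
by apply: (sum_minkowski xpredT r1) => i; [exact: f0|exact: g0].
Qed.

Lemma scalar_cauchy_cvg (R : realType) (K : numFieldType) (re : K -> R) (v : nat -> K) :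
  scalar_field re ->
  (forall eps : R, 0 < eps -> exists N, forall i, (N <= i)%N ->
    rnorm re (v N - v i : K^o) <= eps) ->
  exists l, forall eps : R, 0 < eps -> exists N, forall i, (N <= i)%N ->
    rnorm re (l - v i : K^o) <= eps.
Proof.
move=> hK; case: hK v => v.
  have [e] := scalar_field_embedding (real_scalars R).
  exact: (cauchy_rnorm_cvg (X := R^o) e).
move=> H; have [e] := scalar_field_embedding (real_scalars R).
have part (f : R[i] -> R) : (forall x y, f (x - y) = f x - f y) ->
    (forall x, `|f x| <= complex.Re `|x|) ->
    exists l, forall eps : R, 0 < eps -> exists N, forall i, (N <= i)%N ->
    `|l - f (v i)| <= eps.
  move=> fB fle; apply: (cauchy_rnorm_cvg (X := R^o) e (u := fun i => f (v i))).
  move=> eps /H[N HN]; exists N => i /HN; apply: le_trans.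
  by rewrite /rnorm/= -fB.
have [||a Ha] := part (@complex.Re R).
- by move=> [x1 x2] [y1 y2].
- move=> x; rewrite -lecR; apply: le_trans (normc_ge_Re x) _.
  by rewrite (RRe_real (ger0_real (normr_ge0 x))).
have [||b Hb] := part (@complex.Im R).
- by move=> [x1 x2] [y1 y2].
- move=> x; have -> : complex.Im x = - complex.Re (x * 'i%C) by rewrite ReiNIm opprK.
  rewrite normrN -lecR; apply: le_trans (normc_ge_Re _) _.
  rewrite normrM [`|'i%C|](_ : _ = 1) ?mulr1; last first.
    by rewrite normc_def/= expr0n/= add0r expr1n sqrtr1.
  by rewrite (RRe_real (ger0_real (normr_ge0 x))).
exists (a +i* b)%C => eps eps0.
have e2 : 0 < eps / 2 by rewrite divr_gt0.
have [N1 h1] := Ha _ e2; have [N2 h2] := Hb _ e2.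
exists (maxn N1 N2) => i; rewrite geq_max => /andP[/h1 {}h1 /h2 {}h2].
move: (v i) h1 h2 => [c d] /= h1 h2; rewrite /rnorm.
have -> : ((a +i* b)%C - (c +i* d)%C : R[i]^o) = (a - c)%:C%C + (b - d)%:C%C * 'i%C.
  by apply/eqP; rewrite eq_complex/= !mul0r !mulr0 !mulr1 !subr0 ?addr0 !add0r !eqxx.
have nR (x : R) : `|x%:C%C| = `|x|%:C%C.
  by rewrite normc_def/= expr0n/= addr0 sqrtr_sqr.
have : `|(a - c)%:C%C + (b - d)%:C%C * 'i%C| <= (`|a - c| + `|b - d|)%:C%C.
  apply: le_trans (ler_normD _ _) _; rewrite normrM !nR rmorphD/= lerD2l.
  by rewrite [`|'i%C|](_ : _ = 1) ?mulr1// normc_def/= expr0n/= add0r expr1n sqrtr1.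
rewrite lecE => /andP[_ /= h]; apply: le_trans h _.
by rewrite [leRHS](splitr eps) lerD.
Qed.

Section Snorm.
Context {R : realType} {K : numFieldType} (re : K -> R) (e : scalar_embedding re).
Context (u : R) (u1 : 1 <= u) {I : eqType} (B : nat -> seq I).
Local Notation rnorm := (rnorm re).
Implicit Types (f g : I -> K).

(** The norm over the n-th member of an exhaustion by finite lists. One construction thus serves l_u
    over [nat], with initial segments, and l_2 over multi-indices, with boxes. *)
Definition snorm n f : R := (\sum_(a <- B n) rnorm (f a : K^o) `^ u) `^ u^-1.

Definition ell_bounded f := exists M, forall n, snorm n f <= M.

Let u0 : 0 < u := lt_le_trans ltr01 u1.

Lemma snorm_ge0 n f : 0 <= snorm n f. Proof. exact: powR_ge0. Qed.

Lemma sum_rnorm_ge0 (s : seq I) f : 0 <= \sum_(a <- s) rnorm (f a : K^o) `^ u.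
Proof. by apply: sumr_ge0 => a _; exact: powR_ge0. Qed.

Lemma snormD n f g : snorm n (fun a => f a + g a) <= snorm n f + snorm n g.
Proof.
apply: le_trans (sum_minkowski_seq (B n) u1 (fun a => rnorm_ge0 e (f a : K^o))
  (fun a => rnorm_ge0 e (g a : K^o))).
apply: powR_le; rewrite ?invr_ge0 ?(ltW u0) ?sum_rnorm_ge0//.
apply: ler_sum => a _; apply: powR_le; rewrite ?(ltW u0) ?(rnorm_ge0 e)//.
exact: (rnormD e).
Qed.

Lemma snormZ n c f : snorm n (fun a => c * f a) = rnorm (c : K^o) * snorm n f.
Proof.
rewrite /snorm.
under eq_bigr => a _ do rewrite (rnormM e) powRM ?(rnorm_ge0 e)//.
by rewrite -mulr_sumr powRM ?powR_ge0 ?sum_rnorm_ge0// powRK ?(rnorm_ge0 e) ?gt_eqF.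
Qed.

Lemma snorm_coord n f a : a \in B n -> rnorm (f a : K^o) <= snorm n f.
Proof.
move=> aB; apply: (powR_leK u0); rewrite ?(rnorm_ge0 e) ?powR_ge0//.
rewrite powRVK ?sum_rnorm_ge0 ?gt_eqF// (big_rem a)//= lerDl.
exact: sum_rnorm_ge0.
Qed.

Lemma snorm_le_sum n f : snorm n f <= \sum_(a <- B n) rnorm (f a : K^o).
Proof.
have E (h : I -> R) : \sum_(a <- B n) h a = \sum_(j < size (B n)) h (tnth (in_tuple (B n)) j).
  exact: big_tnth.
rewrite /snorm !E.
apply: le_trans (sum_powR_norm_le xpredT ltr01 u1
  (fun a => rnorm_ge0 e (f (tnth (in_tuple (B n)) a) : K^o))) _.
rewrite invr1 powRr1 ?sumr_ge0// => [|a _]; last exact: powR_ge0.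
by apply: ler_sum => a _; rewrite powRr1 ?(rnorm_ge0 e).
Qed.

Lemma snorm0 n : snorm n (fun=> 0) = 0.
Proof.
apply: le_anti; rewrite snorm_ge0 andbT; apply: le_trans (snorm_le_sum _ _) _.
by rewrite big1// => a _; rewrite (rnorm0 e).
Qed.

Lemma ell_bounded0 : ell_bounded (fun=> 0).
Proof. by exists 0 => n; rewrite snorm0. Qed.

Lemma ell_boundedD f g : ell_bounded f -> ell_bounded g ->
  ell_bounded (fun a => f a + g a).
Proof.
move=> [M HM] [N HN]; exists (M + N) => n.
by apply: le_trans (snormD _ _ _) _; exact: lerD.
Qed.

Lemma ell_boundedZ c f : ell_bounded f -> ell_bounded (fun a => c * f a).
Proof.
move=> [M HM]; exists (rnorm (c : K^o) * M) => n; rewrite snormZ.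
by apply: ler_wpM2l => //; exact: (rnorm_ge0 e).
Qed.

End Snorm.

(* The parameters [hK], [e], [u1] and [covB] are only used by the structures
   below; they are part of the type so that instances can be inferred from it. *)
Definition ell (R : realType) (K : numFieldType) (re : K -> R) (hK : scalar_field re)
    (e : scalar_embedding re) (u : R) (u1 : 1 <= u) (I : eqType) (B : nat -> seq I)
    (covB : forall a, exists n, a \in B n) : Type :=
  {f : I -> K | ell_bounded re u B f}.

Section EllModule.
Context {R : realType} {K : numFieldType} {re : K -> R} (hK : scalar_field re)
  (e : scalar_embedding re) (u : R) (u1 : 1 <= u) (I : eqType) (B : nat -> seq I)
  (covB : forall a, exists n, a \in B n).
Local Notation rnorm := (rnorm re).
Local Notation ell := (ell hK e u1 covB).
Implicit Types (x y z : ell).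

Lemma ell_eq x y : sval x =1 sval y -> x = y.
Proof.
case: x y => [f hf] [g hg] /= h; apply: eq_exist; exact/funext.
Qed.

HB.instance Definition _ := gen_eqMixin ell.
HB.instance Definition _ := gen_choiceMixin ell.

Definition ell_zero : ell := exist _ _ (ell_bounded0 e u1 B).
Definition ell_add x y : ell := exist _ _ (ell_boundedD e u1 (svalP x) (svalP y)).
Definition ell_scale (c : K) x : ell := exist _ _ (ell_boundedZ e u1 c (svalP x)).

Lemma ell_addA : associative ell_add.
Proof. by move=> x y z; apply: ell_eq => a /=; rewrite addrA. Qed.
Lemma ell_addC : commutative ell_add.
Proof. by move=> x y; apply: ell_eq => a /=; rewrite addrC. Qed.
Lemma ell_add0 : left_id ell_zero ell_add.
Proof. by move=> x; apply: ell_eq => a /=; rewrite add0r. Qed.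
Lemma ell_addN : left_inverse ell_zero (ell_scale (-1)) ell_add.
Proof. by move=> x; apply: ell_eq => a /=; rewrite mulN1r addNr. Qed.

HB.instance Definition _ := GRing.isZmodule.Build ell ell_addA ell_addC ell_add0 ell_addN.

Lemma ell_scaleA c d x : ell_scale c (ell_scale d x) = ell_scale (c * d) x.
Proof. by apply: ell_eq => a /=; rewrite mulrA. Qed.
Lemma ell_scale1 : left_id 1 ell_scale.
Proof. by move=> x; apply: ell_eq => a /=; rewrite mul1r. Qed.
Lemma ell_scaleDr : right_distributive ell_scale +%R.
Proof. by move=> c x y; apply: ell_eq => a /=; rewrite mulrDr. Qed.
Lemma ell_scaleDl x : {morph ell_scale^~ x : c d / c + d}.
Proof. by move=> c d; apply: ell_eq => a /=; rewrite mulrDl. Qed.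

HB.instance Definition _ := GRing.Zmodule_isLmodule.Build K ell
  ell_scaleA ell_scale1 ell_scaleDr ell_scaleDl.

Definition ell_norm x : R := sup [set snorm re u B n (sval x) | n in [set: nat]]%classic.

Let has_sup_snorm x : has_sup [set snorm re u B n (sval x) | n in [set: nat]]%classic.
Proof.
split; first by exists (snorm re u B 0 (sval x)); exists 0%N.
by have [M HM] := svalP x; exists M => _ [n _ <-].
Qed.

Lemma snorm_le_ell x n : snorm re u B n (sval x) <= ell_norm x.
Proof. by apply: sup_ubound; [exact: (has_sup_snorm x).2|exists n]. Qed.

Lemma ell_norm_le x M : (forall n, snorm re u B n (sval x) <= M) -> ell_norm x <= M.
Proof.
move=> h; apply: ge_sup; first exact: (has_sup_snorm x).1.
by move=> _ [n _ <-].
Qed.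

Lemma ell_norm_ge0 x : 0 <= ell_norm x.
Proof. exact: le_trans (snorm_ge0 _ _ _ _ _) (snorm_le_ell x 0). Qed.

Lemma ell_coord_le x a : rnorm (sval x a : K^o) <= ell_norm x.
Proof.
have [n an] := covB a.
exact: le_trans (snorm_coord e u1 _ an) (snorm_le_ell x n).
Qed.

Lemma ell_normD x y : e (ell_norm (x + y)) <= e (ell_norm x) + e (ell_norm y).
Proof.
rewrite -rmorphD emb_le; apply: ell_norm_le => n.
by apply: le_trans (snormD e u1 B n _ _) _; rewrite lerD ?snorm_le_ell.
Qed.

Lemma ell_normZ c x : e (ell_norm (c *: x)) = `|c| * e (ell_norm x).
Proof.
have -> : `|c| = e (rnorm (c : K^o)) := normE_rnorm e (c : K^o).
rewrite -rmorphM; congr (e _).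
have le c' x' : ell_norm (c' *: x') <= rnorm (c' : K^o) * ell_norm x'.
  apply: ell_norm_le => n; rewrite (snormZ e u1) ler_wpM2l ?(rnorm_ge0 e)//.
  exact: snorm_le_ell.
apply: le_anti; rewrite le/=.
have [->|c0] := eqVneq c 0; first by rewrite (rnorm0 e) mul0r ell_norm_ge0.
have nc : 0 < rnorm (c : K^o) by rewrite lt0r (rnorm_eq0 e) c0 (rnorm_ge0 e).
rewrite -ler_pdivlMl//; have := le c^-1 (c *: x).
rewrite scalerA mulVf// scale1r; suff -> : rnorm (c^-1 : K^o) = (rnorm (c : K^o))^-1 by [].
apply: (mulfI (lt0r_neq0 nc)); rewrite mulfV ?gt_eqF// -(rnormM e) mulfV//.
by rewrite -(rmorph1 e) (rnorm_emb e) normr1.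
Qed.

Lemma ell_norm_eq0 x : e (ell_norm x) = 0 -> x = 0.
Proof.
rewrite -(rmorph0 e) => /(can_inj (embK e)) x0; apply: ell_eq => a /=.
apply/eqP; rewrite -(rnorm_eq0 e (X := K^o)); apply/eqP/le_anti.
by rewrite (rnorm_ge0 e) -x0 ell_coord_le.
Qed.

HB.instance Definition _ := Lmodule_isNormed.Build K ell ell_normD ell_normZ ell_norm_eq0.

Lemma rnorm_ell x : rnorm x = ell_norm x.
Proof. exact: (embK e). Qed.

Lemma ell_valD x y a : sval (x + y) a = sval x a + sval y a. Proof. by []. Qed.

Lemma ell_valZ c x a : sval (c *: x) a = c * sval x a. Proof. by []. Qed.

Lemma ell_valB x y a : sval (x - y) a = sval x a - sval y a.
Proof. by rewrite ell_valD -scaleN1r ell_valZ mulN1r. Qed.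

Lemma ell_cauchy_cvg (v : nat -> ell) :
  (forall eps : R, 0 < eps -> exists N, forall i, (N <= i)%N -> rnorm (v N - v i) <= eps) ->
  exists x, forall eps : R, 0 < eps -> exists N, forall i, (N <= i)%N ->
    rnorm (x - v i) <= eps.
Proof.
move=> H.
have Hc a : exists l : K, forall eps : R, 0 < eps -> exists N, forall i, (N <= i)%N ->
    rnorm (l - sval (v i) a : K^o) <= eps.
  apply: (scalar_cauchy_cvg hK) => eps /H[N HN]; exists N => i /HN; apply: le_trans.
  by rewrite -ell_valB rnorm_ell; exact: ell_coord_le.
have [f Hf] := choice Hc.
have lim_finite (s : seq I) eps : 0 < eps -> exists N, forall i, (N <= i)%N ->
    \sum_(a <- s) rnorm (f a - sval (v i) a : K^o) <= eps.
  elim: s eps => [|a s IH] eps eps0; first by exists 0%N => i _; rewrite big_nil ltW.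
  have e2 : 0 < eps / 2 by rewrite divr_gt0.
  have [N1 h1] := IH _ e2; have [N2 h2] := Hf a _ e2.
  exists (maxn N1 N2) => i; rewrite geq_max => /andP[/h1 {}h1 /h2 {}h2].
  by rewrite big_cons [leRHS](splitr eps) lerD.
have tail eps : 0 < eps -> exists N, forall i, (N <= i)%N -> forall n,
    snorm re u B n (fun a => f a - sval (v i) a) <= eps.
  move=> eps0; have e2 : 0 < eps / 2 by rewrite divr_gt0.
  have [N HN] := H _ e2; exists N => i Ni n.
  apply/ler_addgt0Pr => d d0; have [N' HN'] := lim_finite (B n) _ d0.
  (* j depends on n: it only compares the coordinatewise limit with the sequence on the finite list
     [B n], and the resulting bound no longer involves j. *)
  pose j := maxn N N'.
  have -> : (fun a => f a - sval (v i) a) =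
      (fun a => (f a - sval (v j) a) + sval (v j - v i) a).
    by apply/funext => a; rewrite ell_valB subrKA.
  apply: le_trans (snormD e u1 B n _ _) _; rewrite addrC; apply: lerD.
    apply: le_trans (snorm_le_ell (v j - v i) n) _; rewrite -rnorm_ell.
    rewrite -(subrKA (v N)) [leRHS]splitr; apply: le_trans (rnormD e _ _) _.
    apply: lerD; last exact: HN.
    by rewrite -rnormN opprB; apply: HN; exact: leq_maxl.
  apply: le_trans (snorm_le_sum e u1 B n _) _; apply: HN'; exact: leq_maxr.
have fb : ell_bounded re u B f.
  have [N HN] := tail 1 ltr01; exists (1 + ell_norm (v N)) => n.
  have -> : f = (fun a => (f a - sval (v N) a) + sval (v N) a).
    by apply/funext => a; rewrite subrK.
  apply: le_trans (snormD e u1 B n _ _) _; apply: lerD; first exact: HN.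
  exact: snorm_le_ell.
exists (exist _ f fb) => eps /tail[N HN]; exists N => i Ni.
rewrite rnorm_ell; apply: ell_norm_le => n; apply: le_trans (HN i Ni n).
rewrite le_eqVlt; apply/orP; left; apply/eqP; congr (snorm _ _ _ _ _).
by apply/funext => a; rewrite ell_valB.
Qed.

Lemma ell_complete (F : set_system ell) : ProperFilter F -> cauchy F -> cvg F.
Proof.
move=> FF /cauchyP Fc.
have eps0 n : 0 < e (2 ^- n) by rewrite -(rmorph0 e) emb_lt invr_gt0 exprn_gt0.
(* Filters are reduced to sequences: v n is the center of a ball of radius 2^-n that belongs to
   F. *)
have [v Hv] := choice (fun n => Fc _ (eps0 n)).
have ballE x n : ball x (e (2 ^- n)) = [set y | rnorm (x - y) < 2 ^- n]%classic.
  apply/funext => y; rewrite -ball_normE /=; apply/propext.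
  by rewrite (normE_rnorm e) emb_lt.
have small eps : 0 < eps -> exists n : nat, 2 ^- n + 2 ^- n <= eps :> R.
  move=> ep; have e2 : 0 < eps / 2 by rewrite divr_gt0.
  exists (Num.truncn (eps / 2)^-1).+1; rewrite [leRHS]splitr.
  suff h : 2 ^- (Num.truncn (eps / 2)^-1).+1 <= eps / 2 by exact: lerD.
  rewrite invf_ple ?posrE ?exprn_gt0//; apply: le_trans (ltW (truncnS_gt _)) _.
  by rewrite -natrX ler_nat ltnW// ltn_expl.
have mono n i : (n <= i)%N -> 2 ^- i <= 2 ^- n :> R.
  by move=> ni; rewrite lef_pV2 ?posrE ?exprn_gt0// ler_weXn2l// ler1n.
have [|x Hx] := @ell_cauchy_cvg v.
  move=> eps /small[n Hn]; exists n => i ni.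
  have [y [yn yi]] := filter_ex (filterI (Hv n) (Hv i)).
  rewrite ballE /= in yn; rewrite ballE /= in yi.
  rewrite -(subrKA y); apply: le_trans (rnormD e _ _) _.
  apply: le_trans Hn; apply: lerD; first exact: ltW.
  by rewrite -rnormN opprB (le_trans (ltW yi)) ?mono.
apply/cvg_ex; exists x; apply/cvgrPdist_le => /= eps ep.
have rep : 0 < re eps by rewrite -(emb_lt e) (reK e) ?(ltW ep)// rmorph0.
have r2 : 0 < re eps / 2 by rewrite divr_gt0.
have [n Hn] := small _ r2; have [N HN] := Hx _ r2.
pose i := maxn n N.
apply: filterS (Hv i) => y; rewrite ballE /= => yi.
rewrite (normE_rnorm e) -(reK e (ltW ep)) emb_le -(subrKA (v i)).
apply: le_trans (rnormD e _ _) _; rewrite [leRHS]splitr; apply: lerD.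
  exact/HN/leq_maxr.
apply: le_trans (ltW yi) _; apply: le_trans (mono n i (leq_maxl _ _)) _.
by apply: le_trans Hn; rewrite lerDl invr_ge0 exprn_ge0.
Qed.

HB.instance Definition _ := Uniform_isComplete.Build ell ell_complete.

End EllModule.

Lemma sum_sign_orthogonal (R : realType) n (a : 'I_n -> R) :
  \sum_(w : {ffun 'I_n -> bool}) (\sum_i (-1) ^+ w i * a i) ^+ 2 =
  2 ^+ n * \sum_i a i ^+ 2.
Proof.
transitivity (\sum_i \sum_j (a i * a j) *
    \sum_(w : {ffun 'I_n -> bool}) (-1) ^+ w i * (-1) ^+ w j).
  under eq_bigr => w _ do rewrite expr2 big_distrlr/=.
  rewrite exchange_big/=; apply: eq_bigr => i _.
  rewrite exchange_big/=; apply: eq_bigr => j _.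
  by rewrite mulr_sumr; apply: eq_bigr => w _; ring.
have orth i j : j != i -> \sum_(w : {ffun 'I_n -> bool}) (-1) ^+ w i * (-1) ^+ w j = 0 :> R.
  move=> ji; set S := \sum_w _; have : S = - S.
    rewrite {1}/S (reindex_inj (inv_inj (flipK i)))/= -sumrN; apply: eq_bigr => w _.
    by rewrite !ffunE eqxx (negbTE ji) addbF addbT signrN mulNr.
  by move/eqP; rewrite -addr_eq0 -mulr2n mulrn_eq0 => /eqP.
rewrite mulr_sumr; apply: eq_bigr => i _; rewrite (bigD1 i)//=.
rewrite [X in _ + X]big1 ?addr0 => [|j ji]; last by rewrite orth// mulr0.
rewrite (eq_bigr (fun=> 1)) => [|w _]; last by rewrite -signr_addb addbb.
by rewrite sumr_const card_ffun card_bool card_ord natrX expr2 mulrC.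
Qed.

Lemma scalar_orthogonal (R : realType) (K : numFieldType) (re : K -> R)
    (hK : scalar_field re) n (k : 'I_n -> K) :
  \sum_w rnorm re (rademacher (k : 'I_n -> K^o) w) ^+ 2 =
  2 ^+ n * \sum_i rnorm re (k i : K^o) ^+ 2.
Proof.
case: hK k => k.
  under eq_bigr => w _ do rewrite /rnorm real_normK ?num_real//.
  under [in RHS]eq_bigr => i _ do rewrite /rnorm real_normK ?num_real//.
  exact: sum_sign_orthogonal.
have sq (z : R[i]) : rnorm (@complex.Re R) (z : R[i]^o) ^+ 2 =
    complex.Re z ^+ 2 + complex.Im z ^+ 2.
  have /(congr1 (@complex.Re R)) := add_Re2_Im2 z.
  have Resq (w : R[i]) : 0 <= w -> complex.Re w ^+ 2 = complex.Re (w ^+ 2).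
    by move=> /ger0_real/complex_realP[r ->]; rewrite -rmorphXn.
  by move=> /= ->; exact: (Resq `|z| (normr_ge0 z)).
under eq_bigr => w _ do rewrite sq.
under [in RHS]eq_bigr => i _ do rewrite sq.
rewrite !big_split/= mulrDr -!sum_sign_orthogonal.
have part (f : R[i] -> R) : f 0 = 0 -> {morph f : x y / x + y} -> {morph f : x / - x} ->
    forall w : {ffun 'I_n -> bool},
    f (rademacher (k : 'I_n -> R[i]^o) w) = \sum_i (-1) ^+ w i * f (k i).
  move=> f0 fD fN w; rewrite /rademacher (big_morph f fD f0); apply: eq_bigr => i _.
  by case: (w i); rewrite ?expr0 ?expr1 ?scale1r ?mul1r// scaleN1r mulN1r fN.
congr (_ + _); apply: eq_bigr => w _; congr (_ ^+ 2); apply: part => //.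
- by move=> [? ?] [? ?].
- by move=> [? ?].
- by move=> [? ?] [? ?].
- by move=> [? ?].
Qed.

(** [G j] is bounded by every upper bound of the [F n j]; by monotonicity one n is nearly optimal
    for all of the finitely many j at once. *)
Lemma sum_sup_le (R : realType) (J : finType) (F : nat -> J -> R) (G : J -> R) (C : R) :
  (forall j n i, (n <= i)%N -> F n j <= F i j) ->
  (forall j b, (forall n, F n j <= b) -> G j <= b) ->
  (forall n, \sum_j F n j <= C) -> \sum_j G j <= C.
Proof.
move=> mono supG H; apply/ler_addgt0Pr => d d0.
pose dd := d / #|J|.+1%:R; have dd0 : 0 < dd by rewrite divr_gt0// ltr0n.
have ex j : exists n, G j <= F n j + dd.
  apply: contrapT => /forallNP h.
  have : G j <= G j - dd.
    apply: supG => n; have /negP := h n; rewrite -ltNge => /ltW.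
    by rewrite lerBrDr.
  by rewrite lerBrDl gerDr leNgt dd0.
have [N HN] := choice ex; pose n := (\max_j N j)%N.
apply: (@le_trans _ _ (\sum_j (F n j + dd))).
  apply: ler_sum => j _; apply: le_trans (HN j) _; rewrite lerD2r; apply: mono.
  exact: leq_bigmax.
rewrite big_split/= lerD// sumr_const -mulr_natr /dd -mulrA ler_piMr ?(ltW d0)//.
by rewrite ler_pdivrMl ?ltr0n// mulr1 ler_nat.
Qed.

Section EllFacts.
Context {R : realType} {K : numFieldType} {re : K -> R} (hK : scalar_field re)
  (e : scalar_embedding re) (u : R) (u1 : 1 <= u) (I : eqType) (B : nat -> seq I)
  (covB : forall a, exists n, a \in B n).
Local Notation rnorm := (rnorm re).
Local Notation ell := (ell hK e u1 covB).

Definition ell_coord_fun (a : I) (x : ell) : K^o := sval x a.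

Lemma ell_coord_linear a : linear (ell_coord_fun a).
Proof. by move=> c x y. Qed.

Definition ell_coord a : {linear ell -> K^o} :=
  HB.pack (ell_coord_fun a) (GRing.isLinear.Build _ _ _ _ _ (ell_coord_linear a)).

Lemma ell_coord_dual a : dual_ball (ell_coord a).
Proof.
move=> x x1; apply: le_trans x1.
rewrite (normE_rnorm e (ell_coord a x)) (normE_rnorm e x) emb_le rnorm_ell.
exact: ell_coord_le.
Qed.

Lemma ell_sum_coord (J : Type) (s : seq J) (P : pred J) (y : J -> ell) a :
  sval (\sum_(j <- s | P j) y j) a = \sum_(j <- s | P j) sval (y j) a.
Proof. exact: (linear_sum (ell_coord a)). Qed.

Lemma rademacher_coord n (y : 'I_n -> ell) w a :
  sval (rademacher y w) a = rademacher (fun i => sval (y i) a : K^o) w.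
Proof. by rewrite /rademacher ell_sum_coord. Qed.

Hypothesis monoB : forall (f : I -> R), (forall a, 0 <= f a) ->
  forall n i, (n <= i)%N -> \sum_(a <- B n) f a <= \sum_(a <- B i) f a.

Let u0 : 0 < u := lt_le_trans ltr01 u1.

Lemma snorm_mono f n i : (n <= i)%N -> snorm re u B n f <= snorm re u B i f.
Proof.
move=> ni; apply: powR_le; rewrite ?invr_ge0 ?(ltW u0) ?sum_rnorm_ge0//.
by apply: monoB => // a; exact: powR_ge0.
Qed.

End EllFacts.

Section Ell2Cotype.
Context {R : realType} {K : numFieldType} {re : K -> R} (hK : scalar_field re)
  (e : scalar_embedding re) (u1 : 1 <= (2 : R)) (I : eqType) (B : nat -> seq I)
  (covB : forall a, exists n, a \in B n).
Local Notation rnorm := (rnorm re).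
Local Notation ell := (ell hK e u1 covB).

Hypothesis monoB : forall (f : I -> R), (forall a, 0 <= f a) ->
  forall n i, (n <= i)%N -> \sum_(a <- B n) f a <= \sum_(a <- B i) f a.

Lemma snorm2_sqr n f : snorm re 2 B n f ^+ 2 = \sum_(a <- B n) rnorm (f a : K^o) ^+ 2.
Proof.
rewrite -powR_mulrn ?snorm_ge0// powRVK ?sum_rnorm_ge0//.
by apply: eq_bigr => a _; rewrite powR_mulrn ?(rnorm_ge0 e).
Qed.

(** On a finite section the squares average to an equality, by orthogonality of signs in every
    coordinate; [sum_sup_le] passes from sections to norms. *)
Lemma ell2_cotype : cotype re 2 ell.
Proof.
exists 1 => // n y; rewrite mul1r.
have -> : \sum_i rnorm (y i) `^ 2 = \sum_i rnorm (y i) ^+ 2.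
  by apply: eq_bigr => i _; rewrite powR_mulrn ?(rnorm_ge0 e).
rewrite powR12_sqrt ?sumr_ge0// => [|i _]; last exact: sqr_ge0.
apply: ler_wsqrtr.
apply: (sum_sup_le (F := fun l i => snorm re 2 B l (sval (y i)) ^+ 2)).
- move=> i l l' ll'; rewrite ler_sqr ?nnegrE ?snorm_ge0//.
  exact: snorm_mono.
- move=> i b h; have b0 : 0 <= b := le_trans (sqr_ge0 _) (h 0%N).
  rewrite -(sqr_sqrtr b0) ler_sqr ?nnegrE ?sqrtr_ge0 ?(rnorm_ge0 e)//.
  rewrite rnorm_ell; apply: ell_norm_le => l.
  by rewrite -ler_sqr ?nnegrE ?sqrtr_ge0 ?snorm_ge0// sqr_sqrtr.
move=> l.
have n2 : 0 < (2 : R) ^+ n by rewrite exprn_gt0.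
rewrite -(ler_pM2l n2) mulrA mulfV ?gt_eqF// mul1r.
have -> : 2 ^+ n * \sum_i snorm re 2 B l (sval (y i)) ^+ 2 =
    \sum_w snorm re 2 B l (sval (rademacher y w)) ^+ 2.
  under eq_bigr => i _ do rewrite snorm2_sqr.
  under [RHS]eq_bigr => w _ do rewrite snorm2_sqr.
  rewrite exchange_big/= mulr_sumr [RHS]exchange_big/=; apply: eq_bigr => a _.
  under [RHS]eq_bigr => w _ do rewrite rademacher_coord.
  by rewrite (scalar_orthogonal hK).
apply: ler_sum => w _; rewrite ler_sqr ?nnegrE ?snorm_ge0 ?(rnorm_ge0 e)//.
rewrite rnorm_ell; exact: snorm_le_ell.
Qed.

End Ell2Cotype.

Section UnitVectors.
Context {R : realType} {K : numFieldType} {re : K -> R} (hK : scalar_field re)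
  (e : scalar_embedding re) (u : R) (u1 : 1 <= u).
Local Notation rnorm := (rnorm re).

Lemma iota_cover (a : nat) : exists n, a \in iota 0 n.
Proof. by exists a.+1; rewrite mem_iota add0n ltnS leqnn. Qed.

Local Notation ell := (ell hK e u1 iota_cover).

Let u0 : 0 < u := lt_le_trans ltr01 u1.

Lemma finite_vector_le n (c : nat -> K) l :
  snorm re u (iota 0) l (fun b => if (b < n)%N then c b else 0) <=
  (\sum_(a < n) rnorm (c a : K^o) `^ u) `^ u^-1.
Proof.
pose F b := if (b < n)%N then rnorm (c b : K^o) `^ u else 0.
have F0 b : 0 <= F b by rewrite /F; case: ifP => // _; exact: powR_ge0.
apply: powR_le; rewrite ?invr_ge0 ?(ltW u0) ?sum_rnorm_ge0//.
have -> : \sum_(a <- iota 0 l) rnorm ((if (a < n)%N then c a else 0) : K^o) `^ u =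
    \sum_(a <- iota 0 l) F a.
  apply: eq_bigr => a _; rewrite /F; case: ifP => // _.
  by rewrite (rnorm0 e) powR0 ?gt_eqF.
have -> : \sum_(a < n) rnorm (c a : K^o) `^ u = \sum_(0 <= a < n) F a.
  by rewrite big_mkord; apply: eq_bigr => a _; rewrite /F ltn_ord.
rewrite -[l in iota 0 l]subn0 -/(index_iota 0 l).
have [ln|nl] := leqP l n.
  by rewrite [leRHS](big_cat_nat (n := l))//= lerDl sumr_ge0.
rewrite [leLHS](big_cat_nat (n := n)) ?(ltnW nl)//= gerDl.
by rewrite big_nat big1// => a /andP[na _]; rewrite /F ltnNge na.
Qed.

Definition finite_vector n (c : nat -> K) : ell :=
  exist _ _ (ex_intro _ _ (finite_vector_le n c)).

Definition unit_vector (a : nat) : ell :=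
  finite_vector a.+1 (fun b => (b == a)%:R).

Lemma unit_vectorE a b : sval (unit_vector a) b = (b == a)%:R.
Proof.
rewrite /=; have [->|ba] := eqVneq b a; first by rewrite ltnSn.
by case: ifP.
Qed.

Lemma unit_vector_sum n (c : nat -> K) :
  finite_vector n c = \sum_(a < n) c a *: unit_vector a.
Proof.
apply: ell_eq => b; rewrite ell_sum_coord.
under eq_bigr => a _ do rewrite ell_valZ unit_vectorE.
rewrite /finite_vector /sval.
case: ifP => bn.
  rewrite (bigD1 (Ordinal bn))//= eqxx mulr1 big1 ?addr0// => a ab.
  by rewrite (_ : (b == a) = false) ?mulr0//; apply/negbTE; rewrite eq_sym.
rewrite big1// => a _; rewrite (_ : (b == a) = false) ?mulr0//.
by apply: contraFF bn => /eqP ->; exact: ltn_ord.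
Qed.

Lemma finite_vector_norm n (c : nat -> K) :
  rnorm (finite_vector n c) <= (\sum_(a < n) rnorm (c a : K^o) `^ u) `^ u^-1.
Proof. by rewrite rnorm_ell; apply: ell_norm_le => l; exact: finite_vector_le. Qed.

(** The exponent 1/(1 - 1/u) is u^*. By duality with d = 1/u it suffices to test phi on vectors with
    coefficients g^(1/u), of norm at most 1, rotated by the unimodular [ph] so that all terms become
    nonnegative. *)
Lemma unit_vector_dual (phi : {linear ell -> K^o}) n : 1 < u -> dual_ball phi ->
  \sum_(a < n) rnorm (phi (unit_vector a)) `^ (1 - u^-1)^-1 <= 1.
Proof.
move=> u1' hphi.
apply: (sub_prob_dual (w := fun a : 'I_n => rnorm (phi (unit_vector a)))).
- by move=> a; exact: (rnorm_ge0 e).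
- by rewrite invr_ge0 (ltW u0) invf_lt1.
move=> g [g0 g1].
pose z a : K := phi (unit_vector a).
(* The default 1 keeps [ph] unimodular where z vanishes. *)
pose ph a : K := if z a == 0 then 1 else e (rnorm (z a : K^o)) / z a.
have ph1 a : rnorm (ph a : K^o) = 1.
  apply: (can_inj (embK e)); rewrite -normE_rnorm rmorph1 /ph.
  have [_|za] := eqVneq (z a) 0; first exact: normr1.
  have -> : `|(e (rnorm (z a : K^o)) / z a : K^o)| = `|e (rnorm (z a : K^o))| / `|z a| :> K.
    by rewrite -normf_div.
  by rewrite -normE_rnorm normr_id divff// normr_eq0.
have phz a : ph a * z a = e (rnorm (z a : K^o)).
  rewrite /ph; have [->|za] := eqVneq (z a) 0; last by rewrite divfK.
  by rewrite (rnorm0 e) rmorph0 mulr0.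
pose gg a := if insub a is Some a' then g a' else 0.
have ggE (a : 'I_n) : gg a = g a by rewrite /gg valK.
pose c a : K := ph a * e (gg a `^ u^-1).
have nc : rnorm (finite_vector n c) <= 1.
  apply: le_trans (finite_vector_norm n c) _.
  have -> : \sum_(a < n) rnorm (c a : K^o) `^ u = \sum_a g a.
    apply: eq_bigr => a _; rewrite /c (rnormM e) ph1 mul1r (rnorm_emb e).
    by rewrite ger0_norm ?powR_ge0// powRVK ?ggE ?gt_eqF.
  by apply: powR_le1; rewrite ?invr_ge0 ?(ltW u0)// sumr_ge0.
have : rnorm (phi (finite_vector n c)) <= 1.
  by apply: le_trans nc; exact: (dual_ball_le e).
have -> : phi (finite_vector n c) =
    e (\sum_a g a `^ u^-1 * rnorm (phi (unit_vector a))) :> K^o.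
  rewrite unit_vector_sum linear_sum rmorph_sum; apply: eq_bigr => a _.
  rewrite linearZ rmorphM -[e (rnorm _)]phz /c ggE.
  by rewrite -[LHS]/(ph a * e (g a `^ u^-1) * z a) mulrAC mulrC.
rewrite (rnorm_emb e) ger0_norm// sumr_ge0// => a _.
by rewrite mulr_ge0 ?powR_ge0 ?(rnorm_ge0 e).
Qed.

End UnitVectors.

(** * Diagonal and multiplier operators *)

Section Diagonal.
Context {R : realType} {K : numFieldType} {re : K -> R} (hK : scalar_field re)
  (e : scalar_embedding re) (u : R) (u1 : 1 <= u).
Local Notation rnorm := (rnorm re).
Local Notation ell := (ell hK e u1 iota_cover).
Context (p : R) (p1 : 1 <= p).

Let p0 : 0 < p := lt_le_trans ltr01 p1.

(** Coordinates belong to the dual ball, so each of them is at most 1 along the family, and raising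
    the exponent from p to r decreases the sum. *)
Lemma coord_sum_le N (z : 'I_N -> ell) a r : p <= r -> weak_bounded re p z ->
  \sum_l rnorm (sval (z l) a : K^o) `^ r <= 1.
Proof.
move=> pr hz; have h := hz _ (ell_coord_dual a).
apply: le_trans h; apply: ler_sum => l _.
apply: powR_le_le1; rewrite ?(ltW p0)// (rnorm_ge0 e)/=.
apply: (powR_leK p0); rewrite ?(rnorm_ge0 e)// powR1.
apply: le_trans (hz _ (ell_coord_dual a)).
by rewrite (bigD1 l)//= lerDl sumr_ge0// => l' _; exact: powR_ge0.
Qed.

(** For r <= 2 the l_2 norm is at most the l_r norm, and with l_r on the outside and inside the
    coordinates decouple. *)
Lemma diagonal_small (r M : R) (mu : nat -> R) N (z : 'I_N -> ell) n :
  p <= r -> r <= 2 -> (forall c, 0 <= mu c) ->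
  \sum_(c < n) mu c `^ r <= M -> weak_bounded re p z ->
  \sum_l (\sum_(c < n) (mu c * rnorm (sval (z l) c : K^o)) `^ 2) `^ (r / 2) <= M.
Proof.
move=> pr r2 mu0 hM hz; have r0 := lt_le_trans p0 pr.
have x0 l c : 0 <= mu c * rnorm (sval (z l) c : K^o) by rewrite mulr_ge0 ?(rnorm_ge0 e).
apply: (@le_trans _ _ (\sum_l \sum_(c < n) (mu c * rnorm (sval (z l) c : K^o)) `^ r)).
  apply: ler_sum => l _.
  have S0 : 0 <= \sum_(c < n) (mu c * rnorm (sval (z l) c : K^o)) `^ r.
    by apply: sumr_ge0 => c _; exact: powR_ge0.
  have h := sum_powR_norm_le xpredT r0 r2 (fun c : 'I_n => x0 l c).
  have := powR_le (ltW r0) (powR_ge0 _ _) h.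
  by rewrite [leRHS](powRVK S0 (lt0r_neq0 r0)) -powRrM [2^-1 * r]mulrC.
rewrite exchange_big/=; apply: le_trans hM; apply: ler_sum => c _.
have E l : (mu c * rnorm (sval (z l) c : K^o)) `^ r =
    mu c `^ r * rnorm (sval (z l) c : K^o) `^ r by rewrite powRM ?(rnorm_ge0 e).
rewrite (eq_bigr _ (fun l _ => E l)) -mulr_sumr ler_piMr ?powR_ge0//.
exact: coord_sum_le.
Qed.

Lemma ell_sum_le1 (x : ell) n : rnorm x <= 1 ->
  \sum_(c < n) rnorm (sval x c : K^o) `^ u <= 1.
Proof.
have u0 : 0 < u := lt_le_trans ltr01 u1.
move=> x1; have h : snorm re u (iota 0) n (sval x) <= 1.
  by apply: le_trans x1; rewrite rnorm_ell; exact: snorm_le_ell.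
have := powR_le (ltW u0) (snorm_ge0 _ _ _ _ _) h.
rewrite powRVK ?sum_rnorm_ge0 ?gt_eqF// powR1 => {}h.
by rewrite -(big_mkord xpredT (fun c => rnorm (sval x c : K^o) `^ u)) /index_iota subn0.
Qed.

Lemma rnorm_rademacher_coord N (z : 'I_N -> ell) (g : 'I_N -> R) c :
  (forall l, 0 <= g l) ->
  2 ^+ N * \sum_l g l ^+ 2 * rnorm (sval (z l) c : K^o) ^+ 2 =
  \sum_w rnorm (sval (rademacher (fun l => e (g l) *: z l) w) c : K^o) ^+ 2.
Proof.
move=> g0; under [RHS]eq_bigr => w _ do rewrite rademacher_coord.
rewrite (scalar_orthogonal hK); congr (_ * _); apply: eq_bigr => l _.
by rewrite ell_valZ (rnormM e) (rnorm_emb e) ger0_norm// exprMn.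
Qed.

(* Diagonal operators into [ell_2] with multiplier in [ell_r], by interpolating
   between the exponents 2 and v, where 1/v = 1/p - 1/2; at v the bound comes
   from the cotype 2 of [ell_2], dualized over the weights [g]. *)
Lemma diagonal_large (r M : R) (mu : nat -> R) N (z : 'I_N -> ell) n :
  p <= 2 -> u^-1 = 1 - p^-1 -> 2 < r -> p^-1 - 2^-1 <= r^-1 -> 0 < M ->
  (forall c, 0 <= mu c) -> \sum_(c < n) mu c `^ r <= M -> weak_bounded re p z ->
  \sum_l (\sum_(c < n) (mu c * rnorm (sval (z l) c : K^o)) `^ 2) `^ (r / 2) <= M.
Proof.
move=> p2 uE r2 pr M0 mu0 hM hz.
have u0 : 0 < u := lt_le_trans ltr01 u1.
have r0 : 0 < r by apply: lt_trans r2.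
pose iv := p^-1 - 2^-1.
have iv0 : 0 <= iv by rewrite subr_ge0 lef_pV2 ?posrE.
have uV0 : 0 < u^-1 by rewrite invr_gt0.
have ivu : iv + u^-1 = 2^-1 by rewrite uE /iv; field; rewrite gt_eqF.
(* With 1/v = [iv] one has 1/v + 1/u = 1/2, and th is the interpolation parameter in 1/r = (1 -
   th)/2 + th/v. *)
pose th := (2^-1 - r^-1) / u^-1.
have rV2 : r^-1 < 2^-1 by rewrite ltf_pV2 ?posrE.
have rV0 : 0 < r^-1 by rewrite invr_gt0.
have th0 : 0 <= th by rewrite divr_ge0 ?(ltW uV0)// subr_ge0 ltW.
have th1 : th <= 1.
  by rewrite ler_pdivrMr// mul1r lerBlDr -lerBlDl -ivu addrK.
have thE : (1 - th) / 2 + th * iv = r^-1.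
  have -> : iv = 2^-1 - u^-1 by rewrite -ivu addrK.
  by rewrite /th; field; rewrite !gt_eqF.
pose mm c := mu c `^ r; have mm0 c : 0 <= mm c by exact: powR_ge0.
pose t l c := rnorm (sval (z l) c : K^o) ^+ 2.
have t0 l c : 0 <= t l c by exact: sqr_ge0.
pose A l := \sum_(c < n) mm c * t l c.
pose B l := \sum_(c < n) mm c `^ (2 * iv) * t l c.
have A0 l : 0 <= A l by apply: sumr_ge0 => c _; rewrite mulr_ge0.
have B0 l : 0 <= B l by apply: sumr_ge0 => c _; rewrite mulr_ge0 ?powR_ge0.
have SAB l : \sum_(c < n) (mu c * rnorm (sval (z l) c : K^o)) `^ 2 <=
    A l `^ (1 - th) * B l `^ th.
  have y01 : 0 <= 1 - th <= 1 by rewrite subr_ge0 th1 gerBl th0.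
  have h := sum_hoelder xpredT (fun c : 'I_n => mulr_ge0 (mm0 c) (t0 l c))
    (fun c : 'I_n => mulr_ge0 (powR_ge0 (mm c) (2 * iv)) (t0 l c)) y01.
  rewrite subKr in h; apply: le_trans h; apply: ler_sum => c _.
  have x0 : 0 <= rnorm (sval (z l) c : K^o) := rnorm_ge0 e _.
  have -> : (mm c * t l c) `^ (1 - th) * (mm c `^ (2 * iv) * t l c) `^ th =
      (mm c `^ (1 - th) * mm c `^ (2 * iv) `^ th) * t l c.
    rewrite (powRM _ (mm0 c) (t0 l c)) (powRM _ (powR_ge0 _ _) (t0 l c)) mulrACA.
    by rewrite -[t l c `^ _ * _]powRD_ge0 ?subr_ge0// subrK powRr1.
  have y0 : 0 <= 1 - th by case/andP: y01.
  have w0 : 0 <= 2 * iv * th := mulr_ge0 (mulr_ge0 (ler0n R 2) iv0) th0.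
  rewrite (powRM 2 (mu0 c) x0) -(powRrM (mm c)) -(powRD_ge0 (mm c) y0 w0).
  rewrite -powRrM.
  have -> : r * (1 - th + 2 * iv * th) = 2.
    have -> : r * (1 - th + 2 * iv * th) = 2 * r * ((1 - th) / 2 + th * iv) by field.
    by rewrite thE -mulrA mulfV ?mulr1// gt_eqF.
  by rewrite [rnorm _ `^ 2]powR_mulrn.
have sumA : \sum_l A l <= M.
  rewrite exchange_big/=; apply: le_trans hM; apply: ler_sum => c _.
  rewrite -mulr_sumr ler_piMr//.
  have E l : t l c = rnorm (sval (z l) c : K^o) `^ 2 by rewrite powR_mulrn ?(rnorm_ge0 e).
  rewrite (eq_bigr _ (fun l _ => E l)); exact: coord_sum_le.
have r20 : 0 <= r / 2 by rewrite divr_ge0 ?(ltW r0).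
have Smono l : (\sum_(c < n) (mu c * rnorm (sval (z l) c : K^o)) `^ 2) `^ (r / 2) <=
    A l `^ ((1 - th) * (r / 2)) * B l `^ (th * (r / 2)).
  rewrite (powRrM (A l)) (powRrM (B l)) -(powRM (r / 2) (powR_ge0 _ _) (powR_ge0 _ _)).
  apply: (powR_le r20 _ (SAB l)).
  by apply: sumr_ge0 => c _; exact: powR_ge0.
(* Here p = 2 and v is infinite: B is bounded pointwise, by the norm of z l in l_2, instead of
   through a sum. *)
have [ivz|ivn] := eqVneq iv 0.
  have E1 : (1 - th) * (r / 2) = 1.
    have -> : (1 - th) * (r / 2) = r * ((1 - th) / 2 + th * iv) by rewrite ivz; field.
    by rewrite thE mulfV ?gt_eqF.
  apply: le_trans (ler_sum _ (fun l _ => Smono l)) _; apply: le_trans sumA.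
  apply: ler_sum => l _; rewrite E1 powRr1// ler_piMr//.
  apply: (powR_le1 (mulr_ge0 th0 r20) (B0 l)).
  have uE2 : u = 2 by apply: invr_inj; rewrite -ivu ivz add0r.
  have pE2 : p = 2 by apply: invr_inj; rewrite -[LHS]subr0 -ivz /iv subKr.
  have zl1 : rnorm (z l) <= 1.
    have [phi hphi <-] := hahn_banach hK (z l).
    apply: (powR_leK p0); rewrite ?(rnorm_ge0 e)// powR1.
    apply: le_trans (hz _ hphi).
    by rewrite (bigD1 l)//= lerDl sumr_ge0// => l' _; exact: powR_ge0.
  apply: (le_trans _ (ell_sum_le1 n zl1)); apply: ler_sum => c _.
  rewrite ivz mulr0 powRr0 mul1r.
  have x0 : 0 <= rnorm (sval (z l) c : K^o) := rnorm_ge0 e _.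
  rewrite [X in _ <= _ `^ X]uE2 (powR_mulrn 2 x0); exact: lexx.
have iv1 : 0 < iv by rewrite lt0r ivn.
have iv2 : 0 < 2 * iv by rewrite mulr_gt0.
have Miv : 0 < M `^ (2 * iv) by exact: powR_gt0.
(* Duality with d = 2/u returns the exponent 1/(1 - 2/u) = v/2. The weighted sum of B is an average
   over signs of sums over the coordinates of signed sums, whose l_u norm is at most 1 because u =
   p^*. *)
have sumB : \sum_l (B l / M `^ (2 * iv)) `^ (2 * iv)^-1 <= 1.
  have dE : 2 * iv = 1 - 2 * u^-1.
    by rewrite -[X in X - _](mulfV (_ : 2 != 0 :> R))// -ivu; ring.
  have -> : (2 * iv)^-1 = (1 - 2 * u^-1)^-1 by rewrite dE.
  apply: (sub_prob_dual (w := fun l => B l / M `^ (2 * iv))).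
  - by move=> l; rewrite divr_ge0 ?(ltW Miv).
  - by rewrite mulr_ge0 ?(ltW uV0)//= -subr_gt0 -dE.
  move=> g [g0 g1].
  under eq_bigr => l _ do rewrite mulrA.
  rewrite -mulr_suml ler_pdivrMr// mul1r.
  have n2 : 0 < (2 : R) ^+ N by rewrite exprn_gt0.
  rewrite -(ler_pM2l n2).
  have -> : 2 ^+ N * \sum_l g l `^ (2 * u^-1) * B l =
      \sum_w \sum_(c < n) mm c `^ (2 * iv) *
      rnorm (sval (rademacher (fun l => e (g l `^ u^-1) *: z l) w) c : K^o) ^+ 2.
    rewrite [RHS]exchange_big/=.
    have E1 l : g l `^ (2 * u^-1) * B l =
        \sum_(c < n) mm c `^ (2 * iv) * ((g l `^ u^-1) ^+ 2 * t l c).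
      rewrite mulr_sumr; apply: eq_bigr => c _; rewrite [2 * _]mulrC powRrM.
      by rewrite powR_mulrn ?powR_ge0// mulrCA.
    rewrite (eq_bigr _ (fun l _ => E1 l)) exchange_big/= mulr_sumr.
    apply: eq_bigr => c _; rewrite -!mulr_sumr mulrCA.
    by rewrite rnorm_rademacher_coord// => l; exact: powR_ge0.
  apply: (@le_trans _ _ (\sum_(w : {ffun 'I_N -> bool}) M `^ (2 * iv))); last first.
    by rewrite sumr_const card_ffun card_bool card_ord -[leLHS]mulr_natl natrX.
  apply: ler_sum => w _.
  have xw : rnorm (rademacher (fun l => e (g l `^ u^-1) *: z l) w) <= 1.
    by rewrite uE; apply: rademacher_bound.
  have v01 : 0 <= 2 * iv <= 1.
    by rewrite (ltW iv2) dE gerBl mulr_ge0 ?(ltW uV0).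
  set x := rademacher _ _ in xw *.
  have E (c : 'I_n) : mm c `^ (2 * iv) * rnorm (sval x c : K^o) ^+ 2 =
      mm c `^ (2 * iv) * (rnorm (sval x c : K^o) `^ u) `^ (1 - 2 * iv).
    have uu : u * (1 - 2 * iv) = 2 by rewrite dE subKr mulrCA mulfV ?mulr1 ?gt_eqF.
    by rewrite -powRrM uu powR_mulrn ?(rnorm_ge0 e).
  rewrite (eq_bigr _ (fun c _ => E c)).
  apply: le_trans (sum_hoelder xpredT (fun c : 'I_n => mm0 c)
    (fun c : 'I_n => powR_ge0 (rnorm (sval x c : K^o)) u) v01) _.
  have v1 : 0 <= 1 - 2 * iv by rewrite subr_ge0; case/andP: v01.
  rewrite -[leRHS]mulr1; apply: ler_pM; rewrite ?powR_ge0//.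
    apply: powR_le => //; [exact: ltW|exact: sumr_ge0].
  apply: powR_le1 => //; last exact: ell_sum_le1.
  by apply: sumr_ge0 => c _; exact: powR_ge0.
pose x := (1 - th) * (r / 2).
have xE : 1 - x = th * (r * iv).
  have -> : 1 = r * ((1 - th) / 2 + th * iv) by rewrite thE mulfV ?gt_eqF.
  by rewrite /x; field.
have x01 : 0 <= x <= 1.
  rewrite mulr_ge0 ?subr_ge0//= -subr_ge0 xE mulr_ge0// mulr_ge0 ?(ltW r0)//.
pose b l := (B l / M `^ (2 * iv)) `^ (2 * iv)^-1.
have b0 l : 0 <= b l by exact: powR_ge0.
have BE l : B l `^ (th * (r / 2)) = M `^ (1 - x) * b l `^ (1 - x).
  have D0 : 0 <= B l / M `^ (2 * iv) by rewrite divr_ge0 ?(ltW Miv).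
  rewrite -[in LHS](divfK (lt0r_neq0 Miv) (B l)) (powRM _ D0 (ltW Miv)) mulrC.
  rewrite /b -(powRrM M) -(powRrM (B l / _)) xE.
  by congr (_ `^ _ * _ `^ _); field; rewrite ?gt_eqF.
apply: (@le_trans _ _ (\sum_l M `^ (1 - x) * (A l `^ x * b l `^ (1 - x)))).
  apply: ler_sum => l _; apply: le_trans (Smono l) _.
  by rewrite BE -/x mulrCA.
rewrite -mulr_sumr.
apply: (@le_trans _ _ (M `^ (1 - x) * M `^ x)); last first.
  have /andP[x0 x1] := x01.
  by rewrite -powRD_ge0 ?subr_ge0// subrK powRr1// ltW.
apply: ler_wpM2l; first exact: powR_ge0.
apply: le_trans (sum_hoelder xpredT A0 b0 x01) _.
have /andP[x0 x1] := x01.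
rewrite -[leRHS]mulr1; apply: ler_pM; rewrite ?powR_ge0//.
  by apply: powR_le => //; exact: sumr_ge0.
apply: powR_le1 => //; [by rewrite subr_ge0|exact: sumr_ge0].
Qed.

End Diagonal.

Section Box.
Context {m : nat}.

Definition box (n : nat) : seq {ffun 'I_m -> nat} :=
  [seq [ffun j => val (i j)] | i : {ffun 'I_m -> 'I_n} <- enum {: {ffun 'I_m -> 'I_n}}].

Lemma sum_box (R : nmodType) (F : {ffun 'I_m -> nat} -> R) n :
  \sum_(a <- box n) F a = \sum_(i : {ffun 'I_m -> 'I_n}) F [ffun j => val (i j)].
Proof. by rewrite big_map big_enum. Qed.

Lemma mem_box a n : (a \in box n) = [forall j, a j < n]%N.
Proof.
apply/mapP/forallP => [[i _ ->] j|an]; first by rewrite ffunE ltn_ord.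
exists [ffun j => Ordinal (an j)]; first by rewrite mem_enum.
by apply/ffunP => j; rewrite !ffunE.
Qed.

Lemma box_cover a : exists n, a \in box n.
Proof.
exists (\max_j a j).+1; rewrite mem_box; apply/forallP => j.
by rewrite ltnS leq_bigmax.
Qed.

Lemma sum_subseq_le (R : numDomainType) (I : eqType) (s t : seq I) (f : I -> R) :
  (forall a, 0 <= f a) -> uniq s -> {subset s <= t} ->
  \sum_(a <- s) f a <= \sum_(a <- t) f a.
Proof.
move=> f0; elim: s t => [|a s IH] t /=; first by rewrite big_nil sumr_ge0.
move=> /andP[as_ us] st; have at_ : a \in t by apply: st; rewrite mem_head.
rewrite big_cons (big_rem a at_)/= lerD2l; apply: IH => // b bs.
have : b \in a :: rem a t by rewrite -(perm_mem (perm_to_rem at_)) st// inE bs orbT.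
rewrite inE => /orP[/eqP ba|//]; by rewrite -ba bs in as_.
Qed.

Lemma sum_box_mono (R : numDomainType) (f : {ffun 'I_m -> nat} -> R) :
  (forall a, 0 <= f a) ->
  forall n i, (n <= i)%N -> \sum_(a <- box n) f a <= \sum_(a <- box i) f a.
Proof.
move=> f0 n i ni; apply: sum_subseq_le => //.
  rewrite map_inj_uniq ?enum_uniq// => a b /ffunP ab; apply/ffunP => j.
  by apply: val_inj; have := ab j; rewrite !ffunE.
move=> a; rewrite !mem_box => /forallP an; apply/forallP => j.
exact: leq_trans (an j) ni.
Qed.

End Box.

(** * Multilinear multipliers into l_2 of multi-indices *)

Section MultiplierOperator.
Context {R : realType} {K : numFieldType} {re : K -> R} (hK : scalar_field re)
  (e : scalar_embedding re) (u : R) (u1 : 1 <= u) (two1 : 1 <= (2 : R)).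
Context {m : nat} (k0 : 'I_m) (w : {ffun 'I_m -> nat} -> R).
Local Notation rnorm := (rnorm re).
Local Notation ellu := (ell hK e u1 iota_cover : completeNormedModType K).
Local Notation ell2 := (ell hK e two1 (@box_cover m) : completeNormedModType K).
Local Notation nval i := [ffun j => val (i j)].
Context (r p : R) (r0 : 0 < r) (p0 : 0 < p).
Hypothesis w0 : forall i, 0 <= w i.

Definition diagonal_bound := forall (mu : nat -> R) (M : R) N (z : 'I_N -> ellu) n,
  (forall c, 0 <= mu c) -> 0 < M -> \sum_(c < n) mu c `^ r <= M ->
  weak_bounded re p z ->
  \sum_l (\sum_(c < n) (mu c * rnorm (sval (z l) c : K^o)) `^ 2) `^ (r / 2) <= M.

(** [mu] is the multiplier of a diagonal operator that dominates, in l_2, the operator with all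
    variables but k frozen at x; [g] stands for the moduli of the free coordinates. *)
Definition fiber_multiplier (k : 'I_m) (x : 'I_m -> ellu) (mu : nat -> R) :=
  forall (g : nat -> R) n, (forall c, 0 <= g c) ->
  \sum_(i : {ffun 'I_m -> 'I_n})
    (w (nval i) * (\prod_(j | j != k) rnorm (sval (x j) (i j) : K^o)) * g (i k)) ^+ 2
  <= \sum_(c < n) (mu c * g c) ^+ 2.

Hypothesis diag : diagonal_bound.
Hypothesis fib : forall (k : 'I_m) (x : 'I_m -> ellu), exists mu : nat -> R, exists2 M : R,
  [/\ (forall c, 0 <= mu c), 0 < M & forall n, \sum_(c < n) mu c `^ r <= M] &
  fiber_multiplier k x mu.

Definition multiplier_fun (x : 'I_m -> ellu) (i : {ffun 'I_m -> nat}) : K :=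
  e (w i) * \prod_j sval (x j) (i j).

Lemma multiplier_dfwith x k v i : multiplier_fun (dfwith x k v) i =
  e (w i) * (\prod_(j | j != k) sval (x j) (i j)) * sval v (i k).
Proof.
rewrite /multiplier_fun (bigD1 k)//= dfwithin mulrA mulrAC; congr (_ * _ * _).
apply: eq_bigr => j jk.
by rewrite dfwithout// eq_sym.
Qed.

Lemma multiplier_fiber k x : exists2 M, 0 < M &
  forall N (z : 'I_N -> ellu), weak_bounded re p z ->
  forall n, \sum_l snorm re 2 box n (multiplier_fun (dfwith x k (z l))) `^ r <= M.
Proof.
have [mu [M [mu0 M0 muM] Hmu]] := fib k x.
exists M => // N z hz n; apply: le_trans (diag mu0 M0 (muM n) hz).
apply: ler_sum => l _.
rewrite /snorm -powRrM [2^-1 * r]mulrC; apply: powR_le.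
- by rewrite divr_ge0 ?(ltW r0).
- by apply: sumr_ge0 => a _; exact: powR_ge0.
have hg c : 0 <= rnorm (sval (z l) c : K^o) := rnorm_ge0 e _.
have := Hmu (fun c => rnorm (sval (z l) c : K^o)) n hg.
have E (c : 'I_n) : (mu c * rnorm (sval (z l) c : K^o)) `^ 2 =
    (mu c * rnorm (sval (z l) c : K^o)) ^+ 2.
  by rewrite powR_mulrn// mulr_ge0.
rewrite [in X in _ -> X](eq_bigr _ (fun c _ => E c)); apply: le_trans.
rewrite sum_box; apply: ler_sum => i _.
rewrite (powR_mulrn 2 (rnorm_ge0 e _)) multiplier_dfwith !(rnormM e) (rnorm_emb e).
rewrite (ger0_norm (w0 _)) ffunE.
have -> : rnorm (\prod_(j | j != k) sval (x j) ((nval i : {ffun 'I_m -> nat}) j) : K^o) =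
    \prod_(j | j != k) rnorm (sval (x j) (i j) : K^o).
  apply: (big_ind2 (fun (a : K) b => rnorm (a : K^o) = b)).
  - by rewrite -(rmorph1 e) (rnorm_emb e) normr1.
  - by move=> a1 b1 a2 b2 <- <-; rewrite (rnormM e).
  - by move=> j _; rewrite ffunE.
exact: lexx.
Qed.

(** Membership in l_2 already follows from the summing estimate, applied to the one-term family made
    of x k0 scaled into the unit ball. *)
Lemma multiplier_bounded x : ell_bounded re 2 box (multiplier_fun x).
Proof.
have [M M0 HM] := multiplier_fiber k0 x.
(* Adding 1 avoids division by 0 when x k0 = 0; the scaling is undone by homogeneity. *)
pose c := (rnorm (x k0) + 1)^-1.
have n0 : 0 < rnorm (x k0) + 1 by rewrite ltr_wpDl// (rnorm_ge0 e).
have c0 : 0 < c by rewrite invr_gt0.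
have z1 : rnorm (e c *: x k0) <= 1.
  by rewrite (rnormZr e) gtr0_norm// mulrC ler_pdivrMr// mul1r lerDl.
have hz : weak_bounded re p (fun _ : 'I_1 => e c *: x k0).
  move=> phi hphi; rewrite big_ord1; apply: powR_le1; rewrite ?(ltW p0) ?(rnorm_ge0 e)//.
  exact: le_trans (dual_ball_le e _ hphi) z1.
have b : ell_bounded re 2 box (multiplier_fun (dfwith x k0 (e c *: x k0))).
  exists (M `^ r^-1) => n; have := HM _ _ hz n; rewrite big_ord1 => h.
  have := powR_le (_ : 0 <= r^-1) (powR_ge0 _ _) h.
  by rewrite powRK ?snorm_ge0 ?gt_eqF// => -> //; rewrite invr_ge0 ltW.
suff -> : multiplier_fun x =
    (fun i => e c^-1 * multiplier_fun (dfwith x k0 (e c *: x k0)) i).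
  exact: ell_boundedZ.
apply/funext => i; rewrite multiplier_dfwith ell_valZ.
have cc : e c^-1 * e c = 1 by rewrite -rmorphM mulVf ?gt_eqF// rmorph1.
have E (a d : K) : e c^-1 * (a * (e c * d)) = a * d.
  by rewrite mulrCA [e c^-1 * _]mulrA cc mul1r.
by rewrite E /multiplier_fun (bigD1 k0)//= [sval _ _ * _]mulrC mulrA.
Qed.

Definition multiplier_operator (x : 'I_m -> ellu) : ell2 :=
  exist _ _ (multiplier_bounded x).

Lemma multiplier_multilinear : multilinear (multiplier_operator : (forall j, ellu) -> ell2).
Proof.
move=> k x a v v'; apply: ell_eq => i.
rewrite ell_valD ell_valZ /= !multiplier_dfwith ell_valD ell_valZ.
by rewrite mulrDr [a * (_ * _)]mulrCA.
Qed.

Lemma multiplier_separately_summing :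
  separately_summing re r p (multiplier_operator : (forall j, ellu) -> ell2).
Proof.
move=> k x; have [M M0 HM] := multiplier_fiber k x.
apply: (finite_summing hK e (u := partial_map multiplier_multilinear k x) (C := M) r0 p0).
move=> N z hz; apply: (sum_sup_le (F := fun n l =>
    snorm re 2 box n (multiplier_fun (dfwith x k (z l))) `^ r)).
- move=> l n i ni; apply: powR_le; rewrite ?(ltW r0) ?snorm_ge0//.
  exact: (snorm_mono two1 (@sum_box_mono m R)).
- move=> l b h; have b0 : 0 <= b := le_trans (powR_ge0 _ _) (h 0%N).
  rewrite -(powRVK b0 (lt0r_neq0 r0)); apply: powR_le; rewrite ?(ltW r0) ?(rnorm_ge0 e)//.
  rewrite rnorm_ell; apply: ell_norm_le => n /=.
  apply: (powR_leK r0 (snorm_ge0 _ _ _ _ _) (powR_ge0 _ _)).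
  rewrite [leRHS](powRVK b0 (lt0r_neq0 r0)); exact: h.
exact: (HM _ _ hz).
Qed.

(** On the unit vectors with indices i_1, ..., i_m the value has i-th coordinate w_i, so its norm is
    at least w_i. Truncating each sequence after n vectors keeps its weak norm below W n. *)
Lemma multiplier_not_summing (s : R) (W : nat -> R) : 0 < s -> (forall n, 0 <= W n) ->
  (forall n, weak_norm re p (fun a => if (a < n)%N then unit_vector hK e u1 a else (0%R : ellu))
    <= (W n)%:E)%E ->
  multiple_summing re s (fun=> p) (multiplier_operator : (forall j, ellu) -> ell2) ->
  exists2 C, 0 < C & forall n,
    \sum_(i : {ffun 'I_m -> 'I_n}) w (nval i) `^ s <= (C * W n ^+ m) `^ s.
Proof.
move=> s0 W0 HW [C C0 H]; exists C => // n.
pose y := fun (j : 'I_m) (a : nat) => if (a < n)%N then unit_vector hK e u1 a else (0 : ellu).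
have := H y.
have le : (C%:E * \prod_(j < m) weak_norm re p (y j) <= (C * W n ^+ m)%:E)%E.
  rewrite EFinM; apply: lee_wpmul2l; first by rewrite lee_fin ltW.
  have -> : (W n ^+ m)%:E = (\prod_(j < m) (W n)%:E)%E.
    by rewrite prodEFin prodr_const card_ord.
  have : (0 <= \prod_(j < m) weak_norm re p (y j) <= \prod_(j < m) (W n)%:E)%E.
    apply: (big_ind2 (fun a b : \bar R => 0 <= a <= b)%E).
    - by rewrite lexx lee_fin ler01.
    - move=> a1 b1 a2 b2 /andP[a10 ab1] /andP[a20 ab2].
      by rewrite mule_ge0//= lee_pmul.
    - by move=> j _; rewrite HW andbT (weak_norm_ge0 hK).
  by case/andP.
move/le_trans/(_ le); rewrite poweR_le_fin//; last 2 first.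
- by apply: esum_ge0 => i _; rewrite lee_fin powR_ge0.
- by rewrite mulr_ge0 ?(ltW C0) ?exprn_ge0.
move/(esum_box_le _ (fun i => powR_ge0 _ _)).1 => /(_ n); apply: le_trans.
apply: ler_sum => i _; apply: powR_le; rewrite ?(ltW s0)// rnorm_ell.
apply: le_trans (ell_coord_le _ (nval i)) => /=.
rewrite /multiplier_fun big1 => [|j _].
  by rewrite mulr1 (rnorm_emb e) ger0_norm.
by rewrite !ffunE /y ltn_ord unit_vectorE eqxx.
Qed.

End MultiplierOperator.

(** The values of phi on the unit vectors form an element of the unit ball of l_v with v = u^*.
    Hölder over n terms from v down to p costs n^(1/p - 1/v), and p <= v is the hypothesis p (1 -
    1/u) <= 1. *)
Lemma unit_vector_weak_norm (R : realType) (K : numFieldType) (re : K -> R)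
    (hK : scalar_field re) (e : scalar_embedding re) (u : R) (u1 : 1 <= u) (p : R) n :
  1 < u -> 0 < p -> p * (1 - u^-1) <= 1 ->
  (weak_norm re p (fun a => if (a < n)%N then unit_vector hK e u1 a else 0%R)
    <= (n%:R `^ (p^-1 - 1 + u^-1))%:E)%E.
Proof.
move=> u1' p0 pu; have u0 : 0 < u := lt_trans ltr01 u1'.
have d0 : 0 <= p^-1 - 1 + u^-1.
  have -> : p^-1 - 1 + u^-1 = p^-1 - (1 - u^-1) by ring.
  by rewrite subr_ge0 -[leRHS]mul1r ler_pdivlMr// mulrC.
apply: (weak_norm_le _ p0 (powR_ge0 _ _)).2 => phi hphi N.
pose z a := rnorm re (phi (unit_vector hK e u1 a)).
have z0 a : 0 <= z a := rnorm_ge0 e _.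
apply: (@le_trans _ _ (\sum_(a < n) z a `^ p)).
  pose G a := if (a < n)%N then z a `^ p else 0.
  have G0 a : 0 <= G a by rewrite /G; case: ifP => // _; exact: powR_ge0.
  have -> : \sum_(i < N) rnorm re (phi (if (i < n)%N then unit_vector hK e u1 i else 0)) `^ p
      = \sum_(0 <= a < N) G a.
    rewrite big_mkord; apply: eq_bigr => a _; rewrite /G; case: ifP => // _.
    by rewrite linear0 (rnorm0 e) powR0// gt_eqF.
  have -> : \sum_(a < n) z a `^ p = \sum_(0 <= a < n) G a.
    by rewrite big_mkord; apply: eq_bigr => a _; rewrite /G ltn_ord.
  have [Nn|nN] := leqP N n.
    by rewrite [leRHS](big_cat_nat (n := N))//= lerDl sumr_ge0.
  rewrite [leLHS](big_cat_nat (n := n)) ?(ltnW nN)//= gerDl.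
  by rewrite big_nat big1// => a /andP[na _]; rewrite /G ltnNge na.
have v1 : 0 < 1 - u^-1 by rewrite subr_gt0 invf_lt1.
have y01 : 0 <= p * (1 - u^-1) <= 1 by rewrite pu mulr_ge0 ?(ltW p0) ?(ltW v1).
have E (a : 'I_n) : z a `^ p =
    (z a `^ (1 - u^-1)^-1) `^ (p * (1 - u^-1)) * 1 `^ (1 - p * (1 - u^-1)).
  by rewrite powR1 mulr1 -powRrM mulrCA mulVf ?mulr1// gt_eqF.
rewrite (eq_bigr _ (fun a _ => E a)).
apply: le_trans (sum_hoelder xpredT (fun a : 'I_n => powR_ge0 (z a) _)
  (fun _ : 'I_n => ler01) y01) _.
have -> : \sum_(i < n) (1 : R) = n%:R by rewrite sumr_const card_ord.
rewrite -powRrM -[leRHS]mul1r.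
have -> : (p^-1 - 1 + u^-1) * p = 1 - p * (1 - u^-1) by field; rewrite !gt_eqF.
apply: ler_wpM2r; first exact: powR_ge0.
case/andP: y01 => y0 _; apply: (powR_le1 y0); last exact: unit_vector_dual.
by apply: sumr_ge0 => a _; exact: powR_ge0.
Qed.

(** * Optimality *)

Section PowerWeights.
Context {R : realType}.

Lemma powRN_le (a b r : R) : 0 <= r -> 0 < a -> a <= b -> b `^ (- r) <= a `^ (- r).
Proof.
move=> r0 a0 ab; rewrite !powRN lef_pV2 ?posrE ?powR_gt0//; last exact: lt_le_trans ab.
exact: powR_le r0 (ltW a0) ab.
Qed.

Lemma powR_exprn (a r : R) n : (a `^ r) ^+ n = a `^ (r * n%:R).
Proof. by rewrite -powR_mulrn ?powR_ge0// -powRrM. Qed.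

(* Grouping the terms of even index with their successors gives
   S_(2n+1) <= 1 + 2^-h * S_n for the partial sums of the p-series. *)
Lemma p_series_bounded (h : R) : 0 < h ->
  exists Z, forall n, \sum_(c < n) c.+1%:R `^ (- (1 + h)) <= Z.
Proof.
move=> h0; pose f c : R := c.+1%:R `^ (- (1 + h)); pose q : R := 2 `^ (- h).
have f0 c : 0 <= f c by exact: powR_ge0.
have h1 : 0 <= 1 + h by rewrite addr_ge0// ltW.
have q1 : q < 1.
  rewrite /q powRN invf_lt1 ?powR_gt0//.
  have : 1 `^ h < 2 `^ h by apply: gt0_ltr_powR; rewrite ?nnegrE// ltr1n.
  by rewrite powR1.
have fq n : f n.*2.+1 + f n.*2.+2 <= q * f n.
  have fn : f n.*2.+1 = 2 `^ (- (1 + h)) * f n.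
    by rewrite /f -powRM// -natrM mul2n doubleS.
  have -> : q = 2 * 2 `^ (- (1 + h)).
    rewrite opprD powRD ?pnatr_eq0 ?implybT// powR_inv1//.
    by rewrite mulrA mulfV ?mul1r// pnatr_eq0.
  rewrite -mulrA -fn mulr_natl mulr2n lerD2l.
  by apply: powRN_le => //; rewrite ler_nat.
have S n : \sum_(c < n.*2.+1) f c <= 1 + q * \sum_(c < n) f c.
  elim: n => [|n IH].
    by rewrite big_ord0 mulr0 addr0 double0 big_ord1 /f powR1.
  rewrite doubleS 2!big_ord_recr/= [in leRHS]big_ord_recr/= mulrDr addrA -addrA.
  exact: lerD (IH) (fq n).
exists (1 - q)^-1 => n; rewrite -[leRHS]mul1r ler_pdivlMr ?subr_gt0//.
rewrite mulrBr mulr1 lerBlDr mulrC; apply: le_trans (S n).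
rewrite -!(big_mkord xpredT f) [leRHS](big_cat_nat (n := n))//= ?lerDl ?sumr_ge0//.
by rewrite -addnn ltnW// ltnS leq_addr.
Qed.

Lemma powR_unbounded (C h : R) : 0 < h -> exists2 n, (0 < n)%N & C < n%:R `^ h.
Proof.
move=> h0; exists (Num.truncn (`|C| `^ h^-1)).+1 => //.
apply: le_lt_trans (ler_norm C) _.
rewrite -[ltLHS](powRVK (normr_ge0 C) (lt0r_neq0 h0)).
by apply: gt0_ltr_powR; rewrite ?nnegrE ?powR_ge0 ?ler0n// truncnS_gt.
Qed.

End PowerWeights.

(** * Weights decaying with the largest index *)

Section Counterexamples.
Context {R : realType} {K : numFieldType} {re : K -> R} (hK : scalar_field re)
  (e : scalar_embedding re) (u : R) (u1 : 1 <= u).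
Context {m : nat} (k0 : 'I_m).
Local Notation rnorm := (rnorm re).
Local Notation ellu := (ell hK e u1 iota_cover : completeNormedModType K).
Local Notation nval i := [ffun j => val (i j)].

Lemma diagonal_boundP (r p : R) : 1 <= p <= 2 -> p <= r -> p^-1 - 2^-1 <= r^-1 ->
  r <= 2 \/ u^-1 = 1 - p^-1 -> diagonal_bound hK e u1 r p.
Proof.
move=> /andP[p1 p2] pr prV h mu M N z n mu0 M0 muM hz.
have [r2|r2] := leP r 2; first exact: (diagonal_small p1).
case: h => [|uE]; first by rewrite leNgt r2.
exact: (diagonal_large p1).
Qed.

Lemma multiplier_counterexample (w : {ffun 'I_m -> nat} -> R) (r p s : R) :
  0 < r -> 0 < p -> 0 < s -> (forall i, 0 <= w i) ->
  1 < u -> p * (1 - u^-1) <= 1 -> diagonal_bound hK e u1 r p ->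
  (forall (k : 'I_m) (x : 'I_m -> ellu), exists mu : nat -> R, exists2 M : R,
    [/\ (forall c, 0 <= mu c), 0 < M & forall n, \sum_(c < n) mu c `^ r <= M] &
    fiber_multiplier w k x mu) ->
  (forall C, 0 < C -> exists n, (C * (n%:R `^ (p^-1 - 1 + u^-1)) ^+ m) `^ s <
    \sum_(i : {ffun 'I_m -> 'I_n}) w (nval i) `^ s) ->
  exists (X : 'I_m -> completeNormedModType K) (Y : completeNormedModType K)
    (T : (forall j, X j) -> Y),
    [/\ cotype re 2 Y, multilinear T, separately_summing re r p T
      & ~ multiple_summing re s (fun=> p) T].
Proof.
move=> r0 p0 s0 w0 u1' pu diag fib big.
have two1 : 1 <= (2 : R) by rewrite ler1n.
exists (fun _ : 'I_m => ellu), (ell hK e two1 (@box_cover m) : completeNormedModType K).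
exists (multiplier_operator two1 k0 r0 p0 w0 diag fib); split.
- by apply: ell2_cotype; exact: sum_box_mono.
- exact: multiplier_multilinear.
- exact: multiplier_separately_summing.
have W0 n : 0 <= n%:R `^ (p^-1 - 1 + u^-1) by exact: powR_ge0.
move=> /(multiplier_not_summing s0 W0 (fun n => unit_vector_weak_norm hK e u1 n u1' p0 pu)).
by case=> C C0 HC; have [n] := big C C0; rewrite ltNge HC.
Qed.

Lemma ell_sum_bounded (x : ellu) n :
  \sum_(c < n) rnorm (sval x c : K^o) `^ u <= rnorm x `^ u.
Proof.
have u0 : 0 < u := lt_le_trans ltr01 u1.
have h : snorm re u (iota 0) n (sval x) <= rnorm x by rewrite rnorm_ell; exact: snorm_le_ell.
have := powR_le (ltW u0) (snorm_ge0 _ _ _ _ _) h.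
rewrite [leLHS](powRVK (sum_rnorm_ge0 _ _ _ _) (lt0r_neq0 u0)).
by rewrite -(big_mkord xpredT (fun c => rnorm (sval x c : K^o) `^ u)) /index_iota subn0.
Qed.

Definition max_weight (g : R) (i : {ffun 'I_m -> nat}) : R :=
  (\max_j i j).+1%:R `^ (- g).

(** The maximum dominates each coordinate, so its negative power can be distributed: a goes to
    coordinate k and b to each of the m - 1 others. *)
Lemma max_weight_prod (a b : R) k (i : {ffun 'I_m -> nat}) : 0 <= a -> 0 <= b ->
  max_weight (a + m.-1%:R * b) i <=
  (i k).+1%:R `^ (- a) * \prod_(j | j != k) (i j).+1%:R `^ (- b).
Proof.
move=> a0 b0; rewrite /max_weight; set X := (\max_j i j).+1%:R.
have Xi j : (i j).+1%:R <= X :> R by rewrite ler_nat ltnS leq_bigmax.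
have -> : X `^ (- (a + m.-1%:R * b)) = X `^ (- a) * \prod_(j | j != k) X `^ (- b).
  rewrite prodr_const cardC1 card_ord powR_exprn -powRD ?pnatr_eq0 ?implybT//.
  by rewrite opprD mulNr mulrC [b * _]mulrC mulrC.
apply: ler_pM; rewrite ?powR_ge0 ?prodr_ge0//.
- by move=> j _; exact: powR_ge0.
- exact: powRN_le.
apply: ler_prod => j _; rewrite powR_ge0 /=; exact: powRN_le.
Qed.

(** The exponent adds up what each variable requires, indices counted from 1: c^(-(1 + h)/r) lies in
    l_r for the free variable, and c^(-b) with b = (1 + h)(1/2 - 1/u) carries l_u into l_2 for each
    frozen one, by Hölder. Both rest on convergence of the p-series with exponent 1 + h. *)
Lemma max_weight_fiber (r h : R) k (x : 'I_m -> ellu) : 0 < r -> 0 < h -> 2 <= u ->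
  exists mu : nat -> R, exists2 M : R,
    [/\ (forall c, 0 <= mu c), 0 < M & forall n, \sum_(c < n) mu c `^ r <= M] &
    fiber_multiplier
      (max_weight ((1 + h) / r + m.-1%:R * ((1 + h) * (2^-1 - u^-1)))) k x mu.
Proof.
move=> r0 h0 u2; have [Z HZ] := p_series_bounded h0.
have u0 : 0 < u := lt_le_trans ltr01 u1.
have h1 : 0 <= 1 + h by rewrite addr_ge0// ltW.
have uV : u^-1 <= 2^-1 by rewrite lef_pV2 ?posrE.
set a := (1 + h) / r; set b := (1 + h) * (2^-1 - u^-1).
have a0 : 0 <= a by rewrite divr_ge0// ltW.
have b0 : 0 <= b by rewrite mulr_ge0 ?subr_ge0.
have Z0 : 0 <= Z by apply: le_trans (HZ 0%N); rewrite big_ord0.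
pose Q j := Z `^ (1 - 2 * u^-1) * (rnorm (x j) `^ u) `^ (2 * u^-1).
have Q0 j : 0 <= Q j by rewrite mulr_ge0 ?powR_ge0.
pose q := Num.sqrt (\prod_(j | j != k) Q j).
have q0 : 0 <= q by exact: sqrtr_ge0.
have HQ j n : \sum_(c < n) (c.+1%:R `^ (- b) * rnorm (sval (x j) c : K^o)) ^+ 2 <= Q j.
  have y01 : 0 <= 1 - 2 * u^-1 <= 1.
    by rewrite subr_ge0 -ler_pdivlMl// mulr1 uV gerBl mulr_ge0 ?invr_ge0 ?(ltW u0).
  have E (c : 'I_n) : (c.+1%:R `^ (- b) * rnorm (sval (x j) c : K^o)) ^+ 2 =
      (c.+1%:R `^ (- (1 + h))) `^ (1 - 2 * u^-1) *
      (rnorm (sval (x j) c : K^o) `^ u) `^ (1 - (1 - 2 * u^-1)).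
    rewrite exprMn powR_exprn -!powRrM subKr; congr (_ `^ _ * _).
      by rewrite /b; field; rewrite gt_eqF.
    by rewrite [u * _]mulrCA mulfV ?gt_eqF// mulr1 powR_mulrn ?(rnorm_ge0 e).
  rewrite (eq_bigr _ (fun c _ => E c)).
  apply: le_trans (sum_hoelder xpredT (fun c : 'I_n => powR_ge0 c.+1%:R (- (1 + h)))
    (fun c : 'I_n => powR_ge0 (rnorm (sval (x j) c : K^o)) u) y01) _.
  have [y0 _] := andP y01.
  rewrite subKr; apply: ler_pM; rewrite ?powR_ge0//.
    apply: (powR_le y0 _ (HZ n)); apply: sumr_ge0 => c _; exact: powR_ge0.
  apply: (powR_le _ _ (ell_sum_bounded (x j) n)).
    by rewrite mulr_ge0 ?invr_ge0 ?(ltW u0).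
  by apply: sumr_ge0 => c _; exact: powR_ge0.
exists (fun c => q * c.+1%:R `^ (- a)), (q `^ r * Z + 1).
  split=> [c||n]; first by rewrite mulr_ge0 ?powR_ge0.
    by rewrite ltr_wpDl// mulr_ge0 ?powR_ge0.
  have E (c : 'I_n) : (q * c.+1%:R `^ (- a)) `^ r = q `^ r * c.+1%:R `^ (- (1 + h)).
    by rewrite powRM ?powR_ge0// -powRrM mulNr /a divfK ?gt_eqF.
  rewrite (eq_bigr _ (fun c _ => E c)) -mulr_sumr.
  by rewrite ler_wpDr// ler_wpM2l ?powR_ge0 ?HZ.
move=> g n g0.
(* The dominating array is a product of functions of one index each, so its sum over multi-indices
   factors. *)
pose F (j : 'I_m) (c : 'I_n) : R := if j == k then (c.+1%:R `^ (- a) * g c) ^+ 2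
  else (c.+1%:R `^ (- b) * rnorm (sval (x j) c : K^o)) ^+ 2.
have F0 j c : 0 <= F j c by rewrite /F; case: ifP => _; exact: sqr_ge0.
apply: (@le_trans _ _ (\sum_(i : {ffun 'I_m -> 'I_n}) \prod_j F j (i j))).
  apply: ler_sum => i _.
  have -> : \prod_j F j (i j) = ((i k).+1%:R `^ (- a) *
      (\prod_(j | j != k) (i j).+1%:R `^ (- b)) *
      (\prod_(j | j != k) rnorm (sval (x j) (i j) : K^o)) * g (i k)) ^+ 2.
    rewrite (bigD1 k)//= {1}/F eqxx.
    have -> : \prod_(j | j != k) F j (i j) = (\prod_(j | j != k)
        ((i j).+1%:R `^ (- b) * rnorm (sval (x j) (i j) : K^o))) ^+ 2.
      by rewrite -prodrXl; apply: eq_bigr => j /negbTE jk; rewrite /F jk.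
    by rewrite big_split/=; ring.
  have P0 : 0 <= \prod_(j | j != k) rnorm (sval (x j) (i j) : K^o).
    by apply: prodr_ge0 => j _; exact: (rnorm_ge0 e).
  have wi := max_weight_prod k (nval i) a0 b0.
  have w0 : 0 <= max_weight (a + m.-1%:R * b) (nval i) by exact: powR_ge0.
  rewrite ffunE in wi.
  have E : \prod_(j | j != k) ((nval i : {ffun 'I_m -> nat}) j).+1%:R `^ (- b) =
      \prod_(j | j != k) (i j).+1%:R `^ (- b) :> R.
    by apply: eq_bigr => j _; rewrite ffunE.
  rewrite E in wi.
  apply: lerXn2r; rewrite ?nnegrE.
  - by rewrite !mulr_ge0.
  - by rewrite !mulr_ge0// ?powR_ge0// prodr_ge0// => j _; exact: powR_ge0.
  by rewrite ler_wpM2r// ler_wpM2r.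
rewrite -(bigA_distr_bigA F) (bigD1 k)//=.
have -> : \sum_(c < n) (q * c.+1%:R `^ (- a) * g c) ^+ 2 =
    (\sum_(c < n) F k c) * \prod_(j | j != k) Q j.
  rewrite mulr_suml; apply: eq_bigr => c _.
  by rewrite /F eqxx -mulrA exprMn sqr_sqrtr ?prodr_ge0// mulrC.
apply: ler_wpM2l; first exact: sumr_ge0.
apply: ler_prod => j jk; rewrite sumr_ge0//=.
by apply: le_trans (HQ j n); rewrite /F (negbTE jk).
Qed.

Lemma max_weight_sum_ge (g s : R) n : 0 <= g -> 0 <= s -> (0 < n)%N ->
  n%:R `^ (m%:R - g * s) <=
  \sum_(i : {ffun 'I_m -> 'I_n}) max_weight g (nval i) `^ s.
Proof.
move=> g0 s0 n0.
apply: (@le_trans _ _ (\sum_(i : {ffun 'I_m -> 'I_n}) n%:R `^ (- (g * s)))).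
  rewrite sumr_const card_ffun !card_ord -[leRHS]mulr_natl natrX -powR_mulrn ?ler0n//.
  by rewrite -powRD ?pnatr_eq0 -?lt0n ?n0 ?implybT.
apply: ler_sum => i _; rewrite /max_weight -powRrM mulNr.
apply: powRN_le; rewrite ?mulr_ge0 ?ltr0n// ler_nat.
case: n n0 i => // n _ i; rewrite ltnS.
by apply/bigmax_leqP => j _; rewrite ffunE -ltnS ltn_ord.
Qed.

End Counterexamples.

Lemma powR_prod (R : realType) (I : finType) (P : pred I) (f : I -> R) r :
  (forall i, 0 <= f i) -> (\prod_(i | P i) f i) `^ r = \prod_(i | P i) f i `^ r.
Proof.
move=> f0; suff [] : 0 <= \prod_(i | P i) f i /\
    (\prod_(i | P i) f i) `^ r = \prod_(i | P i) f i `^ r by [].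
apply: (big_rec2 (fun a b => 0 <= a /\ a `^ r = b)); first by rewrite powR1.
by move=> i a b _ [a0 <-]; rewrite mulr_ge0// powRM.
Qed.

(** * Weights supported on the diagonal *)

Section DiagonalWeight.
Context {R : realType} {K : numFieldType} {re : K -> R} (hK : scalar_field re)
  (e : scalar_embedding re) (u : R) (u1 : 1 <= u).
Context {m : nat} (k0 : 'I_m).
Local Notation rnorm := (rnorm re).
Local Notation ellu := (ell hK e u1 iota_cover : completeNormedModType K).
Local Notation nval i := [ffun j => val (i j)].

Definition diagonal_weight (g : R) (i : {ffun 'I_m -> nat}) : R :=
  if [forall j, i j == i k0] then (i k0).+1%:R `^ (- g) else 0.

Lemma sum_diagonal n (F : {ffun 'I_m -> 'I_n} -> R) (k : 'I_m) :
  (forall i : {ffun 'I_m -> 'I_n}, ~~ [forall j, i j == i k0] -> F i = 0) ->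
  \sum_i F i = \sum_(c < n) F [ffun=> c].
Proof.
move=> F0; rewrite (partition_big (fun i : {ffun 'I_m -> 'I_n} => i k) xpredT)//=.
apply: eq_bigr => c _; rewrite (bigD1 [ffun=> c])/= ?ffunE//.
rewrite big1 ?addr0// => i /andP[/eqP ic ni]; apply: F0; apply: contra ni => /forallP ik.
by apply/eqP/ffunP => j; rewrite ffunE (eqP (ik j)) -ic (eqP (ik k)).
Qed.

Lemma diagonal_weight_out n g (i : {ffun 'I_m -> 'I_n}) :
  ~~ [forall j, i j == i k0] -> diagonal_weight g (nval i) = 0.
Proof.
move=> h; rewrite /diagonal_weight; case: ifP => // /forallP ik.
case/negP: h; apply/forallP => j; have := ik j; by rewrite !ffunE.
Qed.

Lemma diagonal_weight_in n g (c : 'I_n) :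
  diagonal_weight g (nval ([ffun=> c] : {ffun 'I_m -> 'I_n})) = c.+1%:R `^ (- g).
Proof.
rewrite /diagonal_weight !ffunE; case: ifP => // /negP[]; apply/forallP => j.
by rewrite !ffunE.
Qed.

(** Here [mu] is the product of a sequence in l_s and m - 1 sequences in l_u, hence in l_r because
    1/r = 1/s + (m - 1)/u. Instead of Hölder, mu_c^r is bounded termwise by the sum S of the s-th
    power of the first factor and the u-th powers of the coordinates. *)
Lemma diagonal_weight_fiber (r s g : R) k (x : 'I_m -> ellu) :
  0 < r -> 0 < s -> 1 < g * s -> r^-1 = s^-1 + m.-1%:R * u^-1 ->
  exists mu : nat -> R, exists2 M : R,
    [/\ (forall c, 0 <= mu c), 0 < M & forall n, \sum_(c < n) mu c `^ r <= M] &
    fiber_multiplier (diagonal_weight g) k x mu.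
Proof.
move=> r0 s0 gs rE; have u0 : 0 < u := lt_le_trans ltr01 u1.
have h0 : 0 < g * s - 1 by rewrite subr_gt0.
have [Z HZ] := p_series_bounded h0.
have {}HZ n : \sum_(c < n) c.+1%:R `^ (- (g * s)) <= Z.
  by have := HZ n; rewrite [1 + _]addrC subrK.
have Z0 : 0 <= Z by apply: le_trans (HZ 0%N); rewrite big_ord0.
pose y (c : nat) j := rnorm (sval (x j) c : K^o).
have y0 c j : 0 <= y c j := rnorm_ge0 e _.
pose mu c := c.+1%:R `^ (- g) * \prod_(j | j != k) y c j.
exists mu, (Z + \sum_j rnorm (x j) `^ u + 1); last first.
  move=> f n f0; rewrite (sum_diagonal k) => [|i /diagonal_weight_out ->]; last first.
    by rewrite !mul0r expr0n.
  apply: ler_sum => c _; rewrite diagonal_weight_in !ffunE /mu /y.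
  rewrite le_eqVlt; apply/orP; left; apply/eqP; congr ((_ * _ * _) ^+ 2).
  by apply: eq_bigr => j _; rewrite ffunE.
have N0 : 0 <= \sum_j rnorm (x j) `^ u by apply: sumr_ge0 => j _; exact: powR_ge0.
split=> [c||n].
- by rewrite mulr_ge0 ?powR_ge0 ?prodr_ge0.
- by rewrite ltr_wpDl// addr_ge0.
apply: (@le_trans _ _ (\sum_(c < n) (c.+1%:R `^ (- (g * s)) + \sum_j y c j `^ u))).
  apply: ler_sum => c _; set S := (X in _ <= X).
  have S0 : 0 <= \sum_j y c j `^ u by apply: sumr_ge0 => j _; exact: powR_ge0.
  have Sj j : y c j `^ u <= S.
    rewrite /S (bigD1 j)//= addrCA lerDl addr_ge0 ?powR_ge0 ?sumr_ge0// => l _.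
    exact: powR_ge0.
  have Sc : c.+1%:R `^ (- (g * s)) <= S by rewrite lerDl.
  have SS : 0 <= S by apply: le_trans Sc; exact: powR_ge0.
  have -> : mu c `^ r = (c.+1%:R `^ (- (g * s))) `^ (r / s) *
      \prod_(j | j != k) (y c j `^ u) `^ (r / u).
    rewrite /mu powRM ?powR_ge0 ?prodr_ge0// -!powRrM; congr (_ `^ _ * _).
      by field; rewrite gt_eqF.
    rewrite (powR_prod _ r (y0 c)); apply: eq_bigr => j _; rewrite -powRrM; congr (_ `^ _).
    by field; rewrite gt_eqF.
  have -> : S = S `^ (r / s) * \prod_(j | j != k) S `^ (r / u).
    rewrite prodr_const cardC1 card_ord powR_exprn -powRD_ge0.
    - have -> : r / s + r / u * m.-1%:R = 1.
        have -> : r / s + r / u * m.-1%:R = r * (s^-1 + m.-1%:R * u^-1) by ring.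
        by rewrite -rE mulfV// gt_eqF.
      by rewrite powRr1.
    - by rewrite divr_ge0 ?(ltW r0) ?(ltW s0).
    - by rewrite mulr_ge0// divr_ge0 ?(ltW r0) ?(ltW u0).
  apply: ler_pM; rewrite ?powR_ge0//.
  - by apply: prodr_ge0 => j _; exact: powR_ge0.
  - by apply: powR_le Sc; rewrite ?powR_ge0// divr_ge0 ?(ltW r0) ?(ltW s0).
  apply: ler_prod => j _; rewrite powR_ge0/=.
  by apply: powR_le (Sj j); rewrite ?powR_ge0// divr_ge0 ?(ltW r0) ?(ltW u0).
rewrite big_split/= -addrA; apply: lerD (HZ n) _.
rewrite exchange_big/= ler_wpDr//; apply: ler_sum => j _; exact: ell_sum_bounded.
Qed.

Lemma diagonal_weight_sum_ge (g s : R) n : 0 <= g -> 0 < s -> (0 < n)%N ->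
  n%:R `^ (1 - g * s) <=
  \sum_(i : {ffun 'I_m -> 'I_n}) diagonal_weight g (nval i) `^ s.
Proof.
move=> g0 s0 n0; rewrite (sum_diagonal k0) => [|i /diagonal_weight_out ->]; last first.
  by rewrite powR0// gt_eqF.
apply: (@le_trans _ _ (\sum_(c < n) n%:R `^ (- (g * s)))).
  rewrite sumr_const card_ord -[leRHS]mulr_natl -[X in _ <= X * _]powRr1 ?ler0n//.
  by rewrite -powRD ?pnatr_eq0 -?lt0n ?n0 ?implybT.
apply: ler_sum => c _; rewrite diagonal_weight_in -powRrM mulNr.
by apply: powRN_le; rewrite ?mulr_ge0 ?(ltW s0)// ler_nat.
Qed.

End DiagonalWeight.

Section Optimality.
Context {R : realType} {K : numFieldType} {re : K -> R} (hK : scalar_field re).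
Context {m : nat} (m0 : (0 < m)%N).
Context (p r s : R) (p12 : 1 <= p <= 2) (pr : p <= r) (prV : p^-1 - 2^-1 <= r^-1)
  (s0 : 0 < s).
Local Notation rnorm := (rnorm re).

Let p1 : 1 <= p. Proof. by case/andP: p12. Qed.
Let p0 : 0 < p := lt_le_trans ltr01 p1.
Let r0 : 0 < r := lt_le_trans p0 pr.
Let k0 : 'I_m := Ordinal m0.
Let mR : 0 < m%:R :> R. Proof. by rewrite ltr0n. Qed.
Let mE : m.-1%:R = m%:R - 1 :> R. Proof. by rewrite -subn1 natrB. Qed.
Let c0 : 0 <= 1 - p^-1. Proof. by rewrite subr_ge0 invf_le1. Qed.
Let c2 : 1 - p^-1 <= 2^-1.
Proof.
rewrite lerBlDr -lerBlDl -[X in X - _](mulfV (_ : 2 != 0 :> R))//.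
have -> : 2 / 2 - 2^-1 = 2^-1 :> R by field.
by rewrite lef_pV2 ?posrE//; case/andP: p12.
Qed.

Local Notation counterexample :=
  (exists (X : 'I_m -> completeNormedModType K) (Y : completeNormedModType K)
    (T : (forall j, X j) -> Y),
    [/\ cotype re 2 Y, multilinear T, separately_summing re r p T
      & ~ multiple_summing re s (fun=> p) T]).

Lemma optimal_above : r <= 2 ->
  r^-1 + (m%:R - 1) * (2^-1 - (1 - p^-1)) < m%:R / s -> counterexample.
Proof.
move=> r2; set A := r^-1 + _ => As; have [e] := scalar_field_embedding hK.
have m1 : 0 <= m%:R - 1 :> R by rewrite -mE ler0n.
have A0 : 0 < A.
  by rewrite ltr_wpDr ?invr_gt0// mulr_ge0// subr_ge0.
(* A quarter of the gap: the weight exponent exceeds A by at most D and the weak norms of the test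
   vectors cost at most another D, against m/s = A + 4 D. *)
pose D := (m%:R / s - A) / 4; have D0 : 0 < D by rewrite divr_gt0// subr_gt0.
(* 1/u is positive even when p = 1. It exceeds 1/p^* by at most D/m, and it stays below 1/2 because
   u >= 2 is required. *)
pose uV := Num.min 2^-1 (1 - p^-1 + D / m%:R).
have Dm : 0 < D / m%:R by rewrite divr_gt0.
have uV0 : 0 < uV by rewrite lt_min invr_gt0 ltr0n ltr_wpDl.
have uV2 : uV <= 2^-1 by rewrite ge_min lexx.
have uVc : 1 - p^-1 <= uV by rewrite le_min c2 lerDl ltW.
have uVD : uV - (1 - p^-1) <= D / m%:R by rewrite lerBlDl ge_min lexx orbT.
have u2 : 2 <= uV^-1 by rewrite -[leLHS]invrK lef_pV2 ?posrE ?invr_gt0.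
have u1 : 1 <= uV^-1 by apply: le_trans u2; rewrite ler1n.
have u1' : 1 < uV^-1 by apply: lt_le_trans u2; rewrite ltr1n.
(* With this h the factor 1 + h turns A into A + D. *)
pose h := D / A; have h0 : 0 < h by rewrite divr_gt0.
pose g := (1 + h) / r + m.-1%:R * ((1 + h) * (2^-1 - (uV^-1)^-1)).
have g0 : 0 <= g.
  by rewrite addr_ge0 ?mulr_ge0 ?invr_ge0 ?invrK ?subr_ge0 ?ler0n ?addr_ge0 ?(ltW h0) ?(ltW r0).
have gA : g <= A + D.
  have -> : A + D = (1 + h) * A by rewrite /h mulrDl mul1r divfK// gt_eqF.
  have -> : g = (1 + h) * (r^-1 + (m%:R - 1) * (2^-1 - uV)).
    by rewrite /g invrK mE; ring.
  apply: ler_wpM2l; first by rewrite addr_ge0 ?(ltW h0).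
  by rewrite lerD2l ler_wpM2l// lerD2l lerN2.
pose d := p^-1 - 1 + (uV^-1)^-1.
have dm : d * m%:R <= D.
  by rewrite -ler_pdivlMr// /d invrK; apply: le_trans uVD; rewrite opprB addrC.
have kap : 0 < m%:R - g * s - d * m%:R * s.
  have -> : m%:R - g * s - d * m%:R * s = (m%:R / s - g - d * m%:R) * s.
    by field; rewrite gt_eqF.
  rewrite mulr_gt0//; have : m%:R / s = A + 4 * D by rewrite /D; field; rewrite gt_eqF.
  by lra.
apply: (multiplier_counterexample (hK := hK) (e := e) (u1 := u1) k0 (w := max_weight g)) => //.
- by move=> i; exact: powR_ge0.
- by rewrite invrK -ler_pdivlMl// mulr1 lerBlDr -lerBlDl.
- by apply: diagonal_boundP => //; left.
- by move=> k x; apply: max_weight_fiber.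
move=> C C0; have [n n0 Cn] := powR_unbounded (C `^ s) kap.
exists n; apply: lt_le_trans (max_weight_sum_ge g0 (ltW s0) n0).
rewrite powR_exprn powRM ?powR_ge0 ?(ltW C0)// -powRrM -/d.
have -> : m%:R - g * s = (m%:R - g * s - d * m%:R * s) + d * m%:R * s by ring.
rewrite [ltRHS]powRD ?pnatr_eq0 -?lt0n ?n0 ?implybT//.
by rewrite ltr_pM2r ?powR_gt0 ?ltr0n.
Qed.

Lemma optimal_below : 1 < p ->
  0 < r^-1 - (m%:R - 1) * (1 - p^-1) < s^-1 -> counterexample.
Proof.
move=> p1' /andP[]; set A := r^-1 - _ => A0 As; have [e] := scalar_field_embedding hK.
have c0' : 0 < 1 - p^-1 by rewrite subr_gt0 invf_lt1.
have u2 : 2 <= (1 - p^-1)^-1 by rewrite -[leLHS]invrK lef_pV2 ?posrE ?invr_gt0.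
have u1 : 1 <= (1 - p^-1)^-1 by apply: le_trans u2; rewrite ler1n.
have u1' : 1 < (1 - p^-1)^-1 by apply: lt_le_trans u2; rewrite ltr1n.
(* Strictly between A and 1/s: g/A > 1 keeps the weight in l_(1/A), while g s < 1 lets the sum of
   its s-th powers diverge. Since u = p^*, the weak norms of the test vectors stay bounded. *)
pose g := (A + s^-1) / 2; have [Ag gs] : A < g /\ g < s^-1 by rewrite !midf_lt.
have g0 : 0 < g := lt_trans A0 Ag.
have kap : 0 < 1 - g * s by rewrite subr_gt0 -ltr_pdivlMr// mul1r.
apply: (multiplier_counterexample (hK := hK) (e := e) (u1 := u1) k0
  (w := diagonal_weight k0 g)) => //.
- by move=> i; rewrite /diagonal_weight; case: ifP => // _; exact: powR_ge0.
- by rewrite invrK subKr mulfV// gt_eqF.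
- by apply: diagonal_boundP => //; right; rewrite invrK.
- move=> k x; apply: (@diagonal_weight_fiber _ _ _ hK e _ u1 _ k0 r A^-1 g k x); rewrite ?invr_gt0//.
    by rewrite ltr_pdivlMr// mul1r.
  by rewrite !invrK mE subrK.
move=> C C0; have [n n0 Cn] := powR_unbounded (C `^ s) kap.
exists n; apply: lt_le_trans (diagonal_weight_sum_ge k0 (ltW g0) s0 n0).
have -> : p^-1 - 1 + (1 - p^-1)^-1^-1 = 0 by rewrite invrK; ring.
by rewrite powRr0 expr1n mulr1.
Qed.

End Optimality.

Theorem theorem1p1 (R : realType) (K : numFieldType) (re : K -> R)
    (hK : scalar_field re) :
  (forall (m : nat) (X : 'I_m -> completeNormedModType K)
      (Y : completeNormedModType K) (T : (forall j, X j) -> Y) (q r p t : R),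
    (0 < m)%N -> multilinear T ->
    2 <= q -> cotype re q Y ->
    1 <= r -> 1 <= p -> separately_summing re r p T ->
    p <= t ->
    (q^-1 < r^-1 + inv_conj p - m%:R * inv_conj t ->
      forall s : R,
        s^-1 = (m%:R - 1) / (m%:R * q) + (m%:R * r)^-1
               + inv_conj p / m%:R - inv_conj t ->
        multiple_summing re s (fun=> t) T)
    /\
    (0 < r^-1 + inv_conj p - m%:R * inv_conj t <= q^-1 ->
      forall s : R,
        s^-1 = r^-1 + inv_conj p - m%:R * inv_conj t ->
        multiple_summing re s (fun=> t) T))
  /\
  (forall (m : nat) (p r s s' : R),
    (0 < m)%N -> 1 <= p <= 2 -> p <= r ->
    p^-1 - 2^-1 <= r^-1 -> 0 < r^-1 - (m%:R - 1) * inv_conj p ->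
    (2^-1 < r^-1 + inv_conj p - m%:R * inv_conj p
      /\ s^-1 = (m%:R - 1) / (2 * m%:R) + (m%:R * r)^-1
                + inv_conj p / m%:R - inv_conj p)
    \/
    (0 < r^-1 + inv_conj p - m%:R * inv_conj p <= 2^-1
      /\ s^-1 = r^-1 + inv_conj p - m%:R * inv_conj p) ->
    1 <= s' < s ->
    exists (X : 'I_m -> completeNormedModType K) (Y : completeNormedModType K)
        (T : (forall j, X j) -> Y),
      [/\ cotype re 2 Y, multilinear T, separately_summing re r p T
        & ~ multiple_summing re s' (fun=> p) T]).
Proof.
split=> [m X Y T q r p t m0 hT q2 ct r1 p1 sep pt|m p r s s' m0 p12 pr prV sep0 cases].
  split=> h s.
    exact: (inclusion_above hK hT m0 q2 ct r1 p1 sep pt h).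
  exact: (inclusion_below hK hT m0 q2 ct r1 p1 sep pt h).
move=> /andP[s1 ss]; have s0' : 0 < s' := lt_le_trans ltr01 s1.
have p1 : 1 <= p by case/andP: p12.
have r0 : 0 < r := lt_le_trans (lt_le_trans ltr01 p1) pr.
have mR : 0 < m%:R :> R by rewrite ltr0n.
have m1 : 0 <= m%:R - 1 :> R by rewrite subr_ge0 ler1n.
have ssV : s^-1 < s'^-1 by rewrite ltf_pV2 ?posrE// (lt_trans s0').
have c0 : 0 <= 1 - p^-1 by rewrite subr_ge0 invf_le1// (lt_le_trans ltr01).
rewrite (inv_conjE p1) in sep0 cases.
have above : r <= 2 -> m%:R / s = r^-1 + (m%:R - 1) * (2^-1 - (1 - p^-1)) ->
    exists (X : 'I_m -> completeNormedModType K) (Y : completeNormedModType K)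
      (T : (forall j, X j) -> Y),
    [/\ cotype re 2 Y, multilinear T, separately_summing re r p T
      & ~ multiple_summing re s' (fun=> p) T].
  move=> r2 sE; apply: (optimal_above hK m0 p12 pr prV s0' r2).
  by rewrite -sE ltr_pM2l.
case: cases => [[hr sE]|[/andP[h0 h1] sE]].
  apply: above.
    (* In this range r <= 2 is automatic, since 1/r >= 1/r - (m - 1)/p^* > 1/2. *)
    rewrite -lef_pV2 ?posrE//; apply: ltW; apply: (lt_le_trans hr).
    have -> : r^-1 + (1 - p^-1) - m%:R * (1 - p^-1) = r^-1 - (m%:R - 1) * (1 - p^-1) by ring.
    by rewrite gerBl mulr_ge0.
  by rewrite sE; field; rewrite !gt_eqF// (lt_le_trans ltr01).
have [pE|p1'] := eqVneq p 1; last first.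
  apply: (optimal_below hK m0 p12 pr prV s0'); first by rewrite lt_neqAle eq_sym p1'.
  rewrite sep0/=; apply: le_lt_trans ssV; rewrite sE.
  by rewrite le_eqVlt; apply/orP; left; apply/eqP; ring.
rewrite pE invr1 subrr mulr0 subr0 addr0 in h1 sE.
(* For p = 1 the range gives 1/r <= 1/2 and the hypothesis 1/p - 1/2 <= 1/r gives the converse. *)
have rE : r = 2.
  apply: invr_inj; apply: le_anti; rewrite h1/=.
  by apply: le_trans prV; rewrite pE invr1; lra.
apply: above; first by rewrite rE.
by rewrite sE rE pE invr1; field.
Qed.
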